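(* Let $M$ be a $C^\infty$ real hypersurface in $\mathbb{C}^{n+1}$ ($n\ge1$) and $p\in M$, and suppose $M$ admits a good coordinate at $p$. If the Bloom-Graham type of $M$ at $p$ is infinity, then the following three conditions are equivalent: (i) there exists $\gamma\in\Gamma$ tangent to $M$ at $p$ to infinite order; (ii) there exists a good coordinate $(z,w)$ for $M$ at $p$ and some $\hat\gamma\in\hat\Gamma$ such that $(F\circ\hat\gamma)(t)$ is flat at $t=0$; (iii) there exists a good coordinate $(z,w)$ for $M$ at $p$ and some $\hat\gamma\in\hat\Gamma$ such that the formal power series $(\mathcal{S}\circ\hat\gamma)(t)$ converges on an open neighborhood of $t=0$.
   Context: A good coordinate for $M$ at $p$ is a holomorphic coordinate $(z,w)=(z_1,\dots,z_n,w)$ centered at $p$ in which $M$ has the local defining function $r=2\operatorname{Re}(w)+F(z,\bar z)$, with $F$ real-valued $C^\infty$ near $0\in\mathbb{C}^n$, $F(0)=0$, $\nabla F(0)=0$. Bloom-Graham type: an $n$-dimensional complex submanifold $X\ni p$ is tangent to $M$ at $p$ to order $m$ if $r|_X$ vanishes to order at least $m$ at $p$; the type is infinity if such $X$ exist for every $m$. When the Bloom-Graham type is infinity, the Taylor series of $F$ at $0$ consists only of pure terms (monomials $z^\alpha$ or $\bar z^\beta$) and can be written $2\sum_{\alpha\in\mathbb{Z}_+^n}\operatorname{Re}(c_\alpha z^\alpha)$ with $c_\alpha\in\mathbb{C}$; set $\mathcal{S}(z)=\sum_\alpha c_\alpha z^\alpha$ (formal). $\hat\Gamma$ is the set of germs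 of nonconstant holomorphic maps $\hat\gamma=(\hat\gamma_1,\dots,\hat\gamma_n):(\mathbb{C},0)\to(\mathbb{C}^n,0)$; if $\hat\gamma_j(t)=\sum_{k\ge1}a_{jk}t^k$, then $(\mathcal{S}\circ\hat\gamma)(t)=\sum_\alpha c_\alpha\prod_j(\sum_k a_{jk}t^k)^{\alpha_j}$, expanded formally as a power series in $t$. A smooth function of $t$ is flat at $0$ if all its Taylor coefficients at $0$ vanish. $\Gamma$ is the set of germs of nonconstant holomorphic maps $\gamma:(\mathbb{C},0)\to(\mathbb{C}^{n+1},p)$ (good parametrization); $\gamma$ is tangent to $M$ at $p$ to infinite order if $(r\circ\gamma)(t)=O(t^N)$ as $t\to0$ for all $N\in\mathbb{N}$. *)

(* Defs.v *)
(* R : realType, C := R[i] (mathcomp-real-closed),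
   viewed as a numClosedFieldType so that MathComp-Analysis equips C, C^k = 'rV[C]_k
   with their normed-module structures OVER C (so `differentiable` = complex
   differentiability = holomorphy). *)
From mathcomp Require Import all_boot all_order all_algebra.
From mathcomp Require Import all_classical all_reals all_analysis.
From mathcomp Require Import complex.
Import Order.TTheory GRing.Theory Num.Theory.
Import numFieldNormedType.Exports.
Local Open Scope ring_scope.
Local Open Scope complex_scope.
Local Open Scope classical_set_scope.

Set Implicit Arguments.
Unset Strict Implicit.
Unset Printing Implicit Defensive.

Definition Cplx (R : realType) : numClosedFieldType := (R[i] : numClosedFieldType).

Section Defs.
Variable R : realType.
Local Notation C := (Cplx R).

Definition liftC {V : Type} (f : V -> R) : V -> C := fun x => (f x)%:C.

Definition dquot {V : normedModType C} (g : V -> C) (v x : V) : R -> C :=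
  fun h => (h%:C)^-1 * (g (x + h%:C *: v) - g x).
Definition rderivable {V : normedModType C} (g : V -> C) (v x : V) : Prop :=
  cvg (dquot g v x @ 0^').
Definition rdiff {V : normedModType C} (g : V -> C) (v x : V) : C :=
  lim (dquot g v x @ 0^').

Fixpoint iterD {V : normedModType C} (g : V -> C) (s : seq V) : V -> C :=
  if s is v :: s' then rdiff (iterD g s') v else g.

Definition smooth_on {V : normedModType C} (U : set V) (g : V -> C) : Prop :=
  forall (s : seq V) (v x : V), U x ->
    rderivable (iterD g s) v x /\ {for x, continuous (iterD g s)}.
Definition smooth_at {V : normedModType C} (g : V -> C) (a : V) : Prop :=
  exists U : set V, [/\ open U, U a & smooth_on U g].

Definition holo_at {V W : normedModType C} (f : V -> W) (a : V) : Prop :=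
  \forall x \near a, differentiable f x.

Definition real_hypersurface (n : nat) (M : set 'rV[C]_n) : Prop :=
  forall q, M q -> exists r : 'rV[C]_n -> R,
    [/\ smooth_at (liftC r) q, (exists v, rdiff (liftC r) v q != 0)
      & \forall x \near q, (M x <-> r x = 0)].

Definition zpart (n : nat) (x : 'rV[C]_(n + 1)) : 'rV[C]_n := lsubmx x.
Definition wpart (n : nat) (x : 'rV[C]_(n + 1)) : C := rsubmx x ord0 ord0.

Definition defr (n : nat) (Phi : 'rV[C]_(n + 1) -> 'rV[C]_(n + 1))
  (F : 'rV[C]_n -> R) (x : 'rV[C]_(n + 1)) : R :=
  2 * complex.Re (wpart (Phi x)) + F (zpart (Phi x)).

Definition good_coord (n : nat) (M : set 'rV[C]_(n + 1)) (p : 'rV[C]_(n + 1))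
  (Phi : 'rV[C]_(n + 1) -> 'rV[C]_(n + 1)) (F : 'rV[C]_n -> R) : Prop :=
  [/\ Phi p = 0, holo_at Phi p,
      (exists Psi : 'rV[C]_(n + 1) -> 'rV[C]_(n + 1),
         [/\ holo_at Psi 0, Psi 0 = p,
             (\forall x \near p, Psi (Phi x) = x)
           & (\forall y \near (0 : 'rV[C]_(n + 1)), Phi (Psi y) = y)]),
      smooth_at (liftC F) 0 /\ F 0 = 0 /\ (forall v, rdiff (liftC F) v 0 = 0)
    & \forall x \near p, (M x <-> defr Phi F x = 0)].

(* germ of an n-dimensional complex submanifold X through p, given by a
   holomorphic immersion phi : (C^n, 0) -> (C^(n+1), p) (X = image of phi) *)
Definition cx_submfd_param (n : nat) (p : 'rV[C]_(n + 1))
  (phi : 'rV[C]_n -> 'rV[C]_(n + 1)) : Prop :=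
  [/\ holo_at phi 0, phi 0 = p & injective ('d phi 0)].

Definition vanish_order (n : nat) (r : 'rV[C]_(n + 1) -> R)
  (phi : 'rV[C]_n -> 'rV[C]_(n + 1)) (m : nat) : Prop :=
  exists K : R, \forall zeta \near (0 : 'rV[C]_n),
    (`|r (phi zeta)|)%:C <= K%:C * `|zeta| ^+ m.

Definition BG_type_infinite (n : nat) (r : 'rV[C]_(n + 1) -> R)
  (p : 'rV[C]_(n + 1)) : Prop :=
  forall m : nat, exists phi, cx_submfd_param p phi /\ vanish_order r phi m.

Definition Gamma (k : nat) (q : 'rV[C]_k) (g : C -> 'rV[C]_k) : Prop :=
  [/\ holo_at g 0, g 0 = q & ~ (\forall t \near (0 : C), g t = q)].

Definition tangent_inf (k : nat) (r : 'rV[C]_k -> R) (g : C -> 'rV[C]_k) : Prop :=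
  forall N : nat, exists K : R, \forall t \near (0 : C),
    (`|r (g t)|)%:C <= K%:C * `|t| ^+ N.

Definition flat_at (g : C -> C) (a : C) : Prop :=
  forall s : seq C, iterD g s a = 0.

(* Wirtinger derivative d/dz_j = 1/2 (d/dx_j - i d/dy_j) *)
Definition wirt (n : nat) (j : 'I_n) (g : 'rV[C]_n -> C) : 'rV[C]_n -> C :=
  fun x => 2^-1 * (rdiff g (delta_mx 0 j) x - 'i * rdiff g ('i *: delta_mx 0 j) x).
Definition midx (n : nat) (al : 'I_n -> nat) : seq 'I_n :=
  flatten [seq nseq (al j) j | j <- enum 'I_n].
Definition wirtL (n : nat) (g : 'rV[C]_n -> C) (s : seq 'I_n) : 'rV[C]_n -> C :=
  foldr (fun j h => wirt j h) g s.

(* c_alpha: the Taylor coefficient of z^alpha (pure holomorphic term) of F at 0,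
   i.e. (1/alpha!) d^alpha F / dz^alpha (0); c_0 := 0 (F(0) = 0). *)
Definition Scoef (n : nat) (F : 'rV[C]_n -> R) (al : 'I_n -> nat) : C :=
  if (\sum_j al j == 0)%N then 0
  else wirtL (liftC F) (midx al) 0 / (\prod_j (al j)`!)%:R.

Definition taylorc (f : C -> C) (l : nat) : C := derive1n l f 0 / (l`!)%:R.

(* coefficient of t^k in the formal composition (S o gh)(t)
   = sum_alpha c_alpha prod_j (sum_l a_jl t^l)^alpha_j, gh(0) = 0;
   only |alpha| <= k and a_jl with l <= k contribute *)
Definition compcoef (n : nat) (F : 'rV[C]_n -> R) (gh : C -> 'rV[C]_n) (k : nat) : C :=
  \sum_(al : {ffun 'I_n -> 'I_k.+1} | (\sum_j (al j : nat) <= k)%N)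
    Scoef F (fun j => al j : nat) *
    (\prod_j (\poly_(l < k.+1) taylorc (fun t => gh t 0 j) l) ^+ (al j))`_k.

Definition S_comp_converges (n : nat) (F : 'rV[C]_n -> R) (gh : C -> 'rV[C]_n) : Prop :=
  exists rho : R, 0 < rho /\
    forall t : C, `|t| < rho%:C -> cvgn (series (fun k => compcoef F gh k * t ^+ k)).

End Defs.

(* Main.v *)
Require Import Defs.
From mathcomp Require Import all_boot all_order all_algebra.
From mathcomp Require Import all_classical all_reals all_analysis.
From mathcomp Require Import complex ring lra zify.
Import Order.TTheory GRing.Theory Num.Theory.
Import numFieldNormedType.Exports.
Local Open Scope ring_scope.
Local Open Scope classical_set_scope.

(* (ii) => (i): lift [gh] to the complex hypersurface w = 0 of the good coordinate.
   Changing good coordinates multiplies defining functions by bounded factors near p,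
   because moving w by - r / 2 lands on M; so tangency and type do not depend on them.
   (i) => (iii): infinite type makes the Taylor series of F pure, F ~ 2 Re S, by
   testing it on curves z = t v + O(t^2) inside tangent submanifolds.  Along a tangent
   gamma = (gh, h) one has Re (h + S o gh) = O(t^N) for all N, hence S o gh = - h
   formally, and h converges.
   (iii) => (ii): S o gh is a convergent series lying in the formal closure of the
   algebra B of all P o gh with P a polynomial without terms of degree < 2.  If x is a
   coordinate of gh of order d, the orders of elements of B are governed mod d by
   finitely many of them, so division by x eventually stays in the closure.  Iterating
   f = sum_{e < L} c_e p_e + x f' with norm bounds gives S o gh = sum_e q_e(x) p_e with
   q_e convergent, i.e. S o gh = G o gh with G holomorphic on C^n.  The change of
   coordinate w -> w + G(z) turns F into F - 2 Re G, which is flat along gh.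
   One-variable complex analysis (Goursat, power series) is proved from scratch without
   contour integrals: a primitive along each path plays the role of the integral. *)

(** The obstacle is (iii) => (ii). The series [S] may diverge in n variables, and convergence of
    [S o gh] says nothing about [S] off the curve, so [S] cannot serve as the change of coordinate:
    another holomorphic [G] with the same values along [gh] has to be found. Algebraically, a
    convergent series in t that is a t-adic limit of polynomials in [gh] must be a convergent series
    in [gh]. This is within reach because C{t} is a finite module over C{x}, of rank d = ord x, so
    that division by the single element x controls everything. The bounds have to be uniform in the
    dividend, since the division is repeated infinitely often. Terms of degree 0 and 1 are kept out
    throughout, since [G] must vanish to order 2 for the new [F] to have zero gradient. [F] itself
    is only smooth, so no identity of power series is available for it: every comparison is an
    estimate O(|t|^N), one N at a time, and a coefficient is identified once N exceeds its index. *)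

Section Lemmas.
Local Set Implicit Arguments.
Local Unset Strict Implicit.
Local Unset Printing Implicit Defensive.
Local Open Scope complex_scope.
Local Open Scope classical_set_scope.

(** * The norm of a complex normed module as a real number *)

Section RealNorm.
Variable R : realType.
Local Notation C := (Cplx R).

(** [|x|] is an element of [C], whose order is partial. Its real part carries the same information
    by [rnE] and lives in [R], where [lra] and [nra] apply. *)
Definition rn (V : normedZmodType C) (x : V) : R := complex.Re `|x|.

Lemma rnE (V : normedZmodType C) (x : V) : `|x| = (rn x)%:C.
Proof. by rewrite /rn; have := ger0_Im (normr_ge0 x); case: (`|x|) => a b /= ->. Qed.

Lemma lecP (V : normedZmodType C) (x : V) (k : R) : (`|x| <= k%:C) = (rn x <= k).
Proof. by rewrite rnE lecR. Qed.
Lemma ltcP (V : normedZmodType C) (x : V) (k : R) : (`|x| < k%:C) = (rn x < k).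
Proof. by rewrite rnE ltcR. Qed.
Lemma rn_ge0 (V : normedZmodType C) (x : V) : 0 <= rn x.
Proof. by rewrite -ler0c -rnE. Qed.
Lemma rn0 (V : normedZmodType C) : rn (0 : V) = 0.
Proof. by rewrite /rn normr0. Qed.
Lemma rn_eq0 (V : normedZmodType C) (x : V) : (rn x == 0) = (x == 0).
Proof. by rewrite -(normr_eq0 x) rnE -(inj_eq (@complexI R)). Qed.
Lemma rn_gt0 (V : normedZmodType C) (x : V) : (0 < rn x) = (x != 0).
Proof. by rewrite lt_neqAle rn_ge0 andbT eq_sym rn_eq0. Qed.
Lemma rnN (V : normedZmodType C) (x : V) : rn (- x) = rn x.
Proof. by rewrite /rn normrN. Qed.
Lemma rnBC (V : normedZmodType C) (x y : V) : rn (x - y) = rn (y - x).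
Proof. by rewrite -rnN opprB. Qed.
Lemma rnD (V : normedZmodType C) (x y : V) : rn (x + y) <= rn x + rn y.
Proof. by rewrite -lecP (le_trans (ler_normD _ _)) // !rnE rmorphD. Qed.
Lemma rnB (V : normedZmodType C) (x y : V) : rn (x - y) <= rn x + rn y.
Proof. by rewrite (le_trans (rnD _ _)) // rnN. Qed.
Lemma rn_trans (V : normedZmodType C) (y x z : V) : rn (x - z) <= rn (x - y) + rn (y - z).
Proof. by rewrite (le_trans _ (rnD _ _)) // addrA subrK. Qed.
Lemma rn_le (V : normedZmodType C) (x y : V) : rn x <= rn (x - y) + rn y.
Proof. by rewrite (le_trans _ (rnD _ _)) // subrK. Qed.
Lemma rnM (x y : C) : rn (x * y) = rn x * rn y.
Proof. by apply: (@complexI R); rewrite -rnE normrM !rnE rmorphM. Qed.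
Lemma rnZ (V : normedModType C) (k : C) (x : V) : rn (k *: x) = rn k * rn x.
Proof. by apply: (@complexI R); rewrite -rnE normrZ !rnE rmorphM. Qed.
Lemma rn1 : rn (1 : C) = 1.
Proof. by rewrite /rn normr1. Qed.
Lemma rnX (x : C) n : rn (x ^+ n) = rn x ^+ n.
Proof. by elim: n => [|n IH]; rewrite ?expr0 ?rn1 // !exprS rnM IH. Qed.
Lemma rnV (x : C) : rn (x^-1) = (rn x)^-1.
Proof. by apply: (@complexI R); rewrite -rnE normfV rnE fmorphV. Qed.
Lemma rn_real (k : R) : rn (k%:C : C) = `|k|.
Proof. by rewrite /rn normc_def /= expr0n addr0 sqrtr_sqr. Qed.
Lemma rn_nat n : rn (n%:R : C) = n%:R.
Proof. by rewrite /rn normr_nat -(rmorph_nat (real_complex R)). Qed.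
Lemma rn_sum (V : normedZmodType C) (I : Type) (r : seq I) (P : pred I) (F : I -> V) :
  rn (\sum_(i <- r | P i) F i) <= \sum_(i <- r | P i) rn (F i).
Proof.
elim/big_rec2: _ => [|i y x _ H]; first by rewrite rn0.
by rewrite (le_trans (rnD _ _)) // lerD2l.
Qed.
Lemma cReD (x y : C) : complex.Re (x + y) = complex.Re x + complex.Re y.
Proof. by case: x y => a b [c d]. Qed.
Lemma cReN (x : C) : complex.Re (- x) = - complex.Re x.
Proof. by case: x. Qed.
Lemma cReB (x y : C) : complex.Re (x - y) = complex.Re x - complex.Re y.
Proof. by rewrite cReD cReN. Qed.
Lemma cImD (x y : C) : complex.Im (x + y) = complex.Im x + complex.Im y.
Proof. by case: x y => a b [c d]. Qed.
Lemma cImN (x : C) : complex.Im (- x) = - complex.Im x.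
Proof. by case: x. Qed.
Lemma cReZ (k : R) (x : C) : complex.Re (k%:C * x) = k * complex.Re x.
Proof. by case: x => a b /=; rewrite mul0r subr0. Qed.
Lemma cImZ (k : R) (x : C) : complex.Im (k%:C * x) = k * complex.Im x.
Proof. by case: x => a b /=; rewrite mul0r addr0. Qed.
Lemma cRe_sum (I : Type) (r : seq I) (P : pred I) (F : I -> C) :
  complex.Re (\sum_(i <- r | P i) F i) = \sum_(i <- r | P i) complex.Re (F i).
Proof. by elim/big_rec2: _ => [//|i y x _ <-]; rewrite cReD. Qed.
Lemma Re_le (x : C) : `|complex.Re x| <= rn x.
Proof. by have := normc_ge_Re x; rewrite -lecR -rnE. Qed.
Lemma rnJ (x : C) : rn (x^*%C : C) = rn x.
Proof. by rewrite /rn normcJ. Qed.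
Lemma sqr_rn (x : C) : rn x ^+ 2 = complex.Re x ^+ 2 + complex.Im x ^+ 2.
Proof.
by rewrite /rn normc_def /= sqr_sqrtr // addr_ge0 // sqr_ge0.
Qed.
Lemma Im_le (x : C) : `|complex.Im x| <= rn x.
Proof.
rewrite -(@ler_pXn2r _ 2) ?nnegrE ?rn_ge0 //.
by rewrite sqr_rn real_normK ?num_real // lerDr sqr_ge0.
Qed.
Lemma rn_le_ReIm (x : C) : rn x <= `|complex.Re x| + `|complex.Im x|.
Proof.
rewrite -(@ler_pXn2r _ 2) ?nnegrE ?rn_ge0 ?addr_ge0 //.
rewrite sqr_rn -[complex.Re x ^+ 2]real_normK ?num_real // -[complex.Im x ^+ 2]real_normK ?num_real //.
have := normr_ge0 (complex.Re x); have := normr_ge0 (complex.Im x); nra.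
Qed.
Lemma rn_i : rn ('i%C : C) = 1.
Proof. by apply/eqP; rewrite -(@eqrXn2 _ 2) ?rn_ge0 //; rewrite sqr_rn /= expr0n /= add0r expr1n. Qed.

Lemma Re2 (x : C) : (2 * complex.Re x)%:C = x + x^*%C :> C.
Proof. by rewrite addcJ rmorphM rmorph_nat. Qed.

Lemma nearP (V : normedModType C) (a : V) (P : V -> Prop) :
  (\forall x \near a, P x) <-> exists2 d : R, 0 < d & forall x, rn (x - a) < d -> P x.
Proof.
split=> [/nbhs_normP [e /= e0 H]|[d d0 H]].
  have ee : e = (complex.Re e)%:C by have := ger0_Im (ltW e0); case: e {e0 H} => u v /= ->.
  exists (complex.Re e); first by move: e0; rewrite ee /= -ltcR.
  by move=> x xa; apply: H; rewrite /= ee distrC ltcP.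
by apply/nbhs_normP; exists d%:C => [|x /=]; rewrite /= ?ltr0c ?ltcR // distrC ltcP => /H.
Qed.

Lemma near0P (V : normedModType C) (P : V -> Prop) :
  (\forall x \near (0 : V), P x) <-> exists2 d : R, 0 < d & forall x, rn x < d -> P x.
Proof.
rewrite nearP; split=> -[d d0 H]; exists d => // x; have := H x; rewrite subr0; exact.
Qed.

Lemma contP (V W : normedModType C) (f : V -> W) (a : V) :
  {for a, continuous f} <-> forall e : R, 0 < e -> exists2 d : R, 0 < d &
     forall x, rn (x - a) < d -> rn (f x - f a) < e.
Proof.
split=> [fa e e0|H].
  have e0' : (0 : C) < e%:C by rewrite ltcR.
  have /cvgrPdist_lt/(_ _ e0')/nearP := fa.
  by case=> d d0 Hd; exists d => // x /Hd; rewrite distrC ltcP.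
apply/cvgrPdist_lt => e e0.
have ee : e = (complex.Re e)%:C by have := ger0_Im (ltW e0); case: e {e0} => u v /= ->.
move: e0; rewrite ee ltcR => /H [d d0 Hd].
by apply/nearP; exists d => // x /Hd; rewrite distrC ltcP.
Qed.

End RealNorm.

(** * Derivatives along the real line and in the complex plane *)

Section Deriv.
Variable R : realType.
Local Notation C := (Cplx R).

Lemma eqW (x y : R) : x = y -> x <= y.
Proof. by move->. Qed.

(** [L] ranges over arbitrary maps, so that one notion covers complex differentials and the
    real-linear differential [dL] of a smooth function. *)
Definition fD (V W : normedModType C) (f : V -> W) (x : V) (L : V -> W) :=
  forall e : R, 0 < e -> exists2 d : R, 0 < d &
    forall h, rn h < d -> rn (f (x + h) - f x - L h) <= e * rn h.

Definition cD (f : C -> C) (z l : C) := fD f z (fun h => h * l).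

(** Derivative in a real variable with values in a complex normed module, the real scalars acting
    through [%:C]. Paths of integration and directional derivatives are both expressed by it. *)
Definition rD (W : normedModType C) (g : R -> W) (x : R) (l : W) :=
  forall e : R, 0 < e -> exists2 d : R, 0 < d &
    forall h, `|h| < d -> rn (g (x + h) - g x - h%:C *: l) <= e * `|h|.

Lemma differentiable_fD (V W : normedModType C) (f : V -> W) x :
  differentiable f x -> fD f x ('d f x).
Proof.
move=> /diff_locallyP [_ /eqaddoP H] e e0.
have e0' : (0 : C) < e%:C by rewrite ltcR.
have /near0P [d d0 Hd] := H _ e0'.
exists d => // h /Hd; rewrite /= !fctE /=.
by rewrite [h + x]addrC opprD addrA !rnE -rmorphM lecR.
Qed.

Lemma rderiv_is_derive (g : R -> R) (x l : R) :
  (forall e : R, 0 < e -> exists2 d : R, 0 < d &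
    forall h, `|h| < d -> `|g (x + h) - g x - h * l| <= e * `|h|) ->
  is_derive x 1 g l.
Proof.
move=> H.
have cv : h^-1 *: (g (h *: 1 + x) - g x) @[h --> 0^'] --> l.
  apply/cvgrPdist_le => e e0; have [d d0 Hd] := H e e0.
  apply/nbhs_ballP; exists d => //= h; rewrite /ball /= sub0r normrN => hd h0.
  have := Hd h hd; rewrite -[h *: 1]/(h * 1) mulr1 [h + x]addrC.
  have h0' : 0 < `|h| by rewrite normr_gt0.
  rewrite distrC -[h^-1 *: _]/(h^-1 * _) => Hh.
  rewrite -(ler_pM2r h0') -normrM mulrBl mulrAC mulVf // mul1r (mulrC l) //.
by split; [apply/cvg_ex; exists l | exact: cvg_lim cv].
Qed.

Lemma is_derive_rderiv (g : R -> R) (x l : R) :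
  is_derive x 1 g l ->
  (forall e : R, 0 < e -> exists2 d : R, 0 < d &
    forall h, `|h| < d -> `|g (x + h) - g x - h * l| <= e * `|h|).
Proof.
move=> [gx gl] e e0.
have /cvg_ex [l' cv] := gx.
have ll : l' = l by rewrite -gl; symmetry; exact: cvg_lim cv.
move: cv; rewrite ll => /cvgrPdist_le /(_ _ e0) /nbhs_ballP [d /= d0 Hd].
exists d => // h hd; have [->|h0] := eqVneq h 0.
  by rewrite addr0 subrr mul0r subrr !normr0 mulr0.
have h0' : 0 < `|h| by rewrite normr_gt0.
have := Hd h; rewrite /ball /= sub0r normrN => /(_ hd h0).
rewrite -[h *: 1]/(h * 1) mulr1 [h + x]addrC -[h^-1 *: _]/(h^-1 * _).
by rewrite -(ler_pM2r h0') -normrM mulrBl mulrAC mulVf // mul1r (mulrC l) distrC.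
Qed.

Lemma rD_Re (g : R -> C) (x : R) (l : C) : rD g x l ->
  is_derive x 1 (fun s => complex.Re (g s)) (complex.Re l).
Proof.
move=> H; apply: rderiv_is_derive => e /H [d d0 Hd]; exists d => // h /Hd.
apply: le_trans; rewrite -!cReB -cReZ -cReB; exact: Re_le.
Qed.

Section rDops.
Variable W : normedModType C.
Implicit Types (g : R -> W) (x : R) (l : W).

Lemma rD_cst c x : rD (fun=> c : W) x 0.
Proof.
move=> e e0; exists 1 => // h _; rewrite subrr scaler0 subrr rn0.
by rewrite mulr_ge0 // ltW.
Qed.

Lemma rD_ext g1 g2 x l : (exists2 d, 0 < d & forall h, `|h| < d -> g1 (x + h) = g2 (x + h)) ->
  rD g1 x l -> rD g2 x l.
Proof.
move=> [d0 d00 E] H e e0; have [d d1 Hd] := H e e0.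
exists (Num.min d d0); first by rewrite lt_min d1.
move=> h; rewrite lt_min => /andP [h1 h2]; rewrite -E // -(addr0 x) -E ?normr0 ?addr0 //.
exact: Hd.
Qed.

Lemma rD_add g1 g2 x l1 l2 : rD g1 x l1 -> rD g2 x l2 ->
  rD (fun s => g1 s + g2 s) x (l1 + l2).
Proof.
move=> H1 H2 e e0; have e2 : 0 < e / 2 by lra.
have [d1 d10 Hd1] := H1 _ e2; have [d2 d20 Hd2] := H2 _ e2.
exists (Num.min d1 d2); first by rewrite lt_min d10.
move=> h; rewrite lt_min => /andP [/Hd1 h1 /Hd2 h2].
have -> : g1 (x + h) + g2 (x + h) - (g1 x + g2 x) - h%:C *: (l1 + l2) =
  (g1 (x + h) - g1 x - h%:C *: l1) + (g2 (x + h) - g2 x - h%:C *: l2).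
  by rewrite scalerDr !opprD (addrACA (g1 (x + h))) [LHS]addrACA.
by apply: le_trans (rnD _ _) _; lra.
Qed.

Lemma rD_scale (k : C) g x l : rD g x l -> rD (fun s => k *: g s) x (k *: l).
Proof.
move=> H e e0; have k1 : 0 < rn k + 1 by rewrite ltr_wpDl ?rn_ge0.
have [|d d0 Hd] := H (e / (rn k + 1)); first by rewrite divr_gt0.
exists d => // h /Hd hd; rewrite scalerA mulrC -scalerA -!scalerBr rnZ.
apply: (@le_trans _ _ ((rn k + 1) * (e / (rn k + 1) * `|h|))).
  by apply: ler_pM; rewrite ?rn_ge0 // lerDl.
by rewrite mulrA mulrCA divff ?mulr1 // gt_eqF.
Qed.

Lemma rD_opp g x l : rD g x l -> rD (fun s => - g s) x (- l).
Proof.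
move=> /(rD_scale (-1)); rewrite scaleN1r; apply: rD_ext; exists 1 => // h _.
by rewrite scaleN1r.
Qed.

Lemma rD_bound g x l : rD g x l -> exists2 d, 0 < d &
  forall h, `|h| < d -> rn (g (x + h) - g x) <= (rn l + 1) * `|h|.
Proof.
move=> /(_ 1 ltr01) [d d0 Hd]; exists d => // h /Hd H.
rewrite -[_ - g x](subrK (h%:C *: l)) (le_trans (rnD _ _)) // rnZ rn_real.
by lra.
Qed.

Lemma rD_cont g x l : rD g x l -> forall e, 0 < e -> exists2 d, 0 < d &
  forall h, `|h| < d -> rn (g (x + h) - g x) < e.
Proof.
move=> /rD_bound [d d0 Hd] e e0; have l1 : 0 < rn l + 1 by rewrite ltr_wpDl ?rn_ge0.
exists (Num.min d (e / (rn l + 1))); first by rewrite lt_min d0 divr_gt0.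
move=> h; rewrite lt_min => /andP [/Hd h1]; rewrite ltr_pdivlMr // mulrC => h2.
exact: le_lt_trans h1 h2.
Qed.

End rDops.

(** Along a real path the chain rule asks of [L] additivity, homogeneity over the reals and
    boundedness. This is the right generality because differentials of smooth functions are in
    general not complex linear. *)
Lemma rD_comp_fD (V W : normedModType C) (f : V -> W) (P : R -> V) x p (L : V -> W) (K : R) :
  rD P x p -> fD f (P x) L ->
  (forall u v, L (u + v) = L u + L v) -> (forall k : R, forall v, L (k%:C *: v) = k%:C *: L v) ->
  (forall v, rn (L v) <= K * rn v) ->
  rD (fun s => f (P s)) x (L p).
Proof.
move=> HP Hf LD LZ LK e e0.
have K0 : 0 < `|K| + 1 by rewrite ltr_wpDl.
have p0 : 0 < rn p + 1 by rewrite ltr_wpDl ?rn_ge0.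
have [|d1 d10 Hd1] := Hf (e / 2 / (rn p + 1)); first by rewrite divr_gt0 //; lra.
have [d2 d20 Hd2] := rD_bound HP.
have [|d3 d30 Hd3] := rD_cont HP (e := d1) => //.
have [|d4 d40 Hd4] := HP (e / 2 / (`|K| + 1)); first by rewrite divr_gt0 //; lra.
exists (Num.min (Num.min d2 d3) d4); first by rewrite !lt_min d20 d30.
move=> h; rewrite !lt_min => /andP [/andP [/Hd2 A2 /Hd3 A3] /Hd4 A4].
have A1 := Hd1 _ A3; rewrite [P x + _]addrC subrK in A1.
rewrite -LZ.
have -> : f (P (x + h)) - f (P x) - L (h%:C *: p) =
  (f (P (x + h)) - f (P x) - L (P (x + h) - P x)) + L (P (x + h) - P x - h%:C *: p).
  have ED : L (P (x + h) - P x) = L (P (x + h) - P x - h%:C *: p) + L (h%:C *: p).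
    by rewrite -LD subrK.
  by rewrite ED opprD addrA [RHS]addrAC subrK.
have B1 : rn (f (P (x + h)) - f (P x) - L (P (x + h) - P x)) <= e / 2 * `|h|.
  apply: le_trans A1 _; rewrite mulrAC -mulrA ler_pM2l //; last by lra.
  by rewrite ler_pdivrMr // mulrC.
have B2 : rn (L (P (x + h) - P x - h%:C *: p)) <= e / 2 * `|h|.
  apply: le_trans (LK _) _.
  apply: (@le_trans _ _ ((`|K| + 1) * (e / 2 / (`|K| + 1) * `|h|))).
    apply: (@le_trans _ _ ((`|K| + 1) * rn (P (x + h) - P x - h%:C *: p))).
      by apply: ler_wpM2r; rewrite ?rn_ge0 // ler_wpDr // ler_norm.
    by rewrite ler_pM2l.
  by apply: eqW; field; rewrite gt_eqF.
by apply: le_trans (rnD _ _) _; lra.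
Qed.

Lemma rD_mulC (k : C) (g : R -> C) x (l : C) : rD g x l -> rD (fun s => k * g s) x (k * l).
Proof. exact: rD_scale. Qed.

Lemma rD_id (x : R) : rD (fun s => s%:C : C) x 1.
Proof.
move=> e e0; exists 1 => // h _.
rewrite -[h%:C *: _]/(h%:C * 1) mulr1 rmorphD /= [x%:C + _]addrC addrK subrr rn0.
by rewrite mulr_ge0 // ltW.
Qed.

Lemma rD_mul (g1 g2 : R -> C) x (l1 l2 : C) : rD g1 x l1 -> rD g2 x l2 ->
  rD (fun s => g1 s * g2 s) x (l1 * g2 x + g1 x * l2).
Proof.
move=> H1 H2 e e0.
have K1 : 0 < rn (g2 x) + 1 by rewrite ltr_wpDl ?rn_ge0.
have K2 : 0 < rn (g1 x) + 1 by rewrite ltr_wpDl ?rn_ge0.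
have K3 : 0 < rn l1 + 1 by rewrite ltr_wpDl ?rn_ge0.
have [|d1 d10 Hd1] := H1 (e / 3 / (rn (g2 x) + 1)); first by rewrite divr_gt0 //; lra.
have [|d2 d20 Hd2] := H2 (e / 3 / (rn (g1 x) + 1)); first by rewrite divr_gt0 //; lra.
have [d3 d30 Hd3] := rD_bound H1.
have [|d4 d40 Hd4] := rD_cont H2 (e := e / 3 / (rn l1 + 1)).
  by rewrite divr_gt0 //; lra.
exists (Num.min (Num.min d1 d2) (Num.min d3 d4)); first by rewrite !lt_min d10 d20 d30.
move=> h; rewrite !lt_min => /andP [/andP [/Hd1 A1 /Hd2 A2] /andP [/Hd3 A3 /Hd4 A4]].
rewrite -[h%:C *: _]/(h%:C * _).
have -> : g1 (x + h) * g2 (x + h) - g1 x * g2 x - h%:C * (l1 * g2 x + g1 x * l2) =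
  (g1 (x + h) - g1 x - h%:C * l1) * g2 x + g1 x * (g2 (x + h) - g2 x - h%:C * l2) +
  (g1 (x + h) - g1 x) * (g2 (x + h) - g2 x) by ring.
have B1 : rn ((g1 (x + h) - g1 x - h%:C * l1) * g2 x) <= e / 3 * `|h|.
  rewrite rnM; apply: (@le_trans _ _ (e / 3 / (rn (g2 x) + 1) * `|h| * (rn (g2 x) + 1))).
    by apply: ler_pM; rewrite ?rn_ge0 // lerDl.
  by apply: eqW; field; rewrite gt_eqF.
have B2 : rn (g1 x * (g2 (x + h) - g2 x - h%:C * l2)) <= e / 3 * `|h|.
  rewrite rnM; apply: (@le_trans _ _ ((rn (g1 x) + 1) * (e / 3 / (rn (g1 x) + 1) * `|h|))).
    by apply: ler_pM; rewrite ?rn_ge0 // lerDl.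
  by apply: eqW; field; rewrite gt_eqF.
have B3 : rn ((g1 (x + h) - g1 x) * (g2 (x + h) - g2 x)) <= e / 3 * `|h|.
  rewrite rnM; apply: (@le_trans _ _ ((rn l1 + 1) * `|h| * (e / 3 / (rn l1 + 1)))).
    by apply: ler_pM; rewrite ?rn_ge0 // ltW.
  by apply: eqW; field; rewrite gt_eqF.
apply: le_trans (rnD _ _) _; apply: (@le_trans _ _ (e / 3 * `|h| + e / 3 * `|h| + e / 3 * `|h|)).
  by apply: lerD => //; apply: le_trans (rnD _ _) _; apply: lerD.
lra.
Qed.

Lemma rD_comp_cD (f : C -> C) (P : R -> C) x (p l : C) :
  rD P x p -> cD f (P x) l -> rD (fun s => f (P s)) x (p * l).
Proof.
move=> HP Hf; apply: (rD_comp_fD (K := rn l) HP Hf) => [u v|k v|v].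
- by rewrite mulrDl.
- by rewrite -!/(_ * _) -scalerAl.
- by rewrite rnM mulrC.
Qed.

Lemma rD_line (V : normedModType C) (x v : V) s : rD (fun h : R => x + h%:C *: v) s v.
Proof.
move=> e e0; exists 1 => // h _.
rewrite opprD addrACA subrr add0r rmorphD scalerDl [X in X - _]addrC addKr subrr rn0.
by rewrite mulr_ge0 // ltW.
Qed.

Lemma MVT_Re (g : R -> C) (g' : R -> C) (a b : R) : a <= b ->
  (forall x, a <= x <= b -> rD g x (g' x)) ->
  exists2 c, a <= c <= b & complex.Re (g b - g a) = complex.Re (g' c) * (b - a).
Proof.
move=> ab H.
have dr x : x \in `]a, b[%R -> is_derive x 1 (fun s => complex.Re (g s)) (complex.Re (g' x)).
  rewrite in_itv /= => /andP [ax xb]; apply: rD_Re; apply: H; rewrite !ltW //.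
have cont : {within `[a, b], continuous (fun s => complex.Re (g s))}.
  apply: continuous_in_subspaceT => x; rewrite inE /= in_itv /= => axb.
  have [dx _] := rD_Re (H _ axb).
  by apply: differentiable_continuous; apply/derivable1_diffP.
have [c] := MVT_segment ab dr cont.
by rewrite in_itv /= => acb E; exists c => //; rewrite cReB.
Qed.

(** Multiplying [g] by the conjugate of the increment [w] makes the increment the real number |w|^2,
    so the real mean value theorem loses nothing in the constant. *)
Lemma MVT_rn (g : R -> C) (g' : R -> C) (M a b : R) : a <= b ->
  (forall x, a <= x <= b -> rD g x (g' x)) ->
  (forall x, a <= x <= b -> rn (g' x) <= M) ->
  rn (g b - g a) <= M * (b - a).
Proof.
move=> ab H HM; set w := g b - g a.
have [w0|w0] := eqVneq w 0.
  rewrite w0 rn0 mulr_ge0 ?subr_ge0 //.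
  by apply: le_trans (HM a _); rewrite ?rn_ge0 // lexx.
have wp : 0 < rn w by rewrite rn_gt0.
have [|c acb] := @MVT_Re (fun s => w^*%C *: g s) (fun s => w^*%C *: g' s) a b ab.
  by move=> x /H; apply: rD_scale.
rewrite -scalerBr -!/(_ * _).
have -> : complex.Re (w^*%C *: w) = rn w ^+ 2.
  rewrite sqr_rn; case: (w) => u v /=.
  by rewrite mulNr opprK !expr2.
move=> E; rewrite -(ler_pM2l wp) -expr2 E mulrA; apply: ler_wpM2r; first by rewrite subr_ge0.
apply: le_trans (le_trans (ler_norm _) (Re_le _)) _.
by rewrite rnZ rnJ ler_pM2l // HM.
Qed.

End Deriv.

(** * Goursat and power series expansion *)

Section Goursat.
Variable R : realType.
Local Notation C := (Cplx R).

Lemma expr_small (q e : R) : 0 <= q < 1 -> 0 < e ->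
  exists N, forall n, (N <= n)%N -> q ^+ n < e.
Proof.
move=> /andP [q0 q1] e0.
have /cvgrPdist_lt /(_ e e0) [N _ HN] : (fun n => q ^+ n) @ \oo --> (0 : R).
  by apply: cvg_expr; rewrite ger0_norm.
exists N => n /HN /=; rewrite sub0r normrN ger0_norm // exprn_ge0 //.
Qed.

Lemma real_primitive (f : R -> R) (a b : R) : a <= b -> (forall x, {for x, continuous f}) ->
  exists P : R -> R, forall x, a <= x <= b -> is_derive x 1 P (f x).
Proof.
move=> ab cf.
(* The interval is enlarged by 1 on both sides so that [a] and [b] are interior points for the
   fundamental theorem of calculus. *)
have intf : lebesgue_measure.-integrable `[a - 1, b + 1] (EFin \o f).
  apply: continuous_compact_integrable; first exact: segment_compact.
  exact: continuous_subspaceT.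
exists (fun x => (\int[lebesgue_measure]_(t in `[a - 1, x]) (f t))%R) => x /andP [ax xb].
have [| |dx ex] := @continuous_FTC1_closed R f (a - 1) x (b + 1) _ intf _ (cf x).
- by lra.
- by lra.
by split; [exact: dx | rewrite -derive1E; exact: ex].
Qed.

(** Extends a function on [a, b] to the line by its end values; being 1-Lipschitz it preserves
    continuity, which [real_primitive] asks for everywhere. *)
Definition clamp (a b x : R) : R := Num.max a (Num.min b x).

Lemma clamp_id a b x : a <= x <= b -> clamp a b x = x.
Proof. by move=> /andP [ax xb]; rewrite /clamp min_r // max_r. Qed.

Lemma clamp_in a b x : a <= b -> a <= clamp a b x <= b.
Proof. by move=> ab; rewrite /clamp le_max lexx /= ge_max ab ge_min lexx. Qed.

Lemma clamp_lip a b x y : `|clamp a b y - clamp a b x| <= `|y - x|.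
Proof.
rewrite /clamp /Num.max /Num.min.
have := ler_norm (y - x); have := ler_norm (- (y - x)); rewrite normrN => N1 N2.
have N0 := normr_ge0 (y - x).
rewrite ler_norml; case: (ltP b y) => ?; case: (ltP b x) => ?.
- by case: (ltP a b) => ?; apply/andP; split; lra.
- by case: (ltP a b) => ?; case: (ltP a x) => ?; apply/andP; split; lra.
- by case: (ltP a b) => ?; case: (ltP a y) => ?; apply/andP; split; lra.
- by case: (ltP a x) => ?; case: (ltP a y) => ?; apply/andP; split; lra.
Qed.

Lemma primitive (g : R -> C) (a b : R) : a <= b ->
  (forall x, a <= x <= b -> forall e, 0 < e -> exists2 d, 0 < d &
     forall y, `|y - x| < d -> rn (g y - g x) < e) ->
  exists P : R -> C, forall x, a <= x <= b -> rD P x (g x).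
Proof.
move=> ab cg.
have cont (pr : C -> R) : (forall u v, `|pr u - pr v| <= rn (u - v)) ->
    forall x, {for x, continuous (fun x => pr (g (clamp a b x)))}.
  move=> Hpr x; apply/cvgrPdist_lt => e e0.
  have [d d0 Hd] := cg _ (clamp_in x ab) _ e0.
  apply/nbhs_ballP; exists d => //= y; rewrite /ball /= => xy.
  apply: le_lt_trans (Hpr _ _) _; rewrite rnBC; apply: Hd.
  by apply: le_lt_trans (clamp_lip _ _ _ _) _; rewrite distrC.
have [|P HP] := @real_primitive (fun x => complex.Re (g (clamp a b x))) a b ab.
  apply: (cont (@complex.Re R)) => u v; rewrite -cReB; exact: Re_le.
have [|Q HQ] := @real_primitive (fun x => complex.Im (g (clamp a b x))) a b ab.
  apply: (cont (@complex.Im R)) => u v; rewrite -cImN -cImD; exact: Im_le.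
exists (fun x => (P x +i* Q x : C)) => x axb e e0.
have e2 : 0 < e / 2 by lra.
have [d1 d10 H1] := is_derive_rderiv (HP x axb) e2.
have [d2 d20 H2] := is_derive_rderiv (HQ x axb) e2.
exists (Num.min d1 d2); first by rewrite lt_min d10.
move=> h; rewrite lt_min => /andP [/H1 + /H2]; rewrite clamp_id // => A1 A2.
rewrite -[h%:C *: _]/(h%:C * _).
apply: le_trans (rn_le_ReIm _) _.
rewrite !cReB cImD cImD !cImN cReZ cImZ /=; lra.
Qed.

(* [T] maps a rectangle of parameters to the plane; [A t] and [B s] are primitives of
   the pullback of [f dz] along the horizontal and vertical sides, so [I] is the
   integral over the boundary.  [step] bisects, [al + l z] approximates [f]. *)
Section Thm.
Variables (f : C -> C) (T Ts Tt : R -> R -> C) (a0 b0 c0 d0 K : R) (A B : R -> R -> C).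
Hypotheses (ab0 : a0 <= b0) (cd0 : c0 <= d0).
Let inb s t := (a0 <= s <= b0) && (c0 <= t <= d0).
Hypothesis HTs : forall s t, inb s t -> rD (fun s => T s t) s (Ts s t).
Hypothesis HTt : forall s t, inb s t -> rD (fun t => T s t) t (Tt s t).
Hypothesis KTs : forall s t, inb s t -> rn (Ts s t) <= K.
Hypothesis KTt : forall s t, inb s t -> rn (Tt s t) <= K.
Hypothesis Hf : forall s t, inb s t -> exists l, cD f (T s t) l.
Hypothesis HA : forall s t, inb s t -> rD (A t) s (f (T s t) * Ts s t).
Hypothesis HB : forall s t, inb s t -> rD (B s) t (f (T s t) * Tt s t).

Let I (q : R * R * R * R) : C := let: (a, b, c, d) := q in
  (A c b - A c a) + (B b d - B b c) - (A d b - A d a) - (B a d - B a c).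

Let quarters (q : R * R * R * R) := let: (a, b, c, d) := q in
  let m := (a + b) / 2 in let n := (c + d) / 2 in
  ((a, m, c, n), (m, b, c, n), (a, m, n, d), (m, b, n, d)).
Let step q := let: (q1, q2, q3, q4) := quarters q in
  if rn (I q) <= 4 * rn (I q1) then q1 else
  if rn (I q) <= 4 * rn (I q2) then q2 else
  if rn (I q) <= 4 * rn (I q3) then q3 else q4.

Let stepI q : rn (I q) <= 4 * rn (I (step q)).
Proof.
case: q => [[[a b] c] d]; rewrite /step /quarters.
set m := (a + b) / 2; set n := (c + d) / 2.
have E : I (a, b, c, d) = I (a, m, c, n) + I (m, b, c, n) + I (a, m, n, d) + I (m, b, n, d).
  by rewrite /I; ring.
have := rnD (I (a, m, c, n) + I (m, b, c, n) + I (a, m, n, d)) (I (m, b, n, d)).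
have := rnD (I (a, m, c, n) + I (m, b, c, n)) (I (a, m, n, d)).
have := rnD (I (a, m, c, n)) (I (m, b, c, n)).
rewrite -E.
case: ifPn => [//|]; rewrite -ltNge => N1.
case: ifPn => [//|]; rewrite -ltNge => N2.
by case: ifPn => [//|]; rewrite -ltNge => N3; lra.
Qed.

Let good (n : nat) (q : R * R * R * R) := let: (a, b, c, d) := q in
  [/\ a0 <= a, a <= b, b <= b0, c0 <= c & c <= d] /\ [/\ d <= d0,
   b - a = (b0 - a0) / 2 ^+ n & d - c = (d0 - c0) / 2 ^+ n].

Let sub (q' q : R * R * R * R) := let: (a, b, c, d) := q in let: (a', b', c', d') := q' in
  [/\ a <= a', b' <= b, c <= c' & d' <= d].

Let step_good n q : good n q -> good n.+1 (step q) /\ sub (step q) q.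
Proof.
case: q => [[[a b] c] d] [[h1 h2 h3 h4 h5] [h6 h7 h8]]; rewrite /step /quarters.
have E (x : R) : x / 2 ^+ n.+1 = x / 2 ^+ n / 2 by rewrite exprS; field; rewrite expf_neq0.
by do 3?[case: ifPn => _]; rewrite /good /sub !E -h7 -h8; split=> //; do ?split; lra.
Qed.

Let qs n := iter n step (a0, b0, c0, d0).

Let qs_good n : good n (qs n).
Proof.
elim: n => [|n IH]; last by have [] := step_good IH.
by split; split=> //=; rewrite ?expr0 ?divr1 ?lexx.
Qed.

Let sub_trans q1 q2 q3 : sub q1 q2 -> sub q2 q3 -> sub q1 q3.
Proof.
case: q1 q2 q3 => [[[a1 b1] c1] d1] [[[a2 b2] c2] d2] [[[a3 b3] c3] d3].
by rewrite /sub; case=> ? ? ? ? [? ? ? ?]; split; lra.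
Qed.

Let qs_sub n m : (n <= m)%N -> sub (qs m) (qs n).
Proof.
elim: m => [|m IH]; first by rewrite leqn0 => /eqP ->; rewrite /sub /= !lexx.
rewrite leq_eqVlt => /orP [/eqP ->|/IH].
  by case: (qs m.+1) => [[[? ?] ?] ?] /=; rewrite !lexx.
have [_ H] := step_good (qs_good m); exact: sub_trans.
Qed.

Let qsI n : rn (I (a0, b0, c0, d0)) <= 4 ^+ n * rn (I (qs n)).
Proof.
elim: n => [|n IH]; first by rewrite expr0 mul1r.
apply: le_trans IH _; by rewrite exprSr -mulrA ler_pM2l ?exprn_gt0.
Qed.

Lemma goursat : I (a0, b0, c0, d0) = 0.
Proof.
pose a n := (qs n).1.1.1; pose b n := (qs n).1.1.2; pose c n := (qs n).1.2; pose d n := (qs n).2.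
have qE n : qs n = (a n, b n, c n, d n) by rewrite /a /b /c /d; case: (qs n) => [[[? ?] ?] ?].
(* Any two rectangles of the sequence contain the one with the larger index, so left ends never pass
   right ends and the suprema below give a common point. *)
have ab n m : a n <= b m.
  have := qs_sub (leq_maxl n m); have := qs_sub (leq_maxr n m); have := qs_good (maxn n m).
  by rewrite !qE => -[[? ? ? ? ?] [? ? ?]] [? ? ? ?] [? ? ? ?]; lra.
have cd n m : c n <= d m.
  have := qs_sub (leq_maxl n m); have := qs_sub (leq_maxr n m); have := qs_good (maxn n m).
  by rewrite !qE => -[[? ? ? ? ?] [? ? ?]] [? ? ? ?] [? ? ? ?]; lra.
pose s := sup (range a); pose t := sup (range c).
have sP n : a n <= s <= b n.
  apply/andP; split.
    by apply: ub_le_sup; [exists (b 0%N) => _ [m _ <-] | exists n].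
  by apply: ge_sup; [exists (a 0%N); exists 0%N | move=> _ [m _ <-]].
have tP n : c n <= t <= d n.
  apply/andP; split.
    by apply: ub_le_sup; [exists (d 0%N) => _ [m _ <-] | exists n].
  by apply: ge_sup; [exists (c 0%N); exists 0%N | move=> _ [m _ <-]].
have inbP n x y : a n <= x <= b n -> c n <= y <= d n -> inb x y.
  have := qs_good n; rewrite qE => -[[? ? ? ? ?] [? ? ?]] ? ?.
  by rewrite /inb; apply/andP; split; apply/andP; split; lra.
have K0 : 0 <= K by apply: le_trans (KTs (inbP 0%N _ _ (sP _) (tP _))); apply: rn_ge0.
pose w := (b0 - a0) + (d0 - c0).
have w0 : 0 <= w by rewrite /w addr_ge0 // subr_ge0.
have [l Hl] := Hf (inbP 0%N _ _ (sP _) (tP _)).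
pose al := f (T s t) - l * T s t.
(* The boundary integral over the n-th rectangle is at most e times a diameter times a perimeter,
   both of order 2^-n. This compensates the factor 4^n lost in the bisections and leaves a multiple
   of e. *)
have key e : 0 < e -> rn (I (a0, b0, c0, d0)) <= e * (2 * K ^+ 2 * w ^+ 2).
  move=> e0; have [dl dl0 Hdl] := Hl _ e0.
  have [n Hn] : exists n, K * w / 2 ^+ n < dl.
    have [||N HN] := @expr_small (2^-1) (dl / (K * w + 1)); first by lra.
      by rewrite divr_gt0 // ltr_wpDl // mulr_ge0.
    exists N; have := HN N (leqnn N); rewrite ltr_pdivlMr ?ltr_wpDl ?mulr_ge0 // exprVn => HH.
    by apply: le_lt_trans HH; rewrite mulrC ler_pM2l ?invr_gt0 ?exprn_gt0 // lerDl.
  have := qs_good n; rewrite qE => -[[g1 g2 g3 g4 g5] [g6 g7 g8]].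
  have Tlip x y : a n <= x <= b n -> c n <= y <= d n -> rn (T x y - T s t) <= K * w / 2 ^+ n.
    move=> hx hy.
    have l1 : rn (T x y - T s y) <= K * (b n - a n).
      have := MVT_rn (g := fun x => T x y) (g' := fun x => Ts x y) (M := K).
      have [sx|xs] := leP s x.
        move=> /(_ _ _ sx) H; apply: le_trans (H _ _) _ => [u hu|u hu|].
        - by apply: HTs; apply: (inbP n) => //; have := sP n; lra.
        - by apply: KTs; apply: (inbP n) => //; have := sP n; lra.
        - by apply: ler_wpM2l => //; have := sP n; lra.
      move=> /(_ _ _ (ltW xs)) H; rewrite rnBC; apply: le_trans (H _ _) _ => [u hu|u hu|].
      - by apply: HTs; apply: (inbP n) => //; have := sP n; lra.
      - by apply: KTs; apply: (inbP n) => //; have := sP n; lra.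
      - by apply: ler_wpM2l => //; have := sP n; lra.
    have l2 : rn (T s y - T s t) <= K * (d n - c n).
      have := MVT_rn (g := fun y => T s y) (g' := fun y => Tt s y) (M := K).
      have [sx|xs] := leP t y.
        move=> /(_ _ _ sx) H; apply: le_trans (H _ _) _ => [u hu|u hu|].
        - by apply: HTt; apply: (inbP n) => //; have := tP n; lra.
        - by apply: KTt; apply: (inbP n) => //; have := tP n; lra.
        - by apply: ler_wpM2l => //; have := tP n; lra.
      move=> /(_ _ _ (ltW xs)) H; rewrite rnBC; apply: le_trans (H _ _) _ => [u hu|u hu|].
      - by apply: HTt; apply: (inbP n) => //; have := tP n; lra.
      - by apply: KTt; apply: (inbP n) => //; have := tP n; lra.
      - by apply: ler_wpM2l => //; have := tP n; lra.
    apply: le_trans (rn_trans (T s y) _ _) _; apply: le_trans (lerD l1 l2) _.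
    by rewrite g7 g8 /w; apply: eqW; field; rewrite expf_neq0.
  have Ef x y : a n <= x <= b n -> c n <= y <= d n ->
      rn (f (T x y) - (al + l * T x y)) <= e * (K * w / 2 ^+ n).
    move=> hx hy; have h1 := Tlip _ _ hx hy.
    have := Hdl (T x y - T s t) (le_lt_trans h1 Hn).
    have -> : T s t + (T x y - T s t) = T x y by ring.
    have -> : f (T x y) - f (T s t) - (T x y - T s t) * l = f (T x y) - (al + l * T x y).
      by rewrite /al; ring.
    by move/le_trans; apply; rewrite ler_pM2l.
  (* [L] is a primitive of the affine function [al + l z] along every path: its increments around
     the rectangle cancel, and [A - L], [B - L] have small derivatives. *)
  pose L x y := al * T x y + l / 2 * (T x y * T x y).
  have HLs x y : inb x y -> rD (fun x => L x y) x ((al + l * T x y) * Ts x y).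
    move=> /HTs h; have := rD_add (rD_scale al h) (rD_scale (l / 2) (rD_mul h h)).
    have -> : (al + l * T x y) * Ts x y =
      al *: Ts x y + (l / 2) *: (Ts x y * T x y + T x y * Ts x y); last by [].
    by rewrite -[al *: _]/(al * _) -[(l / 2) *: _]/(l / 2 * _); field.
  have HLt x y : inb x y -> rD (fun y => L x y) y ((al + l * T x y) * Tt x y).
    move=> /HTt h; have := rD_add (rD_scale al h) (rD_scale (l / 2) (rD_mul h h)).
    have -> : (al + l * T x y) * Tt x y =
      al *: Tt x y + (l / 2) *: (Tt x y * T x y + T x y * Tt x y); last by [].
    by rewrite -[al *: _]/(al * _) -[(l / 2) *: _]/(l / 2 * _); field.
  have bnd u M : rn u <= e * (K * w / 2 ^+ n) -> rn M <= K -> rn (u * M) <= e * K ^+ 2 * (w / 2 ^+ n).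
    move=> h1 h2; rewrite rnM; apply: le_trans (ler_pM (rn_ge0 _) (rn_ge0 _) h1 h2) _.
    by apply: eqW; ring.
  have EA y : c n <= y <= d n -> rn ((A y (b n) - L (b n) y) - (A y (a n) - L (a n) y)) <=
      e * K ^+ 2 * (w / 2 ^+ n) * (b n - a n).
    move=> hy; apply: (MVT_rn (g := fun x => A y x - L x y)
      (g' := fun x => (f (T x y) - (al + l * T x y)) * Ts x y)) => // x hx.
      have hb := inbP n _ _ hx hy; rewrite mulrBl.
      exact: rD_add (HA hb) (rD_opp (HLs _ _ hb)).
    by apply: bnd; [exact: Ef | apply: KTs; exact: (inbP n)].
  have EB x : a n <= x <= b n -> rn ((B x (d n) - L x (d n)) - (B x (c n) - L x (c n))) <=
      e * K ^+ 2 * (w / 2 ^+ n) * (d n - c n).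
    move=> hx; apply: (MVT_rn (g := fun y => B x y - L x y)
      (g' := fun y => (f (T x y) - (al + l * T x y)) * Tt x y)) => // y hy.
      have hb := inbP n _ _ hx hy; rewrite mulrBl.
      exact: rD_add (HB hb) (rD_opp (HLt _ _ hb)).
    by apply: bnd; [exact: Ef | apply: KTt; exact: (inbP n)].
  have cc : c n <= c n <= d n by rewrite lexx.
  have dd : c n <= d n <= d n by rewrite lexx andbT.
  have aa : a n <= a n <= b n by rewrite lexx.
  have bb : a n <= b n <= b n by rewrite lexx andbT.
  have := EA _ cc; have := EA _ dd; have := EB _ aa; have := EB _ bb.
  set u1 := _ - _ - _; set u2 := _ - _ - _; set u3 := _ - _ - _; set u4 := _ - _ - _ => hu1 hu2 hu3 hu4.
  have Iq : I (qs n) = u4 + u1 - u3 - u2 by rewrite qE /I /u1 /u2 /u3 /u4; ring.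
  have r1 := rnB (u4 + u1 - u3) u2; have r2 := rnB (u4 + u1) u3; have r3 := rnD u4 u1.
  rewrite -Iq in r1; have r4 := qsI n.
  apply: le_trans r4 _.
  have p4 : 4 ^+ n = 2 ^+ n * 2 ^+ n :> R by rewrite -exprMn; congr (_ ^+ _); ring.
  have r5 : rn (I (qs n)) <= e * K ^+ 2 * (w / 2 ^+ n) * (2 * (w / 2 ^+ n)).
    apply: (@le_trans _ _ (e * K ^+ 2 * (w / 2 ^+ n) * (2 * (b n - a n + (d n - c n))))).
      by lra.
    by apply: eqW; rewrite g7 g8 /w; field; rewrite expf_neq0.
  apply: (@le_trans _ _ (4 ^+ n * (e * K ^+ 2 * (w / 2 ^+ n) * (2 * (w / 2 ^+ n))))).
    by rewrite ler_pM2l ?exprn_gt0.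
  by apply: eqW; rewrite p4; field; rewrite expf_neq0.
apply/eqP; rewrite -rn_eq0 eq_le rn_ge0 andbT.
apply/ler_addgt0Pr => e e0; rewrite add0r.
set D := 2 * K ^+ 2 * w ^+ 2 in key.
have D0 : 0 <= D by rewrite /D !mulr_ge0 // sqr_ge0.
have [|] := leP D 0 => D1.
  have D2 : D = 0 by lra.
  by apply: le_trans (key _ e0) _; rewrite D2 mulr0 ltW.
have := key (e / D); rewrite divr_gt0 // divfK ?gt_eqF //; exact.
Qed.

End Thm.
End Goursat.

(** * Cauchy's theorem on a disc for a difference quotient with removable singularity *)

Section Cauchy.
Variable R : realType.
Local Notation C := (Cplx R).

Lemma differentiable_cD (f : C -> C) z : differentiable f z -> cD f z ('d f z 1).
Proof.
move=> /differentiable_fD H; rewrite /cD; move=> e /H [d d0 Hd]; exists d => // h /Hd.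
suff -> : 'd f z h = h * 'd f z 1 by [].
by rewrite -[h * _]/(h *: _) -linearZ /=; congr ('d f z _); rewrite -[h *: _]/(h * 1) mulr1.
Qed.

Lemma primitive_incr (g P Q : R -> C) (a b : R) : a <= b ->
  (forall x, a <= x <= b -> rD P x (g x)) -> (forall x, a <= x <= b -> rD Q x (g x)) ->
  P b - P a = Q b - Q a.
Proof.
move=> ab HP HQ; apply/eqP; rewrite -subr_eq0 -rn_eq0 eq_le rn_ge0 andbT.
have -> : P b - P a - (Q b - Q a) = (P b - Q b) - (P a - Q a) by ring.
have := MVT_rn (g := fun x => P x - Q x) (g' := fun=> 0) (M := 0) ab.
rewrite mul0r; apply => [x hx|x hx]; last by rewrite rn0.
by rewrite -(subrr (g x)); apply: rD_add (HP _ hx) (rD_opp (HQ _ hx)).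
Qed.

Definition cis (t : R) : C := (cos t +i* sin t).

Lemma rn_cis t : rn (cis t) = 1.
Proof. by apply/eqP; rewrite -(@eqrXn2 _ 2) ?rn_ge0 // sqr_rn /= cos2Dsin2 expr1n. Qed.

Lemma rD_ReIm (g : R -> C) (x : R) (l : C) :
  is_derive x 1 (fun s => complex.Re (g s)) (complex.Re l) ->
  is_derive x 1 (fun s => complex.Im (g s)) (complex.Im l) -> rD g x l.
Proof.
move=> H1 H2 e e0; have e2 : 0 < e / 2 by lra.
have [d1 d10 Hd1] := is_derive_rderiv H1 e2.
have [d2 d20 Hd2] := is_derive_rderiv H2 e2.
exists (Num.min d1 d2); first by rewrite lt_min d10.
move=> h; rewrite lt_min => /andP [/Hd1 A1 /Hd2 A2].
rewrite -[h%:C *: _]/(h%:C * _).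
apply: le_trans (rn_le_ReIm _) _.
rewrite !cReB !cImD !cImN cReZ cImZ /=; lra.
Qed.

Lemma rD_cis t : rD cis t ('i%C * cis t).
Proof.
apply: rD_ReIm; rewrite /= ?mul0r ?mul1r ?addr0 ?sub0r ?add0r.
  exact: is_derive_cos.
exact: is_derive_sin.
Qed.

Definition cisN (t : R) : C := (cos t +i* (- sin t)).

Lemma cisVN t : cis t * cisN t = 1.
Proof.
apply/eqP; rewrite eq_complex /= mulrN opprK -!expr2 cos2Dsin2 eqxx /=.
by rewrite mulrN mulrC addNr.
Qed.

Lemma rn_cisN t : rn (cisN t) = 1.
Proof. by apply/eqP; rewrite -(@eqrXn2 _ 2) ?rn_ge0 // sqr_rn /= sqrrN cos2Dsin2 expr1n. Qed.

Lemma rD_cisN t : rD cisN t (- 'i%C * cisN t).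
Proof.
apply: rD_ReIm; rewrite /= ?oppr0 ?mul0r ?mulrNN ?mulN1r ?mul1r ?addr0 ?sub0r ?add0r.
  exact: is_derive_cos.
have -> : - cos t = - (1 * cos t) by rewrite mul1r.
by rewrite mul1r; apply: is_deriveN.
Qed.

Lemma rD_expr (g : R -> C) x l k : rD g x l -> rD (fun s => g s ^+ k) x (k%:R * g x ^+ k.-1 * l).
Proof.
move=> H; elim: k => [|k IH].
  rewrite !mul0r.
  by apply: (rD_ext _ (rD_cst (1 : C) x)); exists 1.
have -> : k.+1%:R * g x ^+ k.+1.-1 * l = l * g x ^+ k + g x * (k%:R * g x ^+ k.-1 * l).
  case: k {IH} => [|k] /=; first by rewrite !expr0; ring.
  by rewrite exprS -(natr1 k.+1); ring.
by apply: (rD_ext _ (rD_mul H IH)); exists 1 => // h _; rewrite exprS.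
Qed.

Lemma cis_2pi : cis (2 * pi) = cis 0.
Proof.
by rewrite /cis mulr_natl cos0 sin0 cos2pi sin2pi.
Qed.
Lemma cisN_2pi : cisN (2 * pi) = cisN 0.
Proof. by rewrite /cisN mulr_natl cos0 sin0 cos2pi sin2pi. Qed.

Section Disk.
Variables (f : C -> C) (r rho M : R).
Hypotheses (rho0 : 0 < rho) (rhor : rho < r).
Hypothesis Hf : forall t, rn t < r -> differentiable f t.
Hypothesis HM : forall t, rn t <= rho -> rn (f t) <= M.

Lemma primitive_rD (g g' : R -> C) (a b : R) : a <= b -> (forall x, a <= x <= b -> rD g x (g' x)) ->
  exists P : R -> C, forall x, a <= x <= b -> rD P x (g x).
Proof.
move=> ab H; apply: primitive => // x /H /rD_cont Hx e /Hx [d d0 Hd].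
by exists d => // y /Hd; rewrite [x + _]addrC subrK.
Qed.

(* [P] stands for the integral of [(f t - f z) / (t - z)] over the circle, swept to the
   removable singularity [z] by the homotopy [z + s (rho e^{i th} - z)]. *)
Lemma cauchy_pole (z : C) : rn z < rho ->
  exists P : R -> C, P (2 * pi) - P 0 = 0 /\ forall t, 0 <= t <= 2 * pi ->
    rD P t ((f (rho%:C * cis t) - f z) / (rho%:C * cis t - z) * (rho%:C * ('i%C * cis t))).
Proof.
have rho0' := rho0; have rhor' := rhor.
move=> zr; have pi0 : 0 <= 2 * pi :> R by rewrite mulr_ge0 // pi_ge0.
pose h (t : C) := (f t - f z) / (t - z).
have hD t : rn t < r -> t != z -> cD h t ('d h t 1).
  move=> tr tz; apply: differentiable_cD.
  apply: differentiableM; first by apply: differentiableB => //; apply: Hf.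
  apply: differentiableV; last by rewrite subr_eq0.
  by apply: differentiableB => //.
pose T (s t : R) : C := z + s%:C * (rho%:C * cis t - z).
pose Ts (s t : R) : C := rho%:C * cis t - z.
pose Tt (s t : R) : C := s%:C * (rho%:C * ('i%C * cis t)).
have rc t : rn (rho%:C * cis t : C) = rho by rewrite rnM rn_real rn_cis mulr1 gtr0_norm.
have Ts0 s t : rho - rn z <= rn (Ts s t).
  by have := rn_le (rho%:C * cis t : C) z; rewrite rc /Ts; lra.
have Tr s t : 0 <= s <= 1 -> rn (T s t) < r.
  move=> /andP [s0 s1]; have -> : T s t = (1 - s)%:C * z + s%:C * (rho%:C * cis t).
    by rewrite /T rmorphB rmorph1; ring.
  apply: le_lt_trans (rnD _ _) _; rewrite !rnM !rn_real rn_cis mulr1 !ger0_norm ?subr_ge0 ?(ltW rho0) //.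
  have h1 : 0 <= (1 - s) * (rho - rn z) by rewrite mulr_ge0 // subr_ge0 // ltW.
  have := rhor; nra.
have Tz s t : 0 < s -> T s t != z.
  move=> s0; rewrite -subr_eq0 /T addrC addKr -rn_gt0 rnM rn_real mulr_gt0 ?normr_gt0 ?gt_eqF //.
  by apply: lt_le_trans (Ts0 s t); rewrite subr_gt0.
have HTs s t : rD (fun s => T s t) s (Ts s t).
  have := rD_add (rD_cst z s) (rD_mulC (Ts s t) (rD_id s)).
  by rewrite add0r mulr1; apply: rD_ext; exists 1 => // x _; rewrite /T mulrC.
have Hu t : rD (fun t => rho%:C * cis t : C) t (rho%:C * ('i%C * cis t)).
  exact: rD_mulC (rD_cis t).
have HTt s t : rD (fun t => T s t) t (Tt s t).
  have := rD_add (rD_cst z t) (rD_mulC s%:C (rD_add (Hu t) (rD_cst (- z) t))).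
  by rewrite add0r addr0.
have HBB s t : 0 < s <= 1 -> rD (fun t => h (T s t) * Tt s t) t
    (Tt s t * 'd h (T s t) 1 * Tt s t + h (T s t) * (s%:C * (rho%:C * ('i%C * ('i%C * cis t))))).
  move=> /andP [s0 s1]; apply: rD_mul.
    by apply: rD_comp_cD => //; apply: hD; [apply: Tr; rewrite ltW | apply: Tz].
  by rewrite /Tt; do 3!apply: rD_mulC; exact: rD_cis.
have HAA s t : 0 < s <= 1 -> rD (fun s => h (T s t) * Ts s t) s
    (Ts s t * 'd h (T s t) 1 * Ts s t + h (T s t) * 0).
  move=> /andP [s0 s1]; apply: rD_mul; last exact: rD_cst.
  by apply: rD_comp_cD => //; apply: hD; [apply: Tr; rewrite ltW | apply: Tz].
(* One primitive for each [s], chosen independently of the others; [goursat] asks for no relation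
   between them. *)
have /choice [B HB] : forall s : R, exists P : R -> C, 0 < s <= 1 ->
    forall t, 0 <= t <= 2 * pi -> rD P t (h (T s t) * Tt s t).
  move=> s; case: (boolP (0 < s <= 1)) => s01; last by exists (fun=> 0).
  by have [P HP] := primitive_rD pi0 (fun t _ => HBB s t s01); exists P.
have const s0 : 0 < s0 <= 1 -> B 1 (2 * pi) - B 1 0 = B s0 (2 * pi) - B s0 0.
  move=> /andP [s00 s01].
  have /choice [A HA] : forall t : R, exists P : R -> C,
      forall s, s0 <= s <= 1 -> rD P s (h (T s t) * Ts s t).
    move=> t; apply: (primitive_rD s01 (g' := fun s => Ts s t * 'd h (T s t) 1 * Ts s t + h (T s t) * 0)).
    by move=> s /andP [h1 h2]; apply: HAA; rewrite h2 (lt_le_trans s00).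
  have ss s : s0 <= s <= 1 -> 0 < s <= 1 by move=> /andP [h1 h2]; rewrite h2 (lt_le_trans s00).
  have := @goursat R h T Ts Tt s0 1 0 (2 * pi) (2 * rho) A B s01 pi0.
  (* The sides t = 0 and t = 2 pi are the same segment, since [cis] is periodic, and cancel in the
     boundary sum. *)
  have -> : A (2 * pi) 1 - A (2 * pi) s0 = A 0 1 - A 0 s0.
    apply: (primitive_incr s01 (g := fun s => h (T s 0) * Ts s 0)) => s hs; last exact: HA.
    by have := HA (2 * pi) s hs; rewrite /T /Ts cis_2pi.
  move=> G; apply/eqP; rewrite -subr_eq0 -[X in _ == X]G; last first.
  - by move=> s t /andP [h1 h2]; apply: HB => //; apply: ss.
  - by move=> s t /andP [h1 h2]; apply: HA.
  - move=> s t /andP [/ss /andP [h1 h3] h2]; exists ('d h (T s t) 1); apply: hD; last exact: Tz.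
    by apply: Tr; rewrite ltW.
  - move=> s t /andP [/ss /andP [h1 h3] h2].
    rewrite /Tt !rnM rn_i rn_cis !rn_real !gtr0_norm // mul1r mulr1; move: h1 h3 => a1 a2; nra.
  - move=> s t _; rewrite /Ts; apply: le_trans (rnB _ _) _; rewrite rc; lra.
  - by move=> s t _; exact: HTt.
  - by move=> s t _; exact: HTs.
  by apply/eqP; ring.
exists (B 1); split; last first.
  move=> t ht; have := HB 1 _ t ht; rewrite ltr01 lexx => /(_ isT).
  by rewrite /h /T /Tt rmorph1 !mul1r [z + _]addrC subrK.
apply/eqP; rewrite -rn_eq0 eq_le rn_ge0 andbT.
have [d d0 Hd] := (@differentiable_cD f z (Hf (lt_trans zr rhor))) 1 ltr01.
set l := 'd f z 1 in Hd.
apply/ler_addgt0Pr => e e0; rewrite add0r.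
have q1 : 0 < 2 * rho by lra.
have q2 : 0 < (rn l + 1) * rho * (2 * pi) + 1.
  by rewrite ltr_wpDl // mulr_ge0 // mulr_ge0 ?(ltW rho0) // addr_ge0 ?rn_ge0.
(* The three bounds keep the small loop where the difference quotient is at most |l| + 1, keep
   [s0 <= 1], and make the increment of the primitive at most [e]. *)
pose m := Num.min (d / (2 * rho)) (Num.min 1 (e / ((rn l + 1) * rho * (2 * pi) + 1))).
have m0 : 0 < m by rewrite !lt_min ltr01 !divr_gt0.
have := lexx m; rewrite {2}/m !le_min => /andP [m1 /andP [m2 m3]].
pose s0 := m / 2; have s00 : 0 < s0 by rewrite /s0; lra.
have s01 : 0 < s0 <= 1 by rewrite /s0; lra.
rewrite (const _ s01).
have := MVT_rn (M := (rn l + 1) * (s0 * rho)) pi0 (HB _ s01).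
rewrite subr0 => H; apply: le_trans (H _) _ => [t ht|].
  rewrite rnM; apply: ler_pM; rewrite ?rn_ge0 //.
    have hz : T s0 t - z = s0%:C * Ts s0 t by rewrite /T addrC addKr.
    have hz0 : 0 < rn (T s0 t - z) by rewrite rn_gt0 subr_eq0 Tz.
    have hzd : rn (T s0 t - z) < d.
      rewrite hz rnM rn_real gtr0_norm //.
      have : rn (Ts s0 t) <= 2 * rho by rewrite /Ts; apply: le_trans (rnB _ _) _; rewrite rc; lra.
      move: m1; rewrite ler_pdivlMr // /s0 => h1 h2.
      apply: (@le_lt_trans _ _ (m / 2 * (2 * rho))); last by lra.
      by rewrite ler_pM2l // divr_gt0.
    have := Hd _ hzd; rewrite [z + _]addrC subrK mul1r => H1.
    rewrite /h rnM rnV ler_pdivrMr //.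
    rewrite -[f _ - _](subrK ((T s0 t - z) * l)); apply: le_trans (rnD _ _) _.
    by rewrite [rn (_ * l)]rnM; lra.
  by rewrite /Tt !rnM rn_i rn_cis !rn_real !gtr0_norm // mul1r mulr1.
apply: (@le_trans _ _ (s0 * ((rn l + 1) * rho * (2 * pi) + 1))).
  have : 0 < s0 by []. by lra.
by rewrite -ler_pdivlMr // /s0; lra.
Qed.

End Disk.
End Cauchy.

(** * Power series expansion of a holomorphic function *)

Section CauchySeries.
Variable R : realType.
Local Notation C := (Cplx R).

Lemma rD_sum n (g g' : nat -> R -> C) x : (forall k, rD (g k) x (g' k x)) ->
  rD (fun s => \sum_(k < n) g k s) x (\sum_(k < n) g' k x).
Proof.
move=> H; elim: n => [|n IH].
  by rewrite big_ord0; apply: (rD_ext _ (rD_cst (0 : C) x)); exists 1 => // h _; rewrite big_ord0.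
rewrite big_ord_recr /=; apply: (rD_ext _ (rD_add IH (H n))); exists 1 => // h _.
by rewrite big_ord_recr.
Qed.

(** The coefficients are the integrals of f(u) u^-k over the circle parametrised by u, divided by 2
    pi. The error comes from the exact remainder (z v)^N of the finite geometric sum of 1 / (1 - z
    v), where v = 1 / u; the factor 2 M bounds f(u) - f(z). *)
Lemma cauchy_ps (f : C -> C) (r rho M : R) : 0 < rho -> rho < r ->
  (forall t, rn t < r -> differentiable f t) ->
  (forall t, rn t <= rho -> rn (f t) <= M) ->
  exists a : nat -> C, (forall k, rn (a k) <= M / rho ^+ k) /\
    forall (z : C) N, rn z < rho ->
      rn (f z - \sum_(k < N) a k * z ^+ k) <= 2 * M * (rn z / rho) ^+ N * (rho / (rho - rn z)).
Proof.
move=> rho0 rhor Hf HM.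
have pi0 : 0 <= 2 * pi :> R by rewrite mulr_ge0 // pi_ge0.
have pi1 : 0 < 2 * pi :> R by rewrite mulr_gt0 // pi_gt0.
pose u t : C := rho%:C * cis t; pose v t : C := rho^-1%:C * cisN t.
have uv t : u t * v t = 1.
  rewrite /u /v mulrACA cisVN mulr1 -rmorphM divff ?gt_eqF // rmorph1 //.
have ru t : rn (u t) = rho by rewrite rnM rn_real rn_cis mulr1 gtr0_norm.
have rv t : rn (v t) = rho^-1 by rewrite rnM rn_real rn_cisN mulr1 gtr0_norm // invr_gt0.
have Du t : rD u t ('i%C * u t).
  have -> : 'i%C * u t = rho%:C * ('i%C * cis t) by rewrite /u; ring.
  by apply: rD_mulC; exact: rD_cis.
have Dv k t : rD (fun t => v t ^+ k) t (- (k%:R * 'i%C) * v t ^+ k).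
  have Dv1 : rD v t (- 'i%C * v t).
    have -> : - 'i%C * v t = rho^-1%:C * (- 'i%C * cisN t) by rewrite /v; ring.
    by apply: rD_mulC; exact: rD_cisN.
  have := rD_expr k Dv1; congr (rD _ _ _); case: k => [|k]; first by rewrite /= !expr0; ring.
  by rewrite /= [v t ^+ k.+1]exprS; ring.
(* Explicit primitive of [v ^+ k]: over a full turn it changes only for k = 0, which produces the
   factor 2 pi. *)
pose Z k t : C := if k is 0%N then t%:C else 'i%C / k%:R * v t ^+ k.
have ii : 'i%C * 'i%C = -1 :> C by rewrite -expr2 sqr_i.
have DZ k t : rD (Z k) t (v t ^+ k).
  case: k => [|k]; first by rewrite expr0; exact: rD_id.
  have -> : v t ^+ k.+1 = 'i%C / k.+1%:R * (- (k.+1%:R * 'i%C) * v t ^+ k.+1).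
    have k0 : k.+1%:R != 0 :> C by rewrite pnatr_eq0.
    rewrite -mulNr !mulrA -[- _]mulN1r; 
    transitivity (- ('i%C * 'i%C) * (k.+1%:R / k.+1%:R) * v t ^+ k.+1); last by field.
    by rewrite ii opprK divff // !mul1r.
  by apply: rD_mulC; exact: Dv.
have Z0 k : Z k (2 * pi) - Z k 0 = (if k is 0%N then (2 * pi)%:C else 0).
  case: k => [|k] /=; first by rewrite rmorph0 subr0.
  by rewrite /v cisN_2pi subrr.
have uE t : u t = rho%:C * cis t by [].
have Du' : forall t, rD u t ('i%C * u t) by [].
clearbody u v.
have Dfu t : rD (fun t => f (u t)) t ('i%C * u t * 'd f (u t) 1).
  by apply: rD_comp_cD => //; apply: differentiable_cD; apply: Hf; rewrite ru.
have /choice [P HP] : forall k, exists P : R -> C, forall t, 0 <= t <= 2 * pi ->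
    rD P t (f (u t) * v t ^+ k).
  move=> k; apply: (primitive_rD pi0) => t _; apply: rD_mul => //; exact: Dfu.
pose c k := P k (2 * pi) - P k 0.
have p0 : (2 * pi)%:C != 0 :> C by rewrite -rn_eq0 rn_real normr_eq0 gt_eqF.
exists (fun k => c k / (2 * pi)%:C); split.
  move=> k; rewrite rnM rnV rn_real gtr0_norm // ler_pdivrMr //.
  have := MVT_rn (M := M / rho ^+ k) pi0 (HP k); rewrite subr0; apply => t _.
  rewrite rnM rnX rv exprVn ler_pM2r ?invr_gt0 ?exprn_gt0 //.
  by apply: HM; rewrite ru.
move=> z N zr; have [Q [Q0 DQ]] := cauchy_pole rho0 rhor Hf zr.
have M0 : 0 <= M by apply: le_trans (HM 0 _); rewrite ?rn_ge0 // rn0 ltW.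
have uz t : u t - z != 0.
  rewrite -rn_gt0; have := rn_le (u t) z; rewrite ru; lra.
have w1 t : z * v t - 1 != 0.
  have -> : z * v t - 1 = - (u t - z) * v t by rewrite -(uv t); ring.
  rewrite mulf_neq0 ?oppr_eq0 // -rn_gt0 rv invr_gt0 //.
case: N => [|N].
  rewrite big_ord0 subr0 expr0 mulr1; apply: le_trans (HM _ (ltW zr)) _.
  rewrite mulrA ler_pdivlMr ?subr_gt0 //; have := rn_ge0 z; nra.
(* A combination of the primitives at hand whose derivative [D'] is the remainder of the geometric
   sum; its increment over a turn is 2 pi times the error at [z]. *)
pose D t : C := - 'i%C * Q t - \sum_(k < N.+1) z ^+ k * P k t + f z * (\sum_(k < N.+1) z ^+ k * Z k t).
pose D' t : C := (f (u t) - f z) * (z * v t) ^+ N.+1 * (u t / (u t - z)).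
have DD t : 0 <= t <= 2 * pi -> rD D t (D' t).
  move=> ht.
  have h1 : rD (fun t => \sum_(k < N.+1) z ^+ k * P k t : C) t (\sum_(k < N.+1) z ^+ k * (f (u t) * v t ^+ k)).
    apply: (@rD_sum N.+1 (fun k t => z ^+ k * P k t) (fun k t => z ^+ k * (f (u t) * v t ^+ k))).
    by move=> k; apply: rD_mulC; apply: HP.
  have h2 : rD (fun t => \sum_(k < N.+1) z ^+ k * Z k t : C) t (\sum_(k < N.+1) z ^+ k * v t ^+ k).
    apply: (@rD_sum N.+1 (fun k t => z ^+ k * Z k t) (fun k t => z ^+ k * v t ^+ k)).
    by move=> k; apply: rD_mulC; apply: DZ.
  have := rD_add (rD_add (rD_mulC (- 'i%C) (DQ t ht)) (rD_opp h1)) (rD_mulC (f z) h2).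
  congr (rD _ _ _); rewrite /D'.
  have -> : \sum_(k < N.+1) z ^+ k * (f (u t) * v t ^+ k) = f (u t) * \sum_(k < N.+1) (z * v t) ^+ k.
    by rewrite mulr_sumr; apply: eq_bigr => k _; rewrite [(z * v t) ^+ k]exprMn mulrCA.
  have -> : \sum_(k < N.+1) z ^+ k * v t ^+ k = \sum_(k < N.+1) (z * v t) ^+ k.
    by apply: eq_bigr => k _; rewrite [(z * v t) ^+ k]exprMn.
  have := subrX1 (z * v t) N.+1; set S := \sum_(k < N.+1) _ => HS.
  have -> : (z * v t) ^+ N.+1 = (z * v t - 1) * S + 1 by rewrite -HS; ring.
  have Ez : z = (u t - (u t - z)) by ring.
  have -> : (z * v t - 1) * S + 1 = 1 - (u t - z) * v t * S by rewrite -{1}(uv t); ring.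
  have -> : (f (u t) - f z) * (1 - (u t - z) * v t * S) * (u t / (u t - z)) =
     (f (u t) - f z) * (u t / (u t - z)) - (f (u t) - f z) * (u t * v t) * S by field.
  rewrite uv.
  have -> : - 'i%C * ((f (rho%:C * cis t) - f z) / (rho%:C * cis t - z) * (rho%:C * ('i%C * cis t))) =
     - ('i%C * 'i%C) * ((f (u t) - f z) * (u t / (u t - z))) by rewrite !uE; ring.
  by rewrite ii; ring.
have bD t : rn (D' t) <= 2 * M * (rn z / rho) ^+ N.+1 * (rho / (rho - rn z)).
  rewrite /D' !rnM rnX rnM rnV rv ru.
  have b1 : rn (f (u t) - f z) <= 2 * M.
    by apply: le_trans (rnB _ _) _; have := HM (u t); have := HM z; rewrite ru lexx ltW // => /(_ isT) ? /(_ isT) ?; lra.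
  have b2 : (rn (u t - z))^-1 <= (rho - rn z)^-1.
    rewrite lef_pV2 ?posrE ?rn_gt0 ?subr_gt0 //.
    by have := rn_le (u t) z; rewrite ru; lra.
  apply: ler_pM; rewrite ?mulr_ge0 ?exprn_ge0 ?mulr_ge0 ?invr_ge0 ?rn_ge0 ?(ltW rho0) //.
    by rewrite ler_wpM2r // exprn_ge0 // mulr_ge0 ?invr_ge0 ?rn_ge0 // ltW.
  by rewrite ler_pM2l.
have incD : D (2 * pi) - D 0 = f z * (2 * pi)%:C - \sum_(k < N.+1) z ^+ k * c k.
  have -> : D (2 * pi) - D 0 = - 'i%C * (Q (2 * pi) - Q 0)
     - (\sum_(k < N.+1) z ^+ k * P k (2 * pi) - \sum_(k < N.+1) z ^+ k * P k 0)
     + f z * (\sum_(k < N.+1) z ^+ k * Z k (2 * pi) - \sum_(k < N.+1) z ^+ k * Z k 0) by rewrite /D; ring.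
  rewrite Q0 mulr0 sub0r -!sumrB addrC; congr (_ * _ - _).
    under eq_bigr do rewrite -mulrBr Z0.
    rewrite big_ord_recl /= expr0 mul1r big1 ?addr0 // => k _.
    by rewrite mulr0.
  by apply: eq_bigr => k _; rewrite -mulrBr.
have := MVT_rn pi0 DD (fun t _ => bD t); rewrite incD subr0 => H.
rewrite -(ler_pM2r pi1); apply: le_trans H.
rewrite -[X in _ * X](gtr0_norm pi1) -rn_real -rnM mulrBl mulr_suml.
rewrite (_ : \sum_(k < N.+1) _ = \sum_(k < N.+1) z ^+ k * c k) // .
by apply: eq_bigr => k _; rewrite mulrAC divfK // mulrC.
Qed.

End CauchySeries.

(** * Sums of power series, their derivatives and Taylor coefficients *)

Section PowerSeries.
Variable R : realType.
Local Notation C := (Cplx R).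

Lemma cD_is_derive (f : C -> C) (z l : C) : cD f z l -> is_derive z 1 f l.
Proof.
move=> H.
have cv : h^-1 *: (f (h *: 1 + z) - f z) @[h --> 0^'] --> l.
  apply/cvgrPdist_le => e e0.
  have ee : e = (complex.Re e)%:C by have := ger0_Im (ltW e0); case: e {e0} => u v /= ->.
  move: e0; rewrite ee ltcR => e0; have [d d0 Hd] := H _ e0.
  apply/nbhs_ballP; exists d%:C => /=; rewrite ?ltcR // => h.
  rewrite /ball /= sub0r normrN ltcP => hd h0.
  have := Hd h hd; rewrite -[h *: 1]/(h * 1) mulr1 [h + z]addrC.
  have h0' : 0 < rn h by rewrite rn_gt0.
  rewrite distrC -[h^-1 *: _]/(h^-1 * _) lecP => Hh.
  by rewrite -(ler_pM2r h0') -rnM mulrBl mulrAC mulVf // mul1r (mulrC l).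
by split; [apply/cvg_ex; exists l | exact: cvg_lim cv].
Qed.

Lemma cD_differentiable (f : C -> C) (z l : C) : cD f z l -> differentiable f z.
Proof. by move=> /cD_is_derive [h _]; apply/derivable1_diffP. Qed.

Lemma cD_derive1 (f : C -> C) (z l : C) : cD f z l -> derive1 f z = l.
Proof. by move=> /cD_is_derive [_ h]; rewrite derive1E. Qed.

Lemma differentiable_derive1 (f : C -> C) z : differentiable f z -> cD f z (derive1 f z).
Proof. by move=> /differentiable_cD H; rewrite (cD_derive1 H). Qed.

(* Convergence at a geometric rate, which avoids the filter of series. *)
Definition conv (a : nat -> C) (z L : C) := exists q B : R, 0 <= q < 1 /\
  forall N, rn (L - \sum_(k < N) a k * z ^+ k) <= B * q ^+ N.

Lemma small_geo (q B e : R) : 0 <= q < 1 -> 0 < e -> exists N, forall n, (N <= n)%N -> B * q ^+ n < e.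
Proof.
move=> hq e0; have B0 : 0 < `|B| + 1 by rewrite ltr_wpDl.
have [N HN] := expr_small hq (divr_gt0 e0 B0); exists N => n /HN.
rewrite ltr_pdivlMr // mulrC; apply: le_lt_trans; apply: ler_wpM2r.
  by rewrite exprn_ge0 //; case/andP: hq.
by apply: le_trans (ler_norm _) _; rewrite lerDl.
Qed.

Lemma conv_uniq a z L1 L2 : conv a z L1 -> conv a z L2 -> L1 = L2.
Proof.
move=> [q1 [B1 [hq1 H1]]] [q2 [B2 [hq2 H2]]].
apply/eqP; rewrite -subr_eq0 -rn_eq0 eq_le rn_ge0 andbT.
apply/ler_addgt0Pr => e e0; rewrite add0r; have e2 : 0 < e / 2 by lra.
have [N1 HN1] := small_geo B1 hq1 e2; have [N2 HN2] := small_geo B2 hq2 e2.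
have h1 := HN1 _ (leq_maxl N1 N2); have h2 := HN2 _ (leq_maxr N1 N2).
have := H1 (maxn N1 N2); have := H2 (maxn N1 N2); set S := \sum_(k < _) _ => A2 A1.
by apply: le_trans (rn_trans S _ _) _; rewrite [rn (S - _)]rnBC; lra.
Qed.

(** The limit is the supremum of the lower bounds [u n - e n]; the hypothesis places every one of
    them below every upper bound [u m + e m]. *)
Lemma real_squeeze (u e : nat -> R) : (forall n m, (n <= m)%N -> `|u m - u n| <= e n) ->
  exists L, forall n, `|L - u n| <= e n.
Proof.
move=> H; have e0 n : 0 <= e n by apply: le_trans (H n n (leqnn n)); rewrite normr_ge0.
have key n m : u n - e n <= u m + e m.
  have := e0 n; have := e0 m.
  case: (leqP n m) => [|/ltnW] /H; rewrite ler_norml => /andP [h1 h2] h3 h4; lra.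
exists (sup (range (fun n => u n - e n))) => n; rewrite ler_distl; apply/andP; split.
  by apply: ub_le_sup; [exists (u 0%N + e 0%N) => _ [m _ <-] | exists n].
by apply: ge_sup; [exists (u 0%N - e 0%N); exists 0%N | move=> _ [m _ <-]].
Qed.

Lemma geo_sum (q : R) n m : 0 <= q < 1 -> (n <= m)%N -> \sum_(n <= k < m) q ^+ k <= q ^+ n / (1 - q).
Proof.
move=> /andP [q0 q1] nm; have q2 : 0 < 1 - q by rewrite subr_gt0.
rewrite ler_pdivlMr // mulr_suml.
have -> : \sum_(n <= k < m) q ^+ k * (1 - q) = \sum_(n <= k < m) (- q ^+ k.+1 - - q ^+ k).
  by apply: eq_bigr => k _; rewrite exprS; ring.
by rewrite telescope_sumr // opprK addrC lerBlDr lerDl exprn_ge0.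
Qed.

Lemma conv_ex (a : nat -> C) (M s : R) z : (forall k, rn (a k) <= M * s ^+ k) -> 0 <= s -> s * rn z < 1 ->
  exists L, forall N, rn (L - \sum_(k < N) a k * z ^+ k) <= 2 * M / (1 - s * rn z) * (s * rn z) ^+ N.
Proof.
move=> Ha s0 q1; set q := s * rn z in q1 *; have q0 : 0 <= q by rewrite mulr_ge0 // rn_ge0.
have M0 : 0 <= M by have := le_trans (rn_ge0 _) (Ha 0%N); rewrite expr0 mulr1.
pose S N := \sum_(k < N) a k * z ^+ k.
have HS n m : (n <= m)%N -> rn (S m - S n) <= M * (q ^+ n / (1 - q)).
  move=> nm; have -> : S m - S n = \sum_(n <= k < m) a k * z ^+ k.
    rewrite /S -!(big_mkord xpredT (fun k => a k * z ^+ k)) (big_cat_nat (leq0n n) nm) /=.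
    by rewrite addrAC subrr add0r.
  apply: le_trans (rn_sum _ _ _) _.
  apply: (@le_trans _ _ (\sum_(n <= k < m) M * q ^+ k)).
    apply: ler_sum => k _; rewrite rnM rnX /q exprMn mulrA ler_wpM2r ?exprn_ge0 ?rn_ge0 //.
  by rewrite -mulr_sumr ler_wpM2l // geo_sum // q0.
have [|x Hx] := @real_squeeze (fun n => complex.Re (S n)) (fun n => M * (q ^+ n / (1 - q))).
  by move=> n m nm; rewrite -cReB; apply: le_trans (Re_le _) (HS _ _ nm).
have [|y Hy] := @real_squeeze (fun n => complex.Im (S n)) (fun n => M * (q ^+ n / (1 - q))).
  by move=> n m nm; rewrite -cImN -cImD; apply: le_trans (Im_le _) (HS _ _ nm).
exists (x +i* y : C) => N; rewrite -/(S N); apply: le_trans (rn_le_ReIm _) _.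
rewrite cReB cImD cImN /=.
have := Hx N; have := Hy N.
have -> : 2 * M / (1 - q) * q ^+ N = M * (q ^+ N / (1 - q)) + M * (q ^+ N / (1 - q)).
  by field; rewrite gt_eqF // subr_gt0.
by lra.
Qed.

(** A total function with value 0 when there is no geometric convergence; otherwise [conv_uniq]
    leaves only one possible value. *)
Definition psum (a : nat -> C) (z : C) : C := xget 0 [set L | conv a z L].

Lemma conv_psum a z L : conv a z L -> psum a z = L.
Proof.
move=> H; apply: (@conv_uniq a z) => //.
exact: (@xgetPex _ 0 [set L | conv a z L] (ex_intro _ L H)).
Qed.

Lemma psumP (a : nat -> C) (M s : R) z : (forall k, rn (a k) <= M * s ^+ k) -> 0 <= s -> s * rn z < 1 ->
  forall N, rn (psum a z - \sum_(k < N) a k * z ^+ k) <= 2 * M / (1 - s * rn z) * (s * rn z) ^+ N.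
Proof.
move=> Ha s0 q1; have [L HL] := conv_ex Ha s0 q1.
rewrite (@conv_psum _ _ L) //; exists (s * rn z), (2 * M / (1 - s * rn z)).
by rewrite mulr_ge0 ?rn_ge0.
Qed.

Lemma psum_bound (a : nat -> C) (M s : R) z : (forall k, rn (a k) <= M * s ^+ k) -> 0 <= s -> s * rn z < 1 ->
  rn (psum a z) <= 2 * M / (1 - s * rn z).
Proof.
by move=> Ha s0 q1; have := psumP Ha s0 q1 0; rewrite big_ord0 subr0 expr0 mulr1.
Qed.

Lemma psumS (a : nat -> C) (M s : R) z : (forall k, rn (a k) <= M * s ^+ k) -> 0 <= s -> s * rn z < 1 ->
  psum a z = a 0%N + z * psum (fun k => a k.+1) z.
Proof.
move=> Ha s0 q1; apply: conv_psum.
have Ha' k : rn (a k.+1) <= (M * s) * s ^+ k by rewrite -mulrA -exprS.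
have q0 : 0 <= s * rn z by rewrite mulr_ge0 ?rn_ge0.
have M0 : 0 <= M by have := le_trans (rn_ge0 _) (Ha 0%N); rewrite expr0 mulr1.
have d0 : 0 < 1 - s * rn z by rewrite subr_gt0.
have H := psumP Ha' s0 q1.
exists (s * rn z), (rn (a 0%N + z * psum (fun k => a k.+1) z) + 2 * M / (1 - s * rn z)); split; first by rewrite q0.
case=> [|N].
  by rewrite big_ord0 subr0 expr0 mulr1 lerDl divr_ge0 ?mulr_ge0 // ltW.
rewrite big_ord_recl expr0 mulr1 /= /bump /=.
have -> : \sum_(i < N) a (1 + i)%N * z ^+ (1 + i) = z * \sum_(i < N) a i.+1 * z ^+ i.
  by rewrite mulr_sumr; apply: eq_bigr => i _; rewrite add1n exprS; ring.
rewrite opprD addrACA subrr add0r -mulrBr rnM.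
apply: (@le_trans _ _ (2 * M / (1 - s * rn z) * (s * rn z) ^+ N.+1)).
  apply: (@le_trans _ _ (rn z * (2 * (M * s) / (1 - s * rn z) * (s * rn z) ^+ N))).
    by rewrite ler_wpM2l ?rn_ge0.
  by apply: eqW; rewrite exprS; field; rewrite gt_eqF.
by rewrite ler_wpM2r ?exprn_ge0 // lerDr rn_ge0.
Qed.

(** Bernoulli's inequality for 1 / q = 1 + x gives k x q^k <= 1. *)
Lemma bernoulli_geo (q : R) : 0 < q < 1 -> exists2 B, 0 <= B & forall k, k%:R * q ^+ k <= B.
Proof.
move=> /andP [q0 q1]; pose x := q^-1 - 1.
have x0 : 0 < x by rewrite subr_gt0 invf_gt1.
exists x^-1; first by rewrite invr_ge0 ltW.
move=> k; have qk : 0 < q ^+ k by rewrite exprn_gt0.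
have h : 1 + k%:R * x <= (q ^+ k)^-1.
  rewrite -exprVn; have -> : q^-1 = 1 + x by rewrite /x; ring.
  elim: k {qk} => [|k IH]; first by rewrite expr0 mul0r addr0.
  rewrite exprS; apply: (@le_trans _ _ ((1 + x) * (1 + k%:R * x))).
    by rewrite -natr1; have : 0 <= k%:R * x * x :> R; [rewrite !mulr_ge0 // ltW | lra].
  by rewrite ler_pM2l //; lra.
rewrite -(ler_pM2r x0) mulVf ?gt_eqF //.
have := ler_wpM2l (ltW qk) h; rewrite divff ?gt_eqF //; lra.
Qed.

Section Deriv.
Variables (a : nat -> C) (M s : R).
Hypotheses (Ha : forall k, rn (a k) <= M * s ^+ k) (s0 : 0 <= s).

Let shb j k : rn (a (k + j)%N) <= (M * s ^+ j) * s ^+ k.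
Proof. by rewrite -mulrA -exprD addnC. Qed.

(** The tails of the series divided by z^j. For j > 0 they are the coefficients, as a series in w,
    of the quotient of [psum a w - psum a z] by [w - z], as in synthetic division. *)
Let b z j := psum (fun k => a (k + j)%N) z.

Let bS z j : s * rn z < 1 -> b z j = a j + z * b z j.+1.
Proof.
move=> q1; have := psumS (shb j) s0 q1.
have -> : (fun k => a (k.+1 + j)%N) = (fun k => a (k + j.+1)%N).
  by apply: funext => k; rewrite addSnnS.
by [].
Qed.

Let bB z j : s * rn z < 1 -> rn (b z j) <= 2 * (M * s ^+ j) / (1 - s * rn z).
Proof. by move=> q1; apply: psum_bound (shb j) s0 q1. Qed.

Let bB' z j : s * rn z < 1 -> rn (b z j.+1) <= (2 * (M * s) / (1 - s * rn z)) * s ^+ j.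
Proof. by move=> /(bB j.+1) h; apply: le_trans h _; apply: eqW; rewrite exprS; ring. Qed.

Let b0 z : b z 0 = psum a z.
Proof. by rewrite /b; have -> : (fun k => a (k + 0)%N) = a by apply: funext => k; rewrite addn0. Qed.

(** [key] is the finite form of the division: by [bS] the sums telescope up to the error
    [b z N * w ^+ N], which tends to 0. *)
Lemma psum_diff z w : s * rn z < 1 -> s * rn w < 1 ->
  psum a w - psum a z = (w - z) * psum (fun j => b z j.+1) w.
Proof.
move=> qz qw; rewrite -(b0 z).
have key N : (w - z) * (\sum_(j < N) b z j.+1 * w ^+ j) = b z N * w ^+ N + \sum_(j < N) a j * w ^+ j - b z 0.
  elim: N => [|N IH]; first by rewrite !big_ord0 expr0; ring.
  rewrite !big_ord_recr /= mulrDr IH exprS (bS N qz); ring.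
have H1 := psumP (fun j => bB' j qz) s0 qw; have H2 := psumP Ha s0 qw.
set L := (w - z) * _; set q := s * rn w in H1 H2 qw *.
have q0 : 0 <= q by rewrite mulr_ge0 ?rn_ge0.
apply/eqP; rewrite -subr_eq0 -rn_eq0 eq_le rn_ge0 andbT.
apply/ler_addgt0Pr => e e0; rewrite add0r.
pose B := rn (w - z) * (2 * (2 * (M * s) / (1 - s * rn z)) / (1 - q)) + 2 * M / (1 - q) + 2 * M / (1 - s * rn z).
have hq : 0 <= q < 1 by rewrite q0.
have [N HN] := small_geo B hq e0; apply: le_trans (ltW (HN N (leqnn N))).
have -> : psum a w - b z 0 - L = (psum a w - \sum_(j < N) a j * w ^+ j) - b z N * w ^+ N
   - (w - z) * (psum (fun j => b z j.+1) w - \sum_(j < N) b z j.+1 * w ^+ j).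
  by rewrite mulrBr key /L; ring.
have h3 : rn (b z N * w ^+ N) <= 2 * M / (1 - s * rn z) * q ^+ N.
  rewrite rnM rnX; apply: le_trans (ler_wpM2r _ (bB N qz)) _; first by rewrite exprn_ge0 ?rn_ge0.
  by apply: eqW; rewrite /q exprMn; ring.
have h4 := ler_wpM2l (rn_ge0 (w - z)) (H1 N); rewrite -rnM in h4.
have h5 := H2 N.
apply: le_trans (rnB _ _) _; apply: le_trans (lerD (rnB _ _) (lexx _)) _.
apply: le_trans (lerD (lerD h5 h3) h4) _; apply: eqW; rewrite /B; ring.
Qed.

(** On the diagonal w = z the quotient series is the termwise derivative. The correction in [key]
    carries a factor N, absorbed by passing from the ratio q to q' = (q + 1) / 2. *)
Lemma psum_deriv z : s * rn z < 1 -> psum (fun j => b z j.+1) z = psum (fun k => k.+1%:R * a k.+1) z.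
Proof.
move=> qz; symmetry; apply: conv_psum.
have key N : \sum_(j < N) b z j.+1 * z ^+ j =
   \sum_(k < N) k.+1%:R * a k.+1 * z ^+ k + N%:R * z ^+ N * b z N.+1.
  elim: N => [|N IH]; first by rewrite !big_ord0; ring.
  rewrite !big_ord_recr /= IH exprS (bS N.+1 qz) -natr1; ring.
have H1 := psumP (fun j => bB' j qz) s0 qz.
set q := s * rn z in H1 qz *; have q0 : 0 <= q by rewrite mulr_ge0 ?rn_ge0.
pose q' := (q + 1) / 2; have q'0 : 0 < q' by rewrite /q'; lra.
have q'1 : q' < 1 by rewrite /q'; lra. have qq' : q < q' by rewrite /q'; lra.
have [B B0 HB] : exists2 B, 0 <= B & forall k, k%:R * q ^+ k <= B * q' ^+ k.
  have [q00|q00] := leP q 0.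
    have -> : q = 0 by lra.
    exists 0 => // -[|k]; first by rewrite !mul0r.
    by rewrite exprS mul0r mulr0 mul0r.
  have [|B B0 HB] := @bernoulli_geo (q / q'); first by rewrite divr_gt0 //= ltr_pdivrMr // mul1r.
  exists B => // k; have := HB k; rewrite expr_div_n mulrA ler_pdivrMr ?exprn_gt0 //.
have q'01 : 0 <= q' < 1 by rewrite ltW.
exists q'; set B1 := 2 * (2 * (M * s) / (1 - q)) / (1 - q) in H1.
exists (B1 + 2 * (M * s) / (1 - q) * B); split=> // N.
have -> : psum (fun j => b z j.+1) z - \sum_(k < N) k.+1%:R * a k.+1 * z ^+ k =
  (psum (fun j => b z j.+1) z - \sum_(j < N) b z j.+1 * z ^+ j) + N%:R * z ^+ N * b z N.+1.
  by rewrite key; ring.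
have M0 : 0 <= M by have := le_trans (rn_ge0 _) (Ha 0%N); rewrite expr0 mulr1.
have dd : 0 < 1 - q by rewrite subr_gt0.
apply: le_trans (rnD _ _) _; rewrite mulrDl; apply: lerD.
  apply: le_trans (H1 N) _; apply: ler_wpM2l; last by apply: lerXn2r; rewrite ?nnegrE // ltW.
  by rewrite /B1 !mulr_ge0 ?invr_ge0 // ltW.
rewrite !rnM rnX rn_nat.
apply: (@le_trans _ _ (N%:R * rn z ^+ N * (2 * (M * s) / (1 - q) * s ^+ N))).
  by apply: ler_wpM2l (bB' N qz); rewrite mulr_ge0 // exprn_ge0 ?rn_ge0.
apply: (@le_trans _ _ (2 * (M * s) / (1 - q) * (N%:R * q ^+ N))).
  by apply: eqW; rewrite /q exprMn; ring.
rewrite -[X in _ <= X]mulrA; apply: ler_wpM2l => //.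
by rewrite !mulr_ge0 ?invr_ge0 // ltW.
Qed.

End Deriv.

Lemma psum_shift_bound (a : nat -> C) (M s : R) z j :
  (forall k, rn (a k) <= M * s ^+ k) -> 0 <= s -> s * rn z < 1 ->
  rn (psum (fun k => a (k + j.+1)%N) z) <= 2 * (M * s) / (1 - s * rn z) * s ^+ j.
Proof.
move=> Ha s0 qz; have H k : rn (a (k + j.+1)%N) <= (M * s ^+ j.+1) * s ^+ k.
  by rewrite -mulrA -exprD addnC.
apply: le_trans (psum_bound H s0 qz) _; apply: eqW; rewrite exprS; ring.
Qed.

(** Dividing twice by [w - z] writes the error of the difference quotient as h times a series that
    stays bounded near z. *)
Lemma psum_cD (a : nat -> C) (M s : R) z : (forall k, rn (a k) <= M * s ^+ k) -> 0 <= s ->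
  s * rn z < 1 -> cD (psum a) z (psum (fun k => k.+1%:R * a k.+1) z).
Proof.
move=> Ha s0 qz e e0; rewrite -(psum_deriv Ha s0 qz).
have Hb := fun j => psum_shift_bound j Ha s0 qz.
have Hc := fun j => psum_shift_bound j Hb s0 qz.
set q := s * rn z in qz Hb Hc *; have q0 : 0 <= q by rewrite mulr_ge0 ?rn_ge0.
set M2 := 2 * _ / _ in Hc.
have M20 : 0 <= M2 by have := le_trans (rn_ge0 _) (Hc 0%N); rewrite expr0 mulr1.
pose K := 2 * M2 / ((1 - q) / 2).
have q2 : 0 < (1 - q) / 2 by rewrite divr_gt0 // subr_gt0.
have K0 : 0 <= K by rewrite /K mulr_ge0 ?invr_ge0 ?(ltW q2) // mulr_ge0.
have s1 : 0 < s + 1 by lra. have K1 : 0 < K + 1 by lra.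
exists (Num.min ((1 - q) / 2 / (s + 1)) (e / (K + 1))); first by rewrite lt_min (divr_gt0 q2 s1) (divr_gt0 e0 K1).
move=> h; rewrite lt_min => /andP [h1 h2].
have qw : s * rn (z + h) <= (1 + q) / 2.
  apply: le_trans (ler_wpM2l s0 (rnD _ _)) _; rewrite mulrDr.
  have : s * rn h <= (s + 1) * rn h by rewrite ler_wpM2r ?rn_ge0 //; lra.
  move: h1; rewrite ltr_pdivlMr // mulrC /q; lra.
have qw1 : s * rn (z + h) < 1 by apply: le_lt_trans qw _; lra.
have := psum_diff Ha s0 qz qw1; rewrite [z + h - z]addrC addKr => ->.
rewrite -mulrBr (psum_diff Hb s0 qz qw1) [z + h - z]addrC addKr !rnM.
rewrite [e * _]mulrC ler_wpM2l ?rn_ge0 //.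
have hK : rn (psum (fun j => psum (fun k => psum (fun i => a (i + (k + j.+1).+1)%N) z) z) (z + h)) <= K.
  apply: le_trans (psum_bound Hc s0 qw1) _.
  apply: ler_wpM2l; first by rewrite mulr_ge0.
  by rewrite lef_pV2 ?posrE //; lra.
apply: (@le_trans _ _ (e / (K + 1) * (K + 1))); last by rewrite divfK // gt_eqF.
by apply: ler_pM; rewrite ?rn_ge0 //; [exact: ltW | apply: le_trans hK _; lra].
Qed.

(** Since k + 1 <= 2^k, the derived series keeps a geometric bound, at the price of doubling the
    rate. *)
Lemma deriv_coef_bound (a : nat -> C) (M s : R) : (forall k, rn (a k) <= M * s ^+ k) -> 0 <= s ->
  forall k, rn (k.+1%:R * a k.+1) <= (M * s) * (2 * s) ^+ k.
Proof.
move=> Ha s0 k; rewrite rnM rn_nat exprMn.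
have M0 : 0 <= M by have := le_trans (rn_ge0 _) (Ha 0%N); rewrite expr0 mulr1.
apply: (@le_trans _ _ (2 ^+ k * (M * s ^+ k.+1))).
  apply: ler_pM; rewrite ?rn_ge0 // -natrX ler_nat; exact: ltn_expl.
by apply: eqW; rewrite exprS; ring.
Qed.

Lemma near_derive1n (f g : C -> C) n (d : R) : (forall t, rn t < d -> f t = g t) ->
  forall t, rn t < d -> derive1n n f t = derive1n n g t.
Proof.
move=> H; elim: n => [//|n IH] t td; rewrite !derive1nS.
rewrite !derive1E; apply: near_eq_derive.
apply/(nearP t (fun u => derive1n n f u = derive1n n g u)); exists (d - rn t); first by rewrite subr_gt0.
move=> u ut; apply: IH; have := rn_le u t; lra.
Qed.

(** Induction with [a], [M] and [s] general, since each differentiation changes the coefficients and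
    doubles the rate. *)
Lemma derive1n_psum (a : nat -> C) (M s : R) n : (forall k, rn (a k) <= M * s ^+ k) -> 0 <= s ->
  derive1n n (psum a) 0 = n`!%:R * a n.
Proof.
elim: n a M s => [|n IH] a M s Ha s0.
  rewrite derive1n0 fact0 mul1r; apply: conv_psum; exists 0, (rn (a 0%N)); split; first by rewrite lexx ltr01.
  case=> [|N]; first by rewrite big_ord0 subr0 expr0 mulr1.
  rewrite big_ord_recl expr0 mulr1 big1 ?addr0 ?subrr ?rn0 ?expr0n ?mulr0 //.
  by move=> i _; rewrite expr0n /= mulr0.
rewrite derive1Sn.
have d0 : 0 < (s + 1)^-1 by rewrite invr_gt0; lra.
have E t : rn t < (s + 1)^-1 -> derive1 (psum a) t = psum (fun k => k.+1%:R * a k.+1) t.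
  move=> ht; apply: cD_derive1; apply: (psum_cD Ha s0).
  move: ht; rewrite -[X in _ < X]mul1r ltr_pdivlMr; last by lra.
  by have := rn_ge0 t; nra.
rewrite (near_derive1n n E) ?rn0 // (IH _ _ _ (deriv_coef_bound Ha s0)) ?mulr_ge0 //.
by rewrite factS natrM; ring.
Qed.

Definition hol (r : R) (f : C -> C) := forall t, rn t < r -> differentiable f t.

Lemma holo_at_hol (f : C -> C) : holo_at f 0 -> exists2 r, 0 < r & hol r f.
Proof. by move=> /near0P. Qed.

Lemma hol_psum (a : nat -> C) (M s : R) : (forall k, rn (a k) <= M * s ^+ k) -> 0 <= s ->
  forall r, s * r <= 1 -> hol r (psum a).
Proof.
move=> Ha s0 r sr t tr; apply: (cD_differentiable (psum_cD Ha s0 _)).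
have [->|/eqP s1] := eqVneq s 0; first by rewrite mul0r.
apply: lt_le_trans sr; rewrite ltr_pM2l // lt_neqAle s0 eq_sym andbT; exact/eqP.
Qed.

(** A convergent power series determines its derivatives at 0, so the coefficients of the Cauchy
    expansion are [taylorc f], the numbers in terms of which [compcoef] is defined. *)
Lemma hol_expand (f : C -> C) (r rho M : R) : 0 < rho -> rho < r -> hol r f ->
  (forall t, rn t <= rho -> rn (f t) <= M) ->
  [/\ (forall k, rn (taylorc f k) <= M / rho ^+ k),
      (forall z, rn z < rho -> f z = psum (taylorc f) z) &
      forall z N, rn z < rho ->
        rn (f z - \sum_(k < N) taylorc f k * z ^+ k) <= 2 * M * (rn z / rho) ^+ N * (rho / (rho - rn z))].
Proof.
move=> rho0 rhor Hf HM; have [a [Ha H]] := cauchy_ps rho0 rhor Hf HM.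
have E z : rn z < rho -> f z = psum a z.
  move=> zr; symmetry; apply: conv_psum; exists (rn z / rho), (2 * M * (rho / (rho - rn z))).
  split; first by rewrite divr_ge0 ?rn_ge0 ?(ltW rho0) //= ltr_pdivrMr // mul1r.
  by move=> N; rewrite mulrAC; exact: H.
have Ha' k : rn (a k) <= M * rho^-1 ^+ k by rewrite exprVn.
have ta : taylorc f = a.
  apply: funext => k; rewrite /taylorc.
  rewrite (near_derive1n k E) ?rn0 // (derive1n_psum _ Ha') ?invr_ge0 ?(ltW rho0) //.
  by rewrite mulrC mulKf // pnatr_eq0 -lt0n fact_gt0.
by rewrite ta.
Qed.

End PowerSeries.

(** * Orders of vanishing at 0 *)

Section BigO.
Variable R : realType.
Local Notation C := (Cplx R).

(** The bound is required at 0 as well, so for N > 0 it forces [f 0 = 0]. *)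
Definition bigo (V : normedModType C) (N : nat) (f : V -> C) := exists K d : R,
  [/\ 0 <= K, 0 < d & forall x, rn x < d -> rn (f x) <= K * rn x ^+ N].

Section Ops.
Variable V : normedModType C.
Implicit Types f g : V -> C.

Lemma bigo_near N f g : (\forall x \near (0 : V), f x = g x) -> bigo N f -> bigo N g.
Proof.
move=> /near0P [d1 d10 E] [K [d [K0 d0 H]]]; exists K, (Num.min d d1); split=> //.
  by rewrite lt_min d0.
by move=> x; rewrite lt_min => /andP [h1 h2]; rewrite -E // H.
Qed.

Lemma bigo_ext N f g : f =1 g -> bigo N f -> bigo N g.
Proof. by move=> E; apply: bigo_near; near=> x; apply: E. Unshelve. all: end_near. Qed.

Lemma bigoD N f g : bigo N f -> bigo N g -> bigo N (fun x => f x + g x).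
Proof.
move=> [K [d [K0 d0 H]]] [L [d1 [L0 d10 H1]]]; exists (K + L), (Num.min d d1); split.
- by rewrite addr_ge0.
- by rewrite lt_min d0.
move=> x; rewrite lt_min => /andP [/H h /H1 h1]; rewrite mulrDl.
exact: le_trans (rnD _ _) (lerD h h1).
Qed.

Lemma bigoM N M f g : bigo N f -> bigo M g -> bigo (N + M) (fun x => f x * g x).
Proof.
move=> [K [d [K0 d0 H]]] [L [d1 [L0 d10 H1]]]; exists (K * L), (Num.min d d1); split.
- by rewrite mulr_ge0.
- by rewrite lt_min d0.
move=> x; rewrite lt_min => /andP [/H h /H1 h1]; rewrite exprD mulrACA rnM.
by apply: ler_pM; rewrite ?rn_ge0.
Qed.

Lemma bigo_cst (c : C) : bigo 0 (fun _ : V => c).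
Proof. by exists (rn c), 1; split; rewrite ?rn_ge0 // => x _; rewrite expr0 mulr1. Qed.

Lemma bigoZ N (c : C) f : bigo N f -> bigo N (fun x => c * f x).
Proof. exact: bigoM (bigo_cst c). Qed.

Lemma bigoN N f : bigo N f -> bigo N (fun x => - f x).
Proof. by move=> /(bigoZ (-1)); apply: bigo_ext => x; rewrite mulN1r. Qed.

Lemma bigoB N f g : bigo N f -> bigo N g -> bigo N (fun x => f x - g x).
Proof. by move=> h1 h2; apply: bigoD h1 (bigoN h2). Qed.

Lemma bigo0 N : bigo N (fun _ : V => 0).
Proof. by exists 0, 1; split=> // x _; rewrite rn0 mul0r. Qed.

Lemma bigo_sum N (I : Type) (r : seq I) (P : pred I) (F : I -> V -> C) :
  (forall i, P i -> bigo N (F i)) -> bigo N (fun x => \sum_(i <- r | P i) F i x).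
Proof.
move=> H; elim: r => [|i r IH]; first by apply: bigo_ext (bigo0 N) => x; rewrite big_nil.
have [Pi|Pi] := boolP (P i).
  by apply: bigo_ext (bigoD (H i Pi) IH) => x; rewrite big_cons Pi.
by apply: bigo_ext IH => x; rewrite big_cons (negbTE Pi).
Qed.

Lemma bigo_le N M f : (N <= M)%N -> bigo M f -> bigo N f.
Proof.
move=> NM [K [d [K0 d0 H]]]; exists K, (Num.min d 1); split; rewrite ?lt_min ?d0 ?ltr01 //.
move=> x; rewrite lt_min => /andP [/H h h1]; apply: le_trans h _.
by rewrite ler_wpM2l // ler_wiXn2l ?rn_ge0 // ltW.
Qed.

Lemma bigo_J N f : bigo N f -> bigo N (fun x => (f x)^*%C : C).
Proof. by move=> [K [d [K0 d0 H]]]; exists K, d; split=> // x /H; rewrite rnJ. Qed.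

Lemma bigo_Re N f : bigo N f -> bigo N (fun x => (complex.Re (f x))%:C : C).
Proof.
move=> [K [d [K0 d0 H]]]; exists K, d; split=> // x /H; rewrite rn_real.
by apply: le_trans; exact: Re_le.
Qed.

Lemma bigo_comp (W : normedModType C) N (f : W -> C) (g : V -> W) (L d : R) : 0 <= L -> 0 < d ->
  (forall x, rn x < d -> rn (g x) <= L * rn x) -> bigo N f -> bigo N (fun x => f (g x)).
Proof.
move=> L0 d0 Hg [K [d1 [K0 d10 H]]]; have L1 : 0 < L + 1 by lra.
exists (K * L ^+ N), (Num.min d (d1 / (L + 1))); split.
- by rewrite mulr_ge0 // exprn_ge0.
- by rewrite lt_min d0 divr_gt0.
move=> x; rewrite lt_min => /andP [/Hg h]; rewrite ltr_pdivlMr // mulrDr mulr1 mulrC => h1.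
have := rn_ge0 x => h0.
apply: le_trans (H _ _) _; first by apply: le_lt_trans h _; lra.
by rewrite -mulrA -exprMn ler_wpM2l // lerXn2r ?nnegrE ?rn_ge0 // mulr_ge0.
Qed.
End Ops.

Lemma bigo_id : bigo 1 (fun t : C => t).
Proof. by exists 1, 1; split=> // x _; rewrite mul1r expr1. Qed.

Lemma bigo_exp k : bigo k (fun t : C => t ^+ k).
Proof. by exists 1, 1; split=> // x _; rewrite rnX mul1r. Qed.

(** The constant term is the limit at 0 and vanishes; dividing by s lowers the degree and the order
    together. Only positive real s are used, so the lemma also serves for expressions that are
    polynomial merely along real rays. *)
Lemma real_poly_small (N : nat) (c : nat -> C) (K d : R) : 0 < d ->
  (forall s : R, 0 < s < d -> rn (\sum_(k < N) c k * s%:C ^+ k) <= K * s ^+ N) ->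
  forall k, (k < N)%N -> c k = 0.
Proof.
move=> d0; elim: N c => [//|N IH] c H.
have E (s : R) : \sum_(k < N.+1) c k * s%:C ^+ k = c 0%N + s%:C * \sum_(k < N) c k.+1 * s%:C ^+ k :> C.
  rewrite big_ord_recl expr0 mulr1 mulr_sumr; congr (_ + _); apply: eq_bigr => k _.
  by rewrite lift0 exprS; ring.
have c0 : c 0%N = 0.
  apply/eqP; rewrite -rn_eq0 eq_le rn_ge0 andbT; apply/ler_addgt0Pr => e e0; rewrite add0r.
  pose B := `|K| + \sum_(k < N) rn (c k.+1).
  have B0 : 0 <= B by rewrite addr_ge0 // sumr_ge0 // => k _; rewrite rn_ge0.
  pose s := Num.min (d / 2) (Num.min 1 (e / (B + 1))).
  have s0 : 0 < s by rewrite !lt_min ltr01 !divr_gt0 // ltr_wpDl.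
  have := lexx s; rewrite {2}/s !le_min => /andP [s1 /andP [s2 s3]].
  have hs := H s; rewrite s0 E in hs.
  have h1 := hs ltac:(apply: le_lt_trans s1 _; lra).
  have h2 : rn (s%:C * \sum_(k < N) c k.+1 * s%:C ^+ k) <= s * \sum_(k < N) rn (c k.+1).
    rewrite rnM rn_real gtr0_norm // ler_pM2l //; apply: le_trans (rn_sum _ _ _) _.
    apply: ler_sum => k _; rewrite rnM rnX rn_real gtr0_norm // ler_piMr ?rn_ge0 //.
    by rewrite exprn_ile1 // ltW.
  have h3 : K * s ^+ N.+1 <= s * `|K|.
    rewrite exprS mulrCA ler_pM2l //; apply: le_trans (ler_norm _) _.
    rewrite normrM ler_piMr // ger0_norm ?exprn_ge0 ?(ltW s0) // exprn_ile1 // ltW //.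
  rewrite -[c 0%N](addrK (s%:C * \sum_(k < N) c k.+1 * s%:C ^+ k)).
  apply: le_trans (rnB _ _) _.
  apply: (@le_trans _ _ (s * B)); first by rewrite /B mulrDr; lra.
  move: s3; rewrite ler_pdivlMr ?ltr_wpDl //; lra.
case=> [//|k]; rewrite ltnS; apply: (IH (fun k => c k.+1)) => s /andP [s0 sd].
have := H s; rewrite s0 sd E c0 add0r rnM rn_real gtr0_norm // exprS mulrCA ler_pM2l //.
exact.
Qed.

(** On the ray through [l] the coefficient of s^k is Re (c_k l^k). Choosing [l] as a k-th root of
    the conjugate of c_k makes it |c_k|^2. The index 0 is left out: the real part does not see an
    imaginary constant. *)
Lemma Re_poly_small N (c : nat -> C) :
  bigo N (fun t : C => (complex.Re (\sum_(k < N) c k * t ^+ k))%:C) ->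
  forall k, (0 < k < N)%N -> c k = 0.
Proof.
move=> [K [d [K0 d0 H]]] k /andP [k0 kN].
have key (l : C) : complex.Re (c k * l ^+ k) = 0.
  have l1 : 0 < rn l + 1 by rewrite ltr_wpDl ?rn_ge0.
  have d1 : 0 < d / (rn l + 1) by rewrite divr_gt0.
  have := @real_poly_small N (fun k => (complex.Re (c k * l ^+ k))%:C) (K * rn l ^+ N) _ d1 _ k kN.
  move=> h; have /(congr1 (@complex.Re R)) : (complex.Re (c k * l ^+ k))%:C = 0 :> C; last by [].
  apply: h => s /andP [s0 sd].
  have := H (s%:C * l); rewrite rnM rn_real gtr0_norm //.
  have -> : s * rn l < d.
    move: sd; rewrite ltr_pdivlMr // mulrDr; lra.
  move=> /(_ isT); rewrite exprMn => h; rewrite -mulrA [rn l ^+ N * _]mulrC.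
  apply: le_trans h; apply: eqW; congr rn.
  rewrite cRe_sum rmorph_sum; apply: eq_bigr => i _.
  rewrite -rmorphXn -rmorphM /=; congr (_%:C).
  by rewrite mulrC -cReZ rmorphXn exprMn; congr complex.Re; ring.
have := key (k.-root (c k)^*%C); rewrite rootCK // => h.
have : rn (c k) ^+ 2 = complex.Re (c k * (c k)^*%C).
  by rewrite sqr_rn; case: (c k) => u v /=; ring.
by rewrite h => /eqP; rewrite sqrf_eq0 rn_eq0 => /eqP.
Qed.

Lemma poly_small N (c : nat -> C) :
  bigo N (fun t : C => \sum_(k < N) c k * t ^+ k) -> forall k, (k < N)%N -> c k = 0.
Proof.
move=> [K [d [K0 d0 H]]]; apply: (real_poly_small (K := K) d0) => s /andP [s0 sd].
by have := H s%:C; rewrite rn_real gtr0_norm // => /(_ sd).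
Qed.

Lemma differentiable_bound (V W : normedModType C) (f : V -> W) x : differentiable f x ->
  forall e, 0 < e -> exists2 d, 0 < d & forall y, rn (y - x) < d -> rn (f y - f x) < e.
Proof. by move=> /differentiable_continuous /contP. Qed.

Lemma hol_germ (f : C -> C) r : 0 < r -> hol r f -> exists rho M, [/\ 0 < rho, rho < r, 0 <= M &
  forall t, rn t <= rho -> rn (f t) <= M].
Proof.
move=> r0 Hf; have := Hf 0; rewrite rn0 => /(_ r0) /differentiable_bound /(_ 1 ltr01) [d d0 Hd].
exists (Num.min d r / 2), (rn (f 0) + 1); have m0 : 0 < Num.min d r by rewrite lt_min d0.
have mr : Num.min d r <= r by rewrite ge_min lexx orbT.
have md : Num.min d r <= d by rewrite ge_min lexx.
split; [lra | lra | by have := rn_ge0 (f 0); lra | move=> t ht].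
have := Hd t; rewrite subr0 => h; have := rn_le (f t) (f 0).
have : rn (f t - f 0) < 1 by apply: h; lra.
lra.
Qed.

Lemma hol_taylor (f : C -> C) r N : 0 < r -> hol r f ->
  bigo N (fun t => f t - \sum_(k < N) taylorc f k * t ^+ k).
Proof.
move=> r0 Hf; have [rho [M [h1 h2 h3 h4]]] := hol_germ r0 Hf.
have [_ _ H] := hol_expand h1 h2 Hf h4.
exists (4 * M / rho ^+ N), (rho / 2); split; [|lra|].
  by rewrite divr_ge0 ?exprn_ge0 ?mulr_ge0 // ltW.
move=> t ht; apply: le_trans (H t N _) _; first by lra.
have h5 : rho / (rho - rn t) <= 2 by rewrite ler_pdivrMr; lra.
have h6 : 0 <= 2 * M * (rn t / rho) ^+ N.
  by rewrite !mulr_ge0 ?exprn_ge0 ?mulr_ge0 ?invr_ge0 ?rn_ge0 // ltW.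
apply: le_trans (ler_wpM2l h6 h5) _; apply: eqW; rewrite expr_div_n; ring.
Qed.

Lemma hol_bigo_coef (f : C -> C) r N : 0 < r -> hol r f -> bigo N f ->
  forall k, (k < N)%N -> taylorc f k = 0.
Proof.
move=> r0 Hf fN; apply: poly_small.
by apply: bigo_ext (bigoB fN (hol_taylor N r0 Hf)) => t; rewrite opprB addrC subrK.
Qed.

Lemma hol_coef_bigo (f : C -> C) r N : 0 < r -> hol r f ->
  (forall k, (k < N)%N -> taylorc f k = 0) -> bigo N f.
Proof.
move=> r0 Hf H; apply: bigo_ext (hol_taylor N r0 Hf) => t.
by rewrite big1 ?subr0 // => k _; rewrite H ?mul0r.
Qed.

Lemma taylorc0 (f : C -> C) : taylorc f 0 = f 0.
Proof. by rewrite /taylorc derive1n0 fact0 divr1. Qed.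

Lemma hol_Re_coef (f : C -> C) r N : 0 < r -> hol r f ->
  bigo N (fun t => (complex.Re (f t))%:C : C) -> forall k, (0 < k < N)%N -> taylorc f k = 0.
Proof.
move=> r0 Hf fN; apply: Re_poly_small.
apply: bigo_ext (bigoB fN (bigo_Re (hol_taylor N r0 Hf))) => t.
by rewrite -rmorphB -cReB opprB addrC subrK.
Qed.

Lemma hol_zero (f : C -> C) r : 0 < r -> hol r f -> (forall k, taylorc f k = 0) ->
  \forall t \near (0 : C), f t = 0.
Proof.
move=> r0 Hf H; have [rho [M [h1 h2 h3 h4]]] := hol_germ r0 Hf.
have [_ E _] := hol_expand h1 h2 Hf h4; apply/near0P; exists rho => // t tr.
rewrite E //; apply: conv_psum; exists 0, 0; split; first by rewrite lexx ltr01.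
by move=> N; rewrite sub0r rnN mul0r big1 ?rn0 // => k _; rewrite H mul0r.
Qed.

Lemma hol_shift (f : C -> C) r z : hol r f -> hol (r - rn z) (fun t => f (z + t)).
Proof.
move=> Hf t tr; apply: (@differentiable_comp _ _ _ _ (fun t => z + t) f).
  by apply: differentiableD.
by apply: Hf; have := rnD z t; lra.
Qed.

(** Expanding about z makes the derivative near z a termwise derived series, which is differentiable
    by [psum_cD]. *)
Lemma hol_derive1 (f : C -> C) r : hol r f -> hol r (derive1 f).
Proof.
move=> Hf z zr; have r0 : 0 < r - rn z by rewrite subr_gt0.
have Hg := @hol_shift f r z Hf; have [rho [M [h1 h2 h3 h4]]] := hol_germ r0 Hg.
have [B E _] := hol_expand h1 h2 Hg h4.
set a := taylorc _ in B E; set s := rho^-1.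
have Ha k : rn (a k) <= M * s ^+ k by rewrite exprVn.
have s0 : 0 < s by rewrite invr_gt0.
have D1 t : rn t < rho -> derive1 f (z + t) = psum (fun k => k.+1%:R * a k.+1) t.
  move=> tr; apply: cD_derive1.
  have st : s * rn t < 1 by rewrite mulrC ltr_pdivrMr // mul1r.
  have := psum_cD Ha (ltW s0) st => H e /H [d d0 Hd].
  exists (Num.min d (rho - rn t)); first by rewrite lt_min d0 subr_gt0.
  move=> h; rewrite lt_min => /andP [/Hd h5 h6].
  have -> : f (z + t + h) = psum a (t + h).
    by rewrite -[z + t + h]addrA; apply: E; apply: le_lt_trans (rnD _ _) _; lra.
  by rewrite (E _ tr).
have Hb := deriv_coef_bound Ha (ltW s0).
have c0 : 2 * s * rn (0 : C) < 1 by rewrite rn0 mulr0.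
have s2 : 0 <= 2 * s by rewrite mulr_ge0 // ltW.
have := psum_cD Hb s2 c0 => H.
apply: (@cD_differentiable _ _ z (psum (fun k : nat => k.+1%:R * (k.+2%:R * a k.+2)) 0)).
move=> e /H [d d0 Hd]; exists (Num.min d rho); first by rewrite lt_min d0.
move=> h; rewrite lt_min => /andP [/Hd h5 h6].
have E0 : derive1 f z = psum (fun k => k.+1%:R * a k.+1) 0.
  have z0 : z + 0 = z by rewrite addr0.
  have r00 : rn (0 : C) < rho by rewrite rn0.
  by have := D1 0 r00; rewrite z0.
have h0 : 0 + h = h by rewrite add0r.
by rewrite h0 in h5; rewrite E0 (D1 h h6).
Qed.

(** The function is restricted to the complex line through [x] and [y], where the case N = 1 of
    [hol_expand] bounds the increment; pairs at distance at least d / 2 are covered by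
    boundedness. *)
Lemma holo_lip (V : normedModType C) (f : V -> C) (a : V) : holo_at f a -> exists L d : R,
  [/\ 0 <= L, 0 < d & forall x y, rn (x - a) < d -> rn (y - a) < d -> rn (f x - f y) <= L * rn (x - y)].
Proof.
move=> /nearP [d1 d10 Hf].
have := Hf a; rewrite subrr rn0 => /(_ d10) /differentiable_bound /(_ 1 ltr01) [d2 d20 Hb].
pose d := Num.min d1 d2 / 4; have m0 : 0 < Num.min d1 d2 by rewrite lt_min d10.
have d0 : 0 < d by rewrite /d; lra.
have dd1 : 4 * d <= d1 by have : Num.min d1 d2 <= d1 by [rewrite ge_min lexx]; rewrite /d; lra.
have dd2 : 4 * d <= d2 by have : Num.min d1 d2 <= d2 by [rewrite ge_min lexx orbT]; rewrite /d; lra.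
pose M := rn (f a) + 1; have M0 : 0 < M by rewrite ltr_wpDl ?rn_ge0.
have bM x : rn (x - a) < 4 * d -> rn (f x) <= M.
  move=> h; have := rn_le (f x) (f a); have := Hb x (lt_le_trans h dd2); rewrite /M; lra.
exists (4 * M / d), d; split=> //; first by rewrite divr_ge0 ?mulr_ge0 // ltW.
move=> x y hx hy; set n := rn (x - y).
have [n0|n0] := leP (d / 2) n.
  apply: (@le_trans _ _ (2 * M)).
    by apply: le_trans (rnB _ _) _; have := bM x; have := bM y; move=> b1 b2;
       have := b1 ltac:(lra); have := b2 ltac:(lra); lra.
  rewrite mulrAC ler_pdivlMr //; nra.
have [/eqP xy|xy] := eqVneq n 0.
  have xe : x = y by apply/eqP; rewrite -subr_eq0 -rn_eq0.
  by rewrite xe subrr rn0 (eqP xy) mulr0.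
have np : 0 < n by rewrite lt_neqAle eq_sym xy rn_ge0.
pose u := n^-1%:C *: (x - y).
have u1 : rn u = 1 by rewrite rnZ rn_real gtr0_norm ?invr_gt0 // mulVf.
pose g (t : C) := f (y + t *: u).
have cl t : rn t < 2 * d -> rn (y + t *: u - a) < 4 * d.
  move=> ht; rewrite addrAC; apply: le_lt_trans (rnD _ _) _; rewrite rnZ u1; lra.
have Hg : hol (2 * d) g.
  move=> t ht; rewrite /g; apply: (@differentiable_comp _ _ _ _ (fun t : C => y + t *: u) f).
    by apply: differentiableD => //; apply: differentiableZl.
  by apply: Hf; apply: lt_le_trans (cl t ht) _.
have [||_ _ /(_ n%:C 1%N)] := @hol_expand _ g (2 * d) d M d0 _ Hg.
- by lra.
- by move=> t ht; apply: bM; apply: cl; lra.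
rewrite big_ord1 expr0 mulr1 taylorc0 rn_real gtr0_norm // => h.
have := h ltac:(lra).
rewrite /g /u scale0r addr0 scalerA -rmorphM divff // rmorph1 scale1r [y + _]addrC subrK expr1 => {h} h.
apply: le_trans h _.
have : d / (d - n) <= 2 by rewrite ler_pdivrMr; lra.
move=> h; have h6 : 0 <= 2 * M * (n / d) by rewrite !mulr_ge0 ?invr_ge0 // ltW.
by apply: le_trans (ler_wpM2l h6 h) _; apply: eqW; ring.
Qed.

End BigO.

(** * Real smooth functions on complex normed modules *)

Section Smooth.
Variable R : realType.
Local Notation C := (Cplx R).

Definition dD (V : normedModType C) (g : V -> C) (v x : V) (l : C) :=
  rD (fun h : R => g (x + h%:C *: v)) 0 l.

Lemma dD_cvg (V : normedModType C) (g : V -> C) v x l :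
  dD g v x l <-> dquot g v x h @[h --> 0^'] --> l.
Proof.
split=> [H|].
  apply/cvgrPdist_le => e e0.
  have ee : e = (complex.Re e)%:C by have := ger0_Im (ltW e0); case: e {e0} => u w /= ->.
  move: e0; rewrite ee ltcR => e0; have [d d0 Hd] := H _ e0.
  apply/nbhs_ballP; exists d => //= h; rewrite /ball /= sub0r normrN => hd h0.
  have := Hd h hd; rewrite add0r scale0r addr0 /dquot -[h%:C *: l]/(h%:C * l).
  have h0' : 0 < `|h| by rewrite normr_gt0.
  have h0'' : h%:C != 0 :> C by rewrite -rn_gt0 rn_real.
  rewrite distrC lecP => Hh.
  by rewrite -(ler_pM2r h0') -(rn_real h) -rnM mulrBl mulrAC mulVf // mul1r (mulrC l) rn_real.
move=> /cvgrPdist_le H e e0.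
have e0' : (0 : C) < e%:C by rewrite ltcR.
have /nbhs_ballP [d /= d0 Hd] := H _ e0'; exists d => // h hd.
rewrite add0r scale0r addr0; have [->|h0] := eqVneq h 0.
  by rewrite scale0r addr0 rmorph0 scale0r !subrr rn0 normr0 mulr0.
have := Hd h; rewrite /ball /= sub0r normrN => /(_ hd h0).
have h0' : 0 < `|h| by rewrite normr_gt0.
have h0'' : h%:C != 0 :> C by rewrite -rn_gt0 rn_real.
rewrite distrC lecP /dquot => Hh; rewrite -[h%:C *: l]/(h%:C * l).
by rewrite -(ler_pM2r h0') -{1}(rn_real h) -rnM mulrBl mulrAC mulVf // mul1r (mulrC l) in Hh.
Qed.

Section OneSpace.
Variable V : normedModType C.
Implicit Types (g f : V -> C) (v x : V) (l : C).

Lemma dD_rderivable g v x l : dD g v x l -> rderivable g v x.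
Proof. by move=> /dD_cvg H; apply/cvg_ex; exists l. Qed.

Lemma dD_rdiff g v x l : dD g v x l -> rdiff g v x = l.
Proof. by move=> /dD_cvg H; apply: cvg_lim. Qed.

Lemma rderivable_dD g v x : rderivable g v x -> dD g v x (rdiff g v x).
Proof. by move=> /cvg_ex [l /dD_cvg H]; rewrite (dD_rdiff H). Qed.

Lemma dD_near g f v x l : (\forall y \near x, g y = f y) -> dD g v x l -> dD f v x l.
Proof.
move=> /nearP [d d0 E]; apply: rD_ext.
have v1 : 0 < rn v + 1 by rewrite ltr_wpDl ?rn_ge0.
exists (d / (rn v + 1)); first by rewrite divr_gt0.
move=> h; rewrite ltr_pdivlMr // => hd; rewrite add0r; apply: E.
rewrite addrC addKr rnZ rn_real; have := normr_ge0 h; lra.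
Qed.

Lemma continuous_near g f x : (\forall y \near x, g y = f y) ->
  {for x, continuous g} -> {for x, continuous f}.
Proof.
move=> /nearP [d d0 E] /contP H; apply/contP => e /H [d1 d10 H1].
exists (Num.min d d1); first by rewrite lt_min d0.
move=> y; rewrite lt_min => /andP [h1 /H1]; rewrite -!E // ?subrr ?rn0 //.
Qed.

Lemma rD_shift (g : R -> C) s l :
  rD (fun h => g (s + h)) 0 l <-> rD g s l.
Proof. by split=> H e /H [d d0 Hd]; exists d => // h /Hd; rewrite add0r addr0. Qed.

Lemma dD_line g v x s l : dD g v (x + s%:C *: v) l -> rD (fun h : R => g (x + h%:C *: v)) s l.
Proof.
move=> H; apply/rD_shift; apply: rD_ext H; exists 1 => // h _.
by rewrite !add0r rmorphD scalerDl addrA.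
Qed.

(* Smoothness by coinduction: a class of continuous functions closed under
   directional derivatives consists of smooth functions. *)
Definition dclosed (U : set V) (A : (V -> C) -> Prop) := forall g, A g ->
  (forall x, U x -> {for x, continuous g}) /\
  (forall v, exists g', A g' /\ forall x, U x -> dD g v x (g' x)).

Lemma dclosed_smooth U A : open U -> dclosed U A -> forall g, A g -> smooth_on U g.
Proof.
move=> oU HA g Ag.
have near_U (f1 f2 : V -> C) x : (forall y, U y -> f1 y = f2 y) -> U x -> \forall y \near x, f1 y = f2 y.
  by move=> E Ux; have := open_nbhs_nbhs (conj oU Ux); apply: filterS => y /E.
have key s : exists2 h, A h & forall x, U x -> Defs.iterD g s x = h x.
  elim: s => [|v s [h Ah E]]; first by exists g.
  have [_ /(_ v) [h' [Ah' H]]] := HA h Ah; exists h' => // x Ux /=.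
  apply: dD_rdiff; apply: dD_near (H x Ux).
  by apply: near_U => // y /E.
move=> s v x Ux; have [h Ah E] := key s; have [ch dh] := HA h Ah; split.
  have [h' [_ H]] := dh v; apply: (dD_rderivable (l := h' x)).
  by apply: dD_near (H x Ux); apply: near_U => // y /E.
by apply: continuous_near (ch x Ux); apply: near_U => // y /E.
Qed.

(** Conjugation is among the operations because the derivative of a smooth function along a
    holomorphic curve involves the conjugate velocity. *)
Inductive alg (B : (V -> C) -> Prop) : (V -> C) -> Prop :=
| alg_base g : B g -> alg B g
| alg_cst c : alg B (fun=> c)
| alg_add g f : alg B g -> alg B f -> alg B (fun x => g x + f x)
| alg_mul g f : alg B g -> alg B f -> alg B (fun x => g x * f x)
| alg_conj g : alg B g -> alg B (fun x => (g x)^*%C).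

Lemma rD_conj (g : R -> C) s l : rD g s l -> rD (fun t => (g t)^*%C : C) s (l^*%C).
Proof.
move=> H e /H [d d0 Hd]; exists d => // h /Hd.
rewrite -[h%:C *: _]/(h%:C * _) -[h%:C *: _]/(h%:C * _).
suff -> : (g (s + h))^*%C - (g s)^*%C - h%:C * l^*%C = ((g (s + h) - g s - h%:C * l)^*)%C :> C by rewrite rnJ.
by rewrite !rmorphB rmorphM /= oppr0.
Qed.

(** Leibniz's rule reduces closure of the whole algebra to its generators, whose derivatives may lie
    anywhere in the algebra. *)
Lemma alg_dclosed (U : set V) B :
  (forall g, B g -> (forall x, U x -> {for x, continuous g}) /\
     (forall v, exists g', alg B g' /\ forall x, U x -> dD g v x (g' x))) ->
  dclosed U (alg B).
Proof.
move=> HB g; elim=> {g} [g /HB // | c | g f _ [cg dg] _ [cf df] | g f Ag [cg dg] Af [cf df] | g _ [cg dg]].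
- split=> [x _|v]; first exact: cst_continuous.
  by exists (fun=> 0); split; [exact: alg_cst | move=> x _; exact: rD_cst].
- split=> [x Ux|v]; first by apply: continuousD; [apply: cg | apply: cf].
  have [g' [Ag' Hg]] := dg v; have [f' [Af' Hf]] := df v.
  exists (fun x => g' x + f' x); split; first exact: alg_add.
  by move=> x Ux; apply: rD_add; [apply: Hg | apply: Hf].
- split=> [x Ux|v]; first by apply: continuousM; [apply: cg | apply: cf].
  have [g' [Ag' Hg]] := dg v; have [f' [Af' Hf]] := df v.
  exists (fun x => g' x * f x + g x * f' x); split.
    by apply: alg_add; apply: alg_mul.
  move=> x Ux; have := rD_mul (Hg x Ux) (Hf x Ux).
  by rewrite scale0r addr0.
- split=> [x Ux|v].
    have /contP H := cg x Ux; apply/contP => e /H [d d0 Hd]; exists d => // y /Hd.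
    by rewrite -rmorphB rnJ.
  have [g' [Ag' Hg]] := dg v; exists (fun x => (g' x)^*%C); split; first exact: alg_conj.
  by move=> x Ux; apply: rD_conj; apply: Hg.
Qed.

Lemma smooth_base U g : smooth_on U g -> (forall x, U x -> {for x, continuous g}) /\
  forall v, smooth_on U (rdiff g v) /\ forall x, U x -> dD g v x (rdiff g v x).
Proof.
move=> H; split=> [x /(H [::] 0 x) []//|v]; split.
  move=> s w x Ux.
  have E : Defs.iterD (rdiff g v) s = Defs.iterD g (s ++ [:: v]) by elim: s => [//|a s IH]; rewrite /= IH.
  by rewrite E; exact: H.
by move=> x Ux; have [h _] := H [::] v x Ux; exact: (rderivable_dD h).
Qed.

Lemma smooth_alg U B : open U -> (forall g, B g -> smooth_on U g) -> forall g, alg B g -> smooth_on U g.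
Proof.
move=> oU HB g Ag; apply: (dclosed_smooth oU (A := alg (smooth_on U))).
  apply: alg_dclosed => f /smooth_base [cf df]; split=> // v; have [h1 h2] := df v.
  by exists (rdiff f v); split => //; exact: alg_base.
elim: Ag => {g} [g /HB h|c|g f _ h1 _ h2|g f _ h1 _ h2|g _ h].
- exact: alg_base.
- exact: alg_cst.
- exact: alg_add.
- exact: alg_mul.
- exact: alg_conj.
Qed.

End OneSpace.
End Smooth.

(** * Smooth functions on C^n: real differential, chain rule, composition with curves *)

Section RowSmooth.
Variable R : realType.
Local Notation C := (Cplx R).

Lemma convex_lt (s u v m : R) : 0 <= s -> s <= 1 -> u < m -> v < m -> (1 - s) * u + s * v < m.
Proof.
move=> s0 s1 um vm; have [uv|/ltW vu] := leP u v.
  by have : 0 <= (1 - s) * (v - u) by [rewrite mulr_ge0 ?subr_ge0 |]; lra.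
by have : 0 <= s * (u - v) by [rewrite mulr_ge0 ?subr_ge0 |]; lra.
Qed.

Lemma rD_bigsum (W : normedModType C) (I : Type) (r : seq I) (g : I -> R -> W) (l : I -> W) x :
  (forall i, rD (g i) x (l i)) -> rD (fun s => \sum_(i <- r) g i s) x (\sum_(i <- r) l i).
Proof.
move=> H; elim: r => [|i r IH].
  by rewrite big_nil; apply: (rD_ext _ (rD_cst (0 : W) x)); exists 1 => // h _; rewrite big_nil.
by rewrite big_cons; apply: (rD_ext _ (rD_add (H i) IH)); exists 1 => // h _; rewrite big_cons.
Qed.

Lemma rD_Zl (W : normedModType C) (g : R -> C) (l : C) x (v : W) :
  rD g x l -> rD (fun s => g s *: v) x (l *: v).
Proof.
move=> H; apply: (rD_comp_fD (f := fun c : C => c *: v) (L := fun c : C => c *: v) (K := rn v) H).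
- move=> e e0; exists 1 => // h _.
  by rewrite scalerDl [_ + h *: v]addrC addrK subrr rn0 mulr_ge0 ?rn_ge0 // ltW.
- by move=> a b; rewrite scalerDl.
- by move=> k a; rewrite scalerA.
- by move=> a; rewrite rnZ mulrC.
Qed.

Lemma rD_arg (W : normedModType C) (G : R -> W) (c s : R) (l : W) :
  rD G (c * s) l -> rD (fun s => G (c * s)) s (c%:C *: l).
Proof.
move=> H e e0; have c1 : 0 < `|c| + 1 by rewrite ltr_wpDl.
have [d d0 Hd] := H _ (divr_gt0 e0 c1); exists (d / (`|c| + 1)); first by rewrite divr_gt0.
move=> h; rewrite ltr_pdivlMr // => hd.
have cd : `|c * h| < d by rewrite normrM; have := normr_ge0 h; nra.
have := Hd _ cd; rewrite -mulrDr scalerA -rmorphM [h * c]mulrC; move/le_trans; apply.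
rewrite mulrAC ler_pdivrMr // normrM -mulrA ler_pM2l // mulrC ler_wpM2l // lerDl //.
Qed.

Lemma cD_dD (f : C -> C) (v x l : C) : cD f x l -> dD f v x (v * l).
Proof.
have E : x + (0 : R)%:C *: v = x by rewrite scale0r addr0.
rewrite -{1}E => H; exact: (rD_comp_cD (P := fun h : R => x + h%:C *: v) (rD_line x v 0) H).
Qed.

Section General.
Variables (V : normedModType C) (I : Type) (dir : I -> V).

(** The coordinates are moved one at a time, each move costing one mean value estimate with a
    continuous partial derivative. The family of directions is arbitrary because it is used for C^n
    with [dir] and for C with 1 and i. *)
Lemma C1_approx (U : set V) (g : V -> C) x : open U -> smooth_on U g -> U x ->
  forall (r : seq I) (e : R), 0 < e -> exists2 eta : R, 0 < eta & forall c : I -> R,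
    (forall i, `|c i| < eta) ->
    rn (g (x + \sum_(i <- r) (c i)%:C *: dir i) - g x - \sum_(i <- r) (c i)%:C * rdiff g (dir i) x)
      <= e * \sum_(i <- r) `|c i|.
Proof.
move=> oU sg Ux; elim=> [|i r IH] e e0.
  by exists 1 => // c _; rewrite !big_nil addr0 subrr subr0 rn0 mulr0.
have [eta1 eta10 H1] := IH e e0.
have [cg dg] := smooth_base sg; have [sdg ddg] := dg (dir i).
have [cdg _] := smooth_base sdg.
have /contP /(_ e e0) [d d0 Hd] := cdg x Ux.
have /nearP [d1 d10 Hd1] := open_nbhs_nbhs (conj oU Ux).
pose S := \sum_(j <- i :: r) rn (dir j) + 1.
have S0 : 0 < S by rewrite ltr_wpDl // sumr_ge0 // => j _; rewrite rn_ge0.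
have m0 : 0 < Num.min d d1 by rewrite lt_min d0.
exists (Num.min eta1 (Num.min d d1 / S)); first by rewrite lt_min eta10 divr_gt0.
move=> c Hc.
have Hc1 j : `|c j| < eta1 by have := Hc j; rewrite lt_min => /andP [].
have Hc2 j : `|c j| < Num.min d d1 / S by have := Hc j; rewrite lt_min => /andP [].
have := H1 c Hc1; rewrite !big_cons; set y := \sum_(j <- r) _ *: _; set T := \sum_(j <- r) _ * _; set c0 := c i.
move=> hr.
have near_x s : 0 <= s <= 1 -> rn (x + y + (c0 * s)%:C *: dir i - x) < Num.min d d1.
  move=> /andP [s0 s1]; rewrite -[x + y + _]addrA [x + (y + _)]addrC addrK.
  apply: (@le_lt_trans _ _ (Num.min d d1 / S * \sum_(j <- i :: r) rn (dir j))); last first.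
    rewrite mulrAC ltr_pdivrMr // ltr_pM2l // /S ltrDl //.
  rewrite big_cons mulrDr addrC; apply: le_trans (rnD _ _) _; apply: lerD.
    rewrite rnZ rn_real normrM ler_wpM2r ?rn_ge0 //.
    by apply: le_trans (ltW (Hc2 i)); rewrite (ger0_norm s0) ler_piMr.
  apply: le_trans (rn_sum _ _ _) _; rewrite mulr_sumr; apply: ler_sum => j _.
  by rewrite rnZ rn_real ler_wpM2r ?rn_ge0 // ltW.
pose D0 := rdiff g (dir i) x.
have := MVT_rn (g := fun s => g (x + y + (c0 * s)%:C *: dir i) - c0%:C * D0 * s%:C)
  (g' := fun s => c0%:C * (rdiff g (dir i) (x + y + (c0 * s)%:C *: dir i) - D0))
  (M := `|c0| * e) (a := 0) (b := 1) ler01.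
have h1 s : 0 <= s <= 1 -> U (x + y + (c0 * s)%:C *: dir i).
  by move=> /near_x; rewrite lt_min => /andP [_ /Hd1].
have h2 s : 0 <= s <= 1 -> rD (fun s => g (x + y + (c0 * s)%:C *: dir i) - c0%:C * D0 * s%:C) s
    (c0%:C * (rdiff g (dir i) (x + y + (c0 * s)%:C *: dir i) - D0)).
  move=> hs; rewrite mulrBr.
  have := rD_arg (dD_line (ddg _ (h1 s hs))) => k1.
  have := rD_opp (rD_mulC (c0%:C * D0) (rD_id s)); rewrite mulr1 => k2.
  exact: rD_add k1 k2.
have h3 s : 0 <= s <= 1 -> rn (c0%:C * (rdiff g (dir i) (x + y + (c0 * s)%:C *: dir i) - D0)) <= `|c0| * e.
  move=> /near_x; rewrite lt_min => /andP [/Hd h _].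
  by rewrite rnM rn_real ler_wpM2l // ltW.
move=> /(_ h2 h3); rewrite mulr0 rmorph0 scale0r addr0 mulr0 subr0 mulr1 rmorph1 mulr1 subr0 mulr1 => h4.
have -> : g (x + (c0%:C *: dir i + y)) - g x - (c0%:C * D0 + T) =
  (g (x + y + c0%:C *: dir i) - c0%:C * D0 - g (x + y)) + (g (x + y) - g x - T).
  have -> : x + (c0%:C *: dir i + y) = x + y + c0%:C *: dir i by rewrite [c0%:C *: _ + y]addrC addrA.
  by ring.
by apply: le_trans (rnD _ _) _; rewrite mulrDr [e * `|c0|]mulrC lerD.
Qed.
End General.

Section Row.
Variable n : nat.
Local Notation V := 'rV[C]_n.

Lemma rV_ball (h : V) (e : R) : 0 < e -> (rn h < e) <-> (forall j, rn (h 0 j) < e).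
Proof.
move=> e0; have e0' : (0 : C) < e%:C by rewrite ltcR.
have E : ball (0 : V) e%:C h = ball_ (fun x => `|x|) (0 : V) e%:C h by rewrite mx_norm_ball.
split=> [he j|H].
  have : ball (0 : V) e%:C h by rewrite E /= sub0r normrN ltcP.
  by move=> [_ /(_ 0 j)]; rewrite mxE /ball /= sub0r normrN ltcP.
have : ball (0 : V) e%:C h.
  by split=> // i j; rewrite mxE /ball /= sub0r normrN ltcP ord1.
by rewrite E /= sub0r normrN ltcP.
Qed.

Lemma rn_coord (h : V) j : rn (h 0 j) <= rn h.
Proof.
apply/ler_addgt0Pr => e e0; apply: ltW.
by have /rV_ball : rn h < rn h + e by [rewrite ltrDl]; apply; rewrite ltr_wpDl ?rn_ge0.
Qed.

Lemma rn_row_le (h : V) (e : R) : 0 <= e -> (forall j, rn (h 0 j) <= e) -> rn h <= e.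
Proof.
move=> e0 H; apply/ler_addgt0Pr => d d0; apply: ltW; apply/rV_ball; first by rewrite ltr_wpDl.
by move=> j; have := H j; lra.
Qed.

(* The 2n real coordinate directions of C^n; [cf] gives the coordinates. *)
Definition dir (i : 'I_n * bool) : V := if i.2 then 'i%C *: delta_mx 0 i.1 else delta_mx 0 i.1.
Definition cf (h : V) (i : 'I_n * bool) : R :=
  if i.2 then complex.Im (h 0 i.1) else complex.Re (h 0 i.1).

Lemma sum_Ib (A : nmodType) (F : 'I_n * bool -> A) :
  \sum_(i : 'I_n * bool) F i = \sum_j (F (j, false) + F (j, true)).
Proof.
rewrite (eq_bigr (fun p => F (p.1, p.2))); last by case.
rewrite -(pair_bigA _ (fun j b => F (j, b))) /=.
by apply: eq_bigr => j _; rewrite big_bool addrC.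
Qed.

Lemma dir_sum (h : V) : h = \sum_i (cf h i)%:C *: dir i.
Proof.
rewrite sum_Ib [LHS]row_sum_delta; apply: eq_bigr => j _.
by rewrite /cf /dir /= scalerA -scalerDl {1}[h 0 j]complexE mulrC.
Qed.

Lemma cf_le h i : `|cf h i| <= rn h.
Proof.
by apply: le_trans (rn_coord h i.1); rewrite /cf; case: ifP => _; [exact: Im_le | exact: Re_le].
Qed.

Definition wirtb (j : 'I_n) (g : V -> C) : V -> C :=
  fun x => 2^-1 * (rdiff g (delta_mx 0 j) x + 'i%C * rdiff g ('i%C *: delta_mx 0 j) x).

Definition dL (g : V -> C) (x h : V) : C := \sum_i (cf h i)%:C * rdiff g (dir i) x.

Lemma dL_wirt g x h : dL g x h = \sum_j (h 0 j * wirt j g x + (h 0 j)^*%C * wirtb j g x).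
Proof.
rewrite /dL sum_Ib; apply: eq_bigr => j _; rewrite /cf /dir /wirt /wirtb /=.
set A := rdiff g (delta_mx 0 j) x; rewrite -complexiE; set B := rdiff g ('i%C *: _) x.
have ii : 'i%C * 'i%C = -1 :> C by rewrite -expr2 sqr_i.
have E1 : h 0 j = (complex.Re (h 0 j))%:C + 'i%C * (complex.Im (h 0 j))%:C :> C by exact: complexE.
have E2 : (h 0 j)^*%C = (complex.Re (h 0 j))%:C - 'i%C * (complex.Im (h 0 j))%:C :> C.
  case: (h 0 j) => u v; apply/eqP; rewrite eq_complex /=.
  by rewrite !(mul0r, mulr0, mul1r, subr0, sub0r, add0r, addr0, oppr0) !eqxx.
rewrite E2; set a := (complex.Re _)%:C in E1 *; set b := (complex.Im _)%:C in E1 *.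
rewrite E1.
have -> : (a + 'i%C * b) * (2^-1 * (A - 'i%C * B)) + (a - 'i%C * b) * (2^-1 * (A + 'i%C * B)) =
  a * A - ('i%C * 'i%C) * b * B by field.
by rewrite ii; ring.
Qed.

Lemma dL_le g x h : rn (dL g x h) <= (\sum_i rn (rdiff g (dir i) x)) * rn h.
Proof.
apply: le_trans (rn_sum _ _ _) _; rewrite mulr_suml; apply: ler_sum => i _.
by rewrite rnM rn_real mulrC ler_wpM2l ?rn_ge0 // cf_le.
Qed.

Lemma cfD u v i : cf (u + v) i = cf u i + cf v i.
Proof. by rewrite /cf mxE; case: ifP => _; rewrite ?cReD ?cImD. Qed.
Lemma cfZ (k : R) v i : cf (k%:C *: v) i = k * cf v i.
Proof. by rewrite /cf mxE; case: ifP => _; rewrite ?cReZ ?cImZ. Qed.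

Lemma dLD g x u v : dL g x (u + v) = dL g x u + dL g x v.
Proof. by rewrite /dL -big_split; apply: eq_bigr => i _; rewrite cfD rmorphD mulrDl. Qed.
Lemma dLZ g x (k : R) v : dL g x (k%:C *: v) = k%:C *: dL g x v.
Proof. by rewrite /dL -[RHS]/(_ * _) mulr_sumr; apply: eq_bigr => i _; rewrite cfZ rmorphM mulrA. Qed.

Lemma smooth_fD (U : set V) (g : V -> C) x : open U -> smooth_on U g -> U x -> fD g x (dL g x).
Proof.
move=> oU sg Ux e e0; pose m : R := #|{: 'I_n * bool}|%:R.
have m1 : 0 < m + 1 by rewrite ltr_wpDl.
have [eta eta0 H] := C1_approx dir oU sg Ux (index_enum _) (divr_gt0 e0 m1).
exists eta => // h hh; have hc i : `|cf h i| < eta by apply: le_lt_trans (cf_le h i) hh.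
have := H _ hc; rewrite -dir_sum => /le_trans; apply.
rewrite mulrAC ler_pdivrMr // -mulrA ler_pM2l //.
apply: (@le_trans _ _ (rn h * m)); last by rewrite ler_wpM2l ?rn_ge0 // lerDl.
apply: (@le_trans _ _ (\sum_(i : 'I_n * bool) rn h)); first by apply: ler_sum => i _; exact: cf_le.
by rewrite sumr_const -mulr_natr.
Qed.

Lemma smooth_comp_rD (U : set V) (g : V -> C) (P : R -> V) s p : open U -> smooth_on U g ->
  U (P s) -> rD P s p -> rD (fun t => g (P t)) s (dL g (P s) p).
Proof.
move=> oU sg Us HP; apply: (rD_comp_fD HP (smooth_fD oU sg Us)).
- exact: dLD.
- exact: dLZ.
- exact: dL_le.
Qed.

Lemma smooth_lip (U : set V) (g : V -> C) a : open U -> smooth_on U g -> U a -> exists L d : R,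
  [/\ 0 <= L, 0 < d & forall x y, rn (x - a) < d -> rn (y - a) < d -> rn (g x - g y) <= L * rn (x - y)].
Proof.
move=> oU sg Ua.
have [d1 d10 Hd1] : exists2 d1 : R, 0 < d1 & forall y, rn (y - a) < d1 -> U y.
  by apply/nearP; exact: open_nbhs_nbhs.
have : forall r : seq ('I_n * bool), exists2 d : R, 0 < d & forall y, rn (y - a) < d ->
   \sum_(i <- r) rn (rdiff g (dir i) y) <= \sum_(i <- r) (rn (rdiff g (dir i) a) + 1).
  elim=> [|i r [d d0 IH]]; first by exists 1 => // y _; rewrite !big_nil.
  have [_ /(_ (dir i)) [sdg _]] := smooth_base sg; have [cdg _] := smooth_base sdg.
  have /contP /(_ 1 ltr01) [d2 d20 Hd2] := cdg a Ua.
  exists (Num.min d d2); first by rewrite lt_min d0.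
  move=> y; rewrite lt_min => /andP [/IH h1 /Hd2 h2]; rewrite !big_cons lerD //.
  by apply: le_trans (rn_le _ (rdiff g (dir i) a)) _; lra.
move=> /(_ (index_enum _)) [d2 d20 Hd2].
exists (\sum_i (rn (rdiff g (dir i) a) + 1)), (Num.min d1 d2); split.
- by apply: sumr_ge0 => i _; rewrite addr_ge0 ?rn_ge0.
- by rewrite lt_min d10.
move=> x y hx hy.
have seg s : 0 <= s <= 1 -> rn (y + s%:C *: (x - y) - a) < Num.min d1 d2.
  move=> /andP [s0 s1].
  have -> : y + s%:C *: (x - y) - a = (1 - s)%:C *: (y - a) + s%:C *: (x - a).
    rewrite rmorphB rmorph1 scalerBl scale1r !scalerBr addrAC -[RHS]addrA; congr (_ + _).
    by rewrite opprB [RHS]addrC [RHS]addrA subrK.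
  apply: le_lt_trans (rnD _ _) _; rewrite !rnZ !rn_real !ger0_norm ?subr_ge0 //.
  exact: convex_lt.
have := MVT_rn (g := fun s => g (y + s%:C *: (x - y))) (g' := fun s => dL g (y + s%:C *: (x - y)) (x - y))
  (M := (\sum_i (rn (rdiff g (dir i) a) + 1)) * rn (x - y)) (a := 0) (b := 1) ler01.
rewrite rmorph1 scale1r [y + (x - y)]addrC subrK rmorph0 scale0r addr0 subr0 mulr1; apply.
  move=> s /seg; rewrite lt_min => /andP [/Hd1 h1 _].
  by apply: (smooth_comp_rD oU sg) => //; exact: rD_line.
move=> s /seg; rewrite lt_min => /andP [_ /Hd2 h2].
by apply: le_trans (dL_le _ _ _) _; rewrite ler_wpM2r ?rn_ge0.
Qed.

Lemma rD_row (P : R -> V) s (p : V) : (forall j, rD (fun t => P t 0 j) s (p 0 j)) -> rD P s p.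
Proof.
move=> H; rewrite [p]row_sum_delta.
apply: (@rD_ext _ _ (fun t => \sum_j P t 0 j *: delta_mx 0 j)).
  by exists 1 => // h _; rewrite -row_sum_delta.
by apply: rD_bigsum => j; apply: rD_Zl.
Qed.

(** A derivative of g o ga is a sum of products of derivatives of g taken along ga, of derivatives
    of ga and of their conjugates. Hence the algebra generated by such compositions and by
    holomorphic functions is closed under differentiation. *)
Lemma smooth_comp_curve (U : set V) (g : V -> C) (ga : C -> V) (r : R) : open U -> smooth_on U g ->
  (forall j, hol r (fun t => ga t 0 j)) -> (forall t, rn t < r -> U (ga t)) ->
  smooth_on [set t : C | rn t < r] (fun t => g (ga t)).
Proof.
move=> oU sg Hga HU; set W := [set t : C | rn t < r].
have oW : open W.
  rewrite openE => t /= tr; suff : \forall u \near (t : C), W u by [].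
  apply/nearP; exists (r - rn t); first by rewrite subr_gt0.
  by move=> u hu; rewrite /W /=; apply: le_lt_trans (rn_le u t) _; lra.
pose B (f : C -> C) := (exists2 g, smooth_on U g & f = fun t => g (ga t)) \/ hol r f.
apply: (dclosed_smooth oW (A := alg B)); last by apply: alg_base; left; exists g.
apply: alg_dclosed => f [[{sg}g sg ->]|Hf]; last first.
  split=> [x xr|v]; first by apply: differentiable_continuous; apply: Hf.
  exists (fun t => v * derive1 f t); split.
    by apply: alg_mul; [exact: alg_cst | apply: alg_base; right; exact: hol_derive1].
  by move=> x xr; apply: cD_dD; exact: differentiable_derive1 (Hf x xr).
have [cg dg] := smooth_base sg.
have Dga v t : rn t < r -> rD (fun h : R => ga (t + h%:C *: v)) 0 (\row_j (v * derive1 (fun t => ga t 0 j) t)).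
  move=> tr; apply: rD_row => j; rewrite mxE.
  exact: cD_dD (differentiable_derive1 (Hga j t tr)).
have Dg v t : rn t < r -> rD (fun h : R => g (ga (t + h%:C *: v))) 0
    (dL g (ga t) (\row_j (v * derive1 (fun t => ga t 0 j) t))).
  move=> tr; have E : t = t + (0 : R)%:C *: v by rewrite scale0r addr0.
  have := @smooth_comp_rD U g (fun h => ga (t + h%:C *: v)) 0 _ oU sg _ (Dga v t tr).
  by rewrite -E; apply; apply: HU.
split=> [t tr|v].
  apply/contP => e e0; have /contP /(_ e e0) [d d0 Hd] := cg _ (HU t tr).
  have cj j : exists2 d1 : R, 0 < d1 & forall u, rn (u - t) < d1 -> rn (ga u 0 j - ga t 0 j) < d.
    exact: differentiable_bound (Hga j t tr) _ d0.
  have : forall s : seq 'I_n, exists2 d1 : R, 0 < d1 & forall u, rn (u - t) < d1 ->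
     forall j, j \in s -> rn (ga u 0 j - ga t 0 j) < d.
    elim=> [|j s [d1 d10 IH]]; first by exists 1.
    have [d2 d20 Hd2] := cj j; exists (Num.min d1 d2); first by rewrite lt_min d10.
    move=> u; rewrite lt_min => /andP [h1 h2] k; rewrite in_cons => /orP [/eqP ->|]; first exact: Hd2.
    exact: IH.
  move=> /(_ (enum 'I_n)) [d1 d10 Hd1]; exists d1 => // u /Hd1 hu; apply: Hd.
  apply/rV_ball => // j; rewrite !mxE; apply: hu; rewrite mem_enum //.
exists (fun t => dL g (ga t) (\row_j (v * derive1 (fun t => ga t 0 j) t))); split; last exact: Dg.
pose F j t := v * derive1 (fun t => ga t 0 j) t.
have AF j : alg B (F j).
  by apply: alg_mul; [exact: alg_cst | apply: alg_base; right; exact: hol_derive1].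
have Asum (I : Type) (s : seq I) (G : I -> C -> C) : (forall i, alg B (G i)) ->
    alg B (fun t => \sum_(i <- s) G i t).
  move=> AG; elim: s => [|i s IH].
    by have -> : (fun t => \sum_(i <- [::]) G i t) = (fun=> 0) by [apply: funext => t; rewrite big_nil]; exact: alg_cst.
  have -> : (fun t => \sum_(i <- i :: s) G i t) = (fun t => G i t + \sum_(i <- s) G i t).
    by apply: funext => t; rewrite big_cons.
  exact: alg_add.
have Ar v' : alg B (fun t => rdiff g v' (ga t)).
  have [h _] := dg v'; apply: alg_base; left; exact: (ex_intro2 _ _ (rdiff g v') h erefl).
(* The Wirtinger form of the differential involves the velocity and its conjugate, both in the
   algebra, in place of real and imaginary parts. *)
have -> : (fun t => dL g (ga t) (\row_j (v * derive1 (fun t => ga t 0 j) t))) =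
  (fun t => \sum_j (F j t * (2^-1 * (rdiff g (delta_mx 0 j) (ga t) + (- 'i%C) * rdiff g ('i%C *: delta_mx 0 j) (ga t))) +
     (F j t)^*%C * (2^-1 * (rdiff g (delta_mx 0 j) (ga t) + 'i%C * rdiff g ('i%C *: delta_mx 0 j) (ga t))))).
  apply: funext => t; rewrite dL_wirt; apply: eq_bigr => j _.
  by rewrite !mxE /wirt /wirtb -complexiE mulNr.
apply: Asum => j; do ?[exact: AF | exact: Ar | exact: alg_cst | apply: alg_add | apply: alg_mul | apply: alg_conj].
Qed.

End Row.
End RowSmooth.

(** * Flatness and orders of vanishing of smooth functions *)

Section Flat.
Variable R : realType.
Local Notation C := (Cplx R).

(* Finite-difference weights extracting a first derivative: they turn the bound
   [O(|x|^{N+1})] on a smooth function into [O(|x|^N)] on its derivatives. *)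
Lemma fd_weights m : exists c : 'I_m -> C, forall k, (k < m)%N ->
  \sum_j c j * (j : nat)%:R ^+ k = (k == 1%N)%:R.
Proof.
pose a : 'rV[C]_m := \row_j (j : nat)%:R; pose W := Vandermonde m a.
have Wu : W \in unitmx.
  rewrite unitmxE unitfE det_Vandermonde; apply/prodf_neq0 => i _; apply/prodf_neq0 => j ij.
  by rewrite !mxE subr_eq0 eqr_nat eq_sym ltn_eqF.
pose b : 'cV[C]_m := \col_k ((k : nat) == 1%N)%:R.
exists (fun j => (invmx W *m b) j 0) => k km.
have := congr1 (fun A : 'cV_m => A (Ordinal km) 0) (mulKVmx Wu b); rewrite !mxE /= => <-.
by apply: eq_bigr => j _; rewrite !mxE mulrC.
Qed.

(** [phi k] stands for the k-th derivative along a line. Repeated use of the mean value inequality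
    gives the remainder without the factorial, which is enough for orders of vanishing. *)
Lemma taylor_line m (phi : nat -> R -> C) (S M : R) :
  (forall k, (k < m)%N -> forall s, 0 <= s <= S -> rD (phi k) s (phi k.+1 s)) ->
  (forall s, 0 <= s <= S -> rn (phi m s) <= M) ->
  forall s, 0 <= s <= S -> rn (phi 0%N s - \sum_(k < m) (k`!)%:R^-1 * s%:C ^+ k * phi k 0) <= M * s ^+ m.
Proof.
elim: m phi => [|m IH] phi Hd HM s hs; first by rewrite big_ord0 subr0 expr0 mulr1 HM.
have IH' := IH (fun k => phi k.+1) (fun k km => Hd k.+1 km) HM.
have [s0 sS] := andP hs.
have M0 : 0 <= M by apply: le_trans (HM 0 _); rewrite ?rn_ge0 // lexx (le_trans s0).
pose psi (u : R) : C := phi 0%N u - \sum_(k < m.+1) (k`!)%:R^-1 * u%:C ^+ k * phi k 0.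
pose psi' (u : R) : C := phi 1%N u - \sum_(k < m) (k`!)%:R^-1 * u%:C ^+ k * phi k.+1 0.
have D u : 0 <= u <= s -> rD psi u (psi' u).
  move=> /andP [u0 us]; apply: rD_add; first by apply: Hd; rewrite // u0 (le_trans us).
  apply: rD_opp.
  have := @rD_sum R m.+1 (fun k u => ((k`!)%:R^-1 * phi k 0) * u%:C ^+ k)
     (fun k u => ((k`!)%:R^-1 * phi k 0) * (k%:R * u%:C ^+ k.-1 * 1)) u _.
  move=> /(_ (fun k => rD_mulC _ (rD_expr k (rD_id u)))) H.
  have -> : \sum_(k < m) (k`!)%:R^-1 * u%:C ^+ k * phi k.+1 0 =
     \sum_(k < m.+1) (k`!)%:R^-1 * phi k 0 * (k%:R * u%:C ^+ k.-1 * 1).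
    rewrite big_ord_recl /= mul0r mul0r mulr0 add0r; apply: eq_bigr => k _.
    rewrite /bump /= add1n add0n factS natrM.
    have k0 : k.+1%:R != 0 :> C by rewrite pnatr_eq0.
    move: (k.+1%:R : C) k0 (k`!%:R : C) (u%:C ^+ k) (phi k.+1 0) => p p0 q X Y.
    by rewrite invfM; transitivity (p^-1 * p * (q^-1 * X * Y)); [rewrite mulVf // mul1r | ring].
  by apply: rD_ext H; exists 1 => // h _; apply: eq_bigr => k _; rewrite mulrAC.
have B u : 0 <= u <= s -> rn (psi' u) <= M * s ^+ m.
  move=> /andP [u0 us]; apply: le_trans (IH' u _) _; first by rewrite u0 (le_trans us).
  by rewrite ler_wpM2l // lerXn2r ?nnegrE.
have p0 : psi 0 = 0.
  rewrite /psi big_ord_recl /= fact0 expr0 invr1 !mul1r big1 ?addr0 ?subrr // => k _.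
  by rewrite /bump /= add1n rmorph0 exprS !mul0r mulr0 mul0r.
have := MVT_rn s0 D B; rewrite p0 !subr0 => h; rewrite -/(psi s); apply: le_trans h _.
by apply: eqW; rewrite exprSr mulrA.
Qed.

Section Decay.
Variable V : normedModType C.

Lemma iterD_rcons (g : V -> C) s v : Defs.iterD (rdiff g v) s = Defs.iterD g (rcons s v).
Proof. by elim: s => [//|a s IH]; rewrite /= IH. Qed.

Lemma smooth_iterD (U : set V) g s : smooth_on U g -> smooth_on U (Defs.iterD g s).
Proof.
elim: s => [//|v s IH] /IH h /=; have [_ /(_ v) [h1 _]] := smooth_base h.
exact: h1.
Qed.

(** g is sampled at the N + 2 points x + j h v with |x| <= h. The weights cancel all Taylor terms
    except h times the derivative; what remains is O(h^(N+1)), from the hypothesis and from the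
    Taylor remainder, and is divided by h. *)
Lemma smooth_decay (U : set V) (g : V -> C) N v : open U -> U 0 -> smooth_on U g ->
  bigo N.+1 g -> bigo N (rdiff g v).
Proof.
move=> oU U0 sg [K [d1 [K0 d10 HK]]].
have [d2 d20 Hd2] : exists2 d : R, 0 < d & forall y, rn y < d -> U y.
  have /nearP [d d0 H] := open_nbhs_nbhs (conj oU U0); exists d => // y yd.
  by apply: H; rewrite subr0.
have [cm _] := smooth_base (smooth_iterD (nseq N.+2 v) sg).
have /contP /(_ 1 ltr01) [d3 d30 Hd3] := cm 0 U0.
set g2 := Defs.iterD g (nseq N.+2 v) in Hd3.
pose M := rn (g2 0) + 1; have M0 : 0 <= M by rewrite addr_ge0 ?rn_ge0.
have HM y : rn y < d3 -> rn (g2 y) <= M.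
  move=> yd; have := Hd3 y; rewrite subr0 => /(_ yd) h.
  by apply: le_trans (rn_le _ (g2 0)) _; rewrite /M; lra.
have [c Hc] := fd_weights N.+2.
pose A := 1 + N.+1%:R * rn v; have A1 : 1 <= A by rewrite lerDl mulr_ge0 ?rn_ge0.
pose Cs := \sum_j rn (c j).
have Cs0 : 0 <= Cs by apply: sumr_ge0 => j _; rewrite rn_ge0.
pose B := Cs * (K * A ^+ N.+1 + M * N.+1%:R ^+ N.+2).
have B0 : 0 <= B.
  by rewrite mulr_ge0 // addr_ge0 // mulr_ge0 // exprn_ge0 //; apply: le_trans A1.
pose d := Num.min (Num.min d1 d2) d3; have d0 : 0 < d by rewrite !lt_min d10 d20.
have A0 : 0 < A by apply: lt_le_trans A1.
pose eta := Num.min 1 (d / A); have eta0 : 0 < eta by rewrite lt_min ltr01 divr_gt0.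
have key x h : rn x <= h -> 0 < h -> h < eta -> rn (rdiff g v x) <= B * h ^+ N.
  move=> xh h0; rewrite lt_min => /andP [h1]; rewrite ltr_pdivlMr // => hd.
  have small (s : R) : 0 <= s <= N.+1%:R * h -> rn (x + s%:C *: v) <= h * A.
    move=> /andP [s0 sh]; apply: le_trans (rnD _ _) _; rewrite rnZ rn_real ger0_norm //.
    rewrite /A mulrDr mulr1; apply: lerD => //.
    apply: le_trans (ler_wpM2r (rn_ge0 v) sh) _; apply: eqW; ring.
  have smallP (s : R) : 0 <= s <= N.+1%:R * h ->
      [/\ rn (x + s%:C *: v) < d1, U (x + s%:C *: v) & rn (x + s%:C *: v) < d3].
    move=> /small hs; have := le_lt_trans hs hd; rewrite !lt_min => /andP [/andP [a1 a2] a3].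
    by split=> //; exact: Hd2.
  pose phi k (s : R) := Defs.iterD g (nseq k v) (x + s%:C *: v).
  have Dphi k s : 0 <= s <= N.+1%:R * h -> rD (phi k) s (phi k.+1 s).
    move=> /smallP [_ Us _]; apply: dD_line.
    by have [_ /(_ v) [_ H]] := smooth_base (smooth_iterD (nseq k v) sg); apply: H.
  have T := @taylor_line N.+2 phi (N.+1%:R * h) M (fun k _ s hs => Dphi k s hs).
  have {}T s : 0 <= s <= N.+1%:R * h ->
      rn (phi 0%N s - \sum_(k < N.+2) (k`!)%:R^-1 * s%:C ^+ k * phi k 0) <= M * s ^+ N.+2.
    by apply: T => u /smallP [_ _ hu]; exact: HM.
  have jh (j : 'I_N.+2) : 0 <= (j : nat)%:R * h <= N.+1%:R * h.
    by rewrite mulr_ge0 ?(ltW h0) //= ler_pM2r // ler_nat -ltnS ltn_ord.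
  pose E (j : 'I_N.+2) := phi 0%N ((j : nat)%:R * h) -
     \sum_(k < N.+2) (k`!)%:R^-1 * ((j : nat)%:R * h)%:C ^+ k * phi k 0.
  have HE j : rn (E j) <= M * N.+1%:R ^+ N.+2 * h ^+ N.+1.
    apply: le_trans (T _ (jh j)) _; rewrite -mulrA ler_wpM2l //.
    have /andP [j0 j1] := jh j.
    apply: (@le_trans _ _ ((N.+1%:R * h) ^+ N.+2)).
      by rewrite lerXn2r ?nnegrE // mulr_ge0 // ltW.
    by rewrite exprMn ler_wpM2l ?exprn_ge0 // exprS ler_piMl ?exprn_ge0 // ltW.
  have Hphi (j : 'I_N.+2) : rn (phi 0%N ((j : nat)%:R * h)) <= K * A ^+ N.+1 * h ^+ N.+1.
    have [a1 _ _] := smallP _ (jh j); apply: le_trans (HK _ a1) _.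
    rewrite -mulrA ler_wpM2l // -exprMn lerXn2r ?nnegrE ?rn_ge0 //.
      by rewrite mulr_ge0 // ltW.
    by rewrite [A * h]mulrC; apply: small.
  have Eq : h%:C * phi 1%N 0 = \sum_j c j * (phi 0%N ((j : nat)%:R * h) - E j).
    transitivity (\sum_(k < N.+2) (k`!)%:R^-1 * h%:C ^+ k * phi k 0 * (\sum_j c j * (j : nat)%:R ^+ k)).
      rewrite big_ord_recl (Hc 0%N) // mulr0 add0r big_ord_recl (Hc 1%N) //= mulr1.
      rewrite big1 ?addr0; last by move=> k _; rewrite (Hc k.+2) ?mulr0 // !ltnS.
      have -> : bump 0 0 = 1%N by [].
      by rewrite (_ : 1`! = 1%N) // invr1 mul1r expr1.
    under eq_bigr => k _ do rewrite mulr_sumr.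
    rewrite exchange_big; apply: eq_bigr => j _ /=.
    rewrite /E opprB addrC subrK mulr_sumr; apply: eq_bigr => k _.
    by rewrite rmorphM rmorph_nat exprMn; ring.
  have x0 : phi 1%N 0 = rdiff g v x by rewrite /phi /= scale0r addr0.
  rewrite x0 in Eq; rewrite -(ler_pM2l h0).
  have -> : h * rn (rdiff g v x) = rn (h%:C * rdiff g v x) by rewrite rnM rn_real gtr0_norm.
  rewrite Eq; apply: le_trans (rn_sum _ _ _) _.
  apply: (@le_trans _ _ (\sum_j rn (c j) * ((K * A ^+ N.+1 + M * N.+1%:R ^+ N.+2) * h ^+ N.+1))).
    apply: ler_sum => j _; rewrite rnM ler_wpM2l ?rn_ge0 // mulrDl.
    by apply: le_trans (rnB _ _) _; rewrite lerD.
  rewrite -mulr_suml -/Cs [X in _ <= X](_ : _ = B * h ^+ N.+1); last by rewrite exprS mulrCA.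
  by rewrite /B mulrA.
exists B, (eta / 2); split => //; first by rewrite divr_gt0.
(* For x nonzero the step is h = |x|. At x = 0 the step is free: it tends to 0 if N > 0, and any
   admissible one will do if N = 0. *)
move=> x xe; have [x0|x0] := eqVneq x 0; last first.
  by apply: key => //; rewrite ?rn_gt0 //; lra.
have he : 0 < eta / 2 < eta by lra.
have [he1 he2] := andP he.
rewrite x0 rn0; have [N0|N0] := posnP N.
  by have := key 0 _ _ he1 he2; rewrite N0 rn0 expr0; apply; exact: ltW.
rewrite expr0n gtn_eqF // mulr0; apply/ler_addgt0Pr => e e0; rewrite add0r.
have B1 : 0 < B + 1 by lra.
pose h := Num.min (eta / 2) (e / (B + 1)).
have h0 : 0 < h by rewrite lt_min he1 divr_gt0.
have := lexx h; rewrite {2}/h le_min => /andP [h1 h2].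
have heta : h < eta by apply: le_lt_trans h1 he2.
have hl1 : h <= 1 by apply: ltW; apply: lt_le_trans heta _; rewrite ge_min lexx.
apply: le_trans (key 0 h _ h0 heta) _; first by rewrite rn0 ltW.
apply: (@le_trans _ _ ((B + 1) * h)); last by rewrite mulrC -ler_pdivlMr.
apply: ler_pM; rewrite ?exprn_ge0 ?(ltW h0) //; first by rewrite lerDl.
by rewrite -[X in _ <= X]expr1 ler_wiXn2l // ltW.
Qed.

Lemma bigo_at0 (f : V -> C) N : bigo N.+1 f -> f 0 = 0.
Proof.
move=> [K [d [K0 d0 H]]]; have := H 0; rewrite rn0 => /(_ d0).
by rewrite expr0n mulr0 => h; apply/eqP; rewrite -rn_eq0 eq_le h rn_ge0.
Qed.

Lemma bigo_flat (U : set V) (g : V -> C) N s : open U -> U 0 -> smooth_on U g -> bigo N.+1 g ->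
  (size s <= N)%N -> Defs.iterD g s 0 = 0.
Proof.
move=> oU U0 sg gN sN; apply: (@bigo_at0 _ (N - size s)).
elim: s sN => [|v s IH] sN; first by rewrite subn0.
have /= := IH (ltnW sN); rewrite subnS prednK ?subn_gt0 // => h.
exact: (smooth_decay v oU U0 (smooth_iterD s sg)).
Qed.
End Decay.

Lemma C_rdiff (U : set C) (g : C -> C) x : open U -> smooth_on U g -> U x ->
  forall t, dD g t x ((complex.Re t)%:C * rdiff g 1 x + (complex.Im t)%:C * rdiff g 'i%C x).
Proof.
move=> oU sg Ux t.
pose dr (b : bool) : C := if b then 'i%C else 1.
pose c (b : bool) : R := if b then complex.Im t else complex.Re t.
have St (h : R) : h%:C *: t = \sum_(b <- [:: false; true]) (h * c b)%:C *: dr b.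
  rewrite big_cons big_seq1 /dr /c -!/(_ * _).
  rewrite {1}[t]complexE -[_ *: _]/(_ * _) -[(h * complex.Re t)%:C *: _]/(_ * _) -[(h * complex.Im t)%:C *: _]/(_ * _).
  by rewrite !rmorphM; ring.
move=> e e0; pose m : R := `|c false| + `|c true|; have m1 : 0 < m + 1 by rewrite ltr_wpDl // addr_ge0.
have [eta eta0 H] := C1_approx dr oU sg Ux [:: false; true] (divr_gt0 e0 m1).
exists (eta / (m + 1)); first by rewrite divr_gt0.
move=> h; rewrite ltr_pdivlMr // => hh.
have hc b : `|h * c b| < eta.
  rewrite normrM; apply: le_lt_trans hh; rewrite ler_wpM2l //.
  by rewrite /m; case: b; have := normr_ge0 (c true); have := normr_ge0 (c false); lra.
have := H (fun b => h * c b) hc; rewrite -St add0r scale0r addr0.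
rewrite !big_cons !big_nil !addr0 /dr /c /= !normrM -mulrDr.
have -> : h%:C *: ((complex.Re t)%:C * rdiff g 1 x + (complex.Im t)%:C * rdiff g 'i%C x) =
  (h * complex.Re t)%:C * rdiff g 1 x + (h * complex.Im t)%:C * rdiff g 'i%C x.
  by rewrite -[_ *: _]/(_ * _) !rmorphM; ring.
move/le_trans; apply; rewrite mulrAC ler_pdivrMr // -mulrA ler_pM2l // ler_wpM2l //.
by rewrite lerDl.
Qed.

Lemma bigo_of_rdiff (U : set C) (g : C -> C) N : open U -> U 0 -> smooth_on U g -> g 0 = 0 ->
  bigo N (rdiff g 1) -> bigo N (rdiff g 'i%C) -> bigo N.+1 g.
Proof.
move=> oU U0 sg g0 [K1 [d1 [K10 d10 H1]]] [K2 [d2 [K20 d20 H2]]].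
have [d0 d00 Hd0] : exists2 d : R, 0 < d & forall y, rn y < d -> U y.
  by have /nearP [d d0 Hd] := open_nbhs_nbhs (conj oU U0); exists d => // y yd; apply: Hd; rewrite subr0.
exists (K1 + K2), (Num.min d0 (Num.min d1 d2)); split; rewrite ?addr_ge0 ?lt_min ?d00 ?d10 //.
move=> t; rewrite !lt_min => /andP [t0 /andP [t1 t2]].
have seg s : 0 <= s <= 1 -> rn (s%:C * t) <= rn t.
  by move=> /andP [s0 s1]; rewrite rnM rn_real ger0_norm // ler_piMl ?rn_ge0.
have := MVT_rn (g := fun s => g (0 + s%:C *: t))
  (g' := fun s => (complex.Re t)%:C * rdiff g 1 (0 + s%:C *: t) + (complex.Im t)%:C * rdiff g 'i%C (0 + s%:C *: t))
  (M := (K1 + K2) * rn t ^+ N.+1) (a := 0) (b := 1) ler01.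
rewrite !add0r scale0r g0 scale1r !subr0 mulr1; apply=> s /seg hs.
  apply: dD_line; apply: (C_rdiff oU sg); apply: Hd0; rewrite add0r; exact: le_lt_trans hs t0.
rewrite add0r -[s%:C *: t]/(s%:C * t); apply: le_trans (rnD _ _) _; rewrite !rnM !rn_real exprS mulrDl.
have key K : 0 <= K -> K * rn (s%:C * t) ^+ N <= K * rn t ^+ N.
  by move=> K0; rewrite ler_wpM2l // lerXn2r ?nnegrE ?rn_ge0.
apply: lerD; rewrite mulrCA; apply: ler_pM; rewrite ?rn_ge0 ?normr_ge0 ?Re_le ?Im_le //.
  by apply: le_trans (H1 _ (le_lt_trans hs t1)) (key _ K10).
by apply: le_trans (H2 _ (le_lt_trans hs t2)) (key _ K20).
Qed.

(** Estimating along segments from 0 raises the common order of the two partial derivatives by one,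
    so vanishing of all iterated derivatives gives every order. *)
Lemma flat_bigo (U : set C) (g : C -> C) N : open U -> U 0 -> smooth_on U g ->
  (forall s, Defs.iterD g s 0 = 0) -> bigo N g.
Proof.
move=> oU U0; elim: N g => [|N IH] g sg H.
  have [cg _] := smooth_base sg; have /contP /(_ 1 ltr01) [d d0 Hd] := cg 0 U0.
  exists 1, d; split=> // x xd; rewrite expr0 mulr1 ltW //.
  by have g0 : g 0 = 0 := H [::]; have := Hd x; rewrite subr0 g0 subr0; apply.
apply: (bigo_of_rdiff oU U0 sg (H [::])); apply: IH.
- by have [_ /(_ 1) [h _]] := smooth_base sg.
- by move=> s; rewrite iterD_rcons.
- by have [_ /(_ 'i%C) [h _]] := smooth_base sg.
- by move=> s; rewrite iterD_rcons.
Qed.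

End Flat.

(** * Taylor expansion in z and its conjugate *)

Section Taylor.
Variable R : realType.
Local Notation C := (Cplx R).
Variable n : nat.
Local Notation V := 'rV[C]_n.

(* Monomials are lists of variables: [mon u z] is [z^al] with [al] the multiplicities in [u]. *)
Definition mon (u : seq 'I_n) (z : V) : C := \prod_(j <- u) z 0 j.
Definition bmon (p : seq 'I_n * seq 'I_n) (z : V) : C := mon p.1 z * (mon p.2 z)^*%C.
Definition pe (l : seq (C * (seq 'I_n * seq 'I_n))) (z : V) : C := \sum_(p <- l) p.1 * bmon p.2 z.
Definition homog k (l : seq (C * (seq 'I_n * seq 'I_n))) := forall p, p \in l -> (size p.2.1 + size p.2.2 = k)%N.

Lemma monZ u (c : C) z : mon u (c *: z) = c ^+ size u * mon u z.
Proof.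
rewrite /mon; elim: u => [|j u IH]; first by rewrite !big_nil expr0 mulr1.
by rewrite !big_cons IH mxE exprS; ring.
Qed.

Lemma bmonZ p (c : C) z : bmon p (c *: z) = c ^+ size p.1 * (c^*%C) ^+ size p.2 * bmon p z.
Proof. by rewrite /bmon !monZ rmorphM rmorphXn /=; ring. Qed.

Lemma peZ_real k l (s : R) z : homog k l -> pe l (s%:C *: z) = s%:C ^+ k * pe l z.
Proof.
move=> H; rewrite /pe mulr_sumr big_seq [RHS]big_seq; apply: eq_bigr => p /H <-.
by rewrite bmonZ conjc_real exprD; ring.
Qed.

Lemma smooth_wirt (U : set V) (g : V -> C) j : open U -> smooth_on U g -> smooth_on U (wirt j g).
Proof.
move=> oU sg; have [_ dg] := smooth_base sg.
have -> : wirt j g = fun x => 2^-1 * (rdiff g (delta_mx 0 j) x + (- 'i%C) * rdiff g ('i%C *: delta_mx 0 j) x).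
  by apply: funext => x; rewrite /wirt -complexiE mulNr.
apply: (smooth_alg oU (B := smooth_on U)) => //.
have A v : alg (smooth_on U) (rdiff g v) by apply: alg_base; have [] := dg v.
do ?[exact: A | exact: alg_cst | apply: alg_add | apply: alg_mul].
Qed.

Lemma smooth_wirtb (U : set V) (g : V -> C) j : open U -> smooth_on U g -> smooth_on U (wirtb j g).
Proof.
move=> oU sg; have [_ dg] := smooth_base sg.
apply: (smooth_alg oU (B := smooth_on U)) => //.
have A v : alg (smooth_on U) (rdiff g v) by apply: alg_base; have [] := dg v.
rewrite /wirtb; do ?[exact: A | exact: alg_cst | apply: alg_add | apply: alg_mul].
Qed.

Lemma bigo_cont (W : normedModType C) (g : W -> C) : {for 0, continuous g} -> bigo 0 g.
Proof.
move=> /contP /(_ 1 ltr01) [d d0 Hd]; exists (rn (g 0) + 1), d; split=> //.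
  by rewrite addr_ge0 ?rn_ge0.
move=> x xd; rewrite expr0 mulr1; have := Hd x; rewrite subr0 => /(_ xd) h.
by apply: le_trans (rn_le _ (g 0)) _; lra.
Qed.

Lemma open_ball0 (W : normedModType C) (U : set W) : open U -> U 0 ->
  exists2 d : R, 0 < d & forall y, rn y < d -> U y.
Proof.
move=> oU U0; have /nearP [d d0 Hd] := open_nbhs_nbhs (conj oU U0).
by exists d => // y yd; apply: Hd; rewrite subr0.
Qed.

Lemma row_MVT (U : set V) (g : V -> C) (h h' : R -> C) (z : V) (M d : R) : open U -> smooth_on U g ->
  (forall y, rn y < d -> U y) -> rn z < d ->
  (forall s, 0 <= s <= 1 -> rD h s (h' s)) ->
  (forall s, 0 <= s <= 1 -> rn (dL g (s%:C *: z) z - h' s) <= M) ->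
  rn (g z - h 1 - (g 0 - h 0)) <= M.
Proof.
move=> oU sg HU zd Hh HM.
have := MVT_rn (g := fun s => g (0 + s%:C *: z) - h s) (g' := fun s => dL g (s%:C *: z) z - h' s)
  (M := M) (a := 0) (b := 1) ler01.
rewrite !add0r scale1r scale0r subr0 mulr1; apply=> // s hs.
apply: rD_add; last by apply: rD_opp; exact: Hh.
have -> : s%:C *: z = 0 + s%:C *: z by rewrite add0r.
apply: (smooth_comp_rD (P := fun s : R => 0 + s%:C *: z) oU sg); last exact: rD_line.
rewrite add0r; apply: HU; rewrite rnZ rn_real; case/andP: hs => s0 s1.
by rewrite ger0_norm //; apply: le_lt_trans zd; rewrite ler_piMl ?rn_ge0.
Qed.

(** Induction on N through the Wirtinger derivatives. By Euler's relation the part of degree k + 1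
    is 1 / (k + 1) times the sum of z_j, or its conjugate, times the degree-k parts of the
    derivatives; the mean value inequality on the segment from 0 gives the remainder. *)
Lemma taylor_row N (U : set V) (g : V -> C) : open U -> U 0 -> smooth_on U g ->
  exists L : nat -> seq (C * (seq 'I_n * seq 'I_n)), (forall k, homog k (L k)) /\
    bigo N (fun z => g z - \sum_(k < N) pe (L k) z).
Proof.
move=> oU U0; elim: N g => [|N IH] g sg.
  exists (fun=> [::]); split=> //; have [cg _] := smooth_base sg.
  by apply: bigo_ext (bigo_cont (cg 0 U0)) => z; rewrite big_ord0 subr0.
have /choice [La HLa] : forall j, exists L : nat -> seq (C * (seq 'I_n * seq 'I_n)),
  (forall k, homog k (L k)) /\ bigo N (fun z => wirt j g z - \sum_(k < N) pe (L k) z).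
  by move=> j; apply: IH; exact: smooth_wirt.
have /choice [Lb HLb] : forall j, exists L : nat -> seq (C * (seq 'I_n * seq 'I_n)),
  (forall k, homog k (L k)) /\ bigo N (fun z => wirtb j g z - \sum_(k < N) pe (L k) z).
  by move=> j; apply: IH; exact: smooth_wirtb.
pose fa k (j : 'I_n) (p : C * (seq 'I_n * seq 'I_n)) := (k.+1%:R^-1 * p.1, (j :: p.2.1, p.2.2)).
pose fb k (j : 'I_n) (p : C * (seq 'I_n * seq 'I_n)) := (k.+1%:R^-1 * p.1, (p.2.1, j :: p.2.2)).
pose L k := if k is k'.+1 then flatten [seq map (fa k' j) (La j k') ++ map (fb k' j) (Lb j k') | j <- enum 'I_n]
   else [:: (g 0, ([::], [::]))].
have HL k : homog k (L k).
  case: k => [|k] p /=; first by rewrite inE => /eqP ->.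
  move=> /flatten_mapP [j _]; rewrite mem_cat => /orP [] /mapP [q qL ->] /=.
    by rewrite addSn ((HLa j).1 k q qL).
  by rewrite addnS ((HLb j).1 k q qL).
have EL k z : pe (L k.+1) z = k.+1%:R^-1 * \sum_j (z 0 j * pe (La j k) z + (z 0 j)^*%C * pe (Lb j k) z).
  rewrite /pe /= big_flatten /= big_map -big_enum mulr_sumr; apply: eq_bigr => j _.
  rewrite big_cat !big_map /= mulrDr !mulr_sumr; congr (_ + _); apply: eq_bigr => p _.
    by rewrite /bmon /= /mon big_cons; ring.
  by rewrite /bmon /= /mon big_cons rmorphM; ring.
exists L; split=> //.
have [d d0 HU] := open_ball0 oU U0.
have HO : bigo N (fun z => \sum_j (rn (wirt j g z - \sum_(k < N) pe (La j k) z) +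
    rn (wirtb j g z - \sum_(k < N) pe (Lb j k) z))%:C : C).
  apply: bigo_sum => j _.
  have [K1 [d1 [K10 d10 H1]]] := (HLa j).2; have [K2 [d2 [K20 d20 H2]]] := (HLb j).2.
  exists (K1 + K2), (Num.min d1 d2); split; rewrite ?addr_ge0 ?lt_min ?d10 //.
  move=> x; rewrite lt_min => /andP [/H1 h1 /H2 h2].
  by rewrite rn_real ger0_norm ?addr_ge0 ?rn_ge0 // mulrDl lerD.
have {HO} [K [d1 [K0 d10 HO]]] := HO.
exists K, (Num.min d d1); split; rewrite ?lt_min ?d0 //.
move=> z; rewrite lt_min => /andP [zd zd1].
pose h (s : R) : C := \sum_(k < N) pe (L k.+1) z * s%:C ^+ k.+1.
pose h' (s : R) : C := \sum_(k < N) pe (L k.+1) z * (k.+1%:R * s%:C ^+ k * 1).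
have Dh s : 0 <= s <= 1 -> rD h s (h' s).
  move=> _; apply: (@rD_sum R N (fun k s => pe (L k.+1) z * s%:C ^+ k.+1)
    (fun k s => pe (L k.+1) z * (k.+1%:R * s%:C ^+ k * 1))) => k.
  by apply: rD_mulC; exact: (rD_expr k.+1 (rD_id s)).
have := @row_MVT U g h h' z (K * rn z ^+ N.+1) d oU sg HU zd Dh _.
have -> : g z - h 1 - (g 0 - h 0) = g z - \sum_(k < N.+1) pe (L k) z.
  rewrite big_ord_recl /= /pe /= big_seq1 /= /bmon /mon !big_nil rmorph1 !mulr1.
  have -> : h 0 = 0 by apply: big1 => k _; rewrite rmorph0 expr0n mulr0.
  have -> : h 1 = \sum_(k < N) pe (L (bump 0 k)) z.
    by apply: eq_bigr => k _; rewrite rmorph1 expr1n mulr1.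
  by rewrite /pe; ring.
apply=> s hs; have [s0 s1] := andP hs.
have -> : h' s = \sum_j (z 0 j * \sum_(k < N) pe (La j k) (s%:C *: z) +
    (z 0 j)^*%C * \sum_(k < N) pe (Lb j k) (s%:C *: z)).
  transitivity (\sum_(k < N) \sum_j (z 0 j * pe (La j k) (s%:C *: z) + (z 0 j)^*%C * pe (Lb j k) (s%:C *: z))).
    apply: eq_bigr => k _; rewrite EL mulr1.
    have k0 : k.+1%:R != 0 :> C by rewrite pnatr_eq0.
    rewrite mulrC -!mulrA mulrCA; rewrite [k.+1%:R * (_ * _)]mulrA divff // mul1r mulr_sumr.
    apply: eq_bigr => j _; rewrite (peZ_real _ _ ((HLa j).1 k)) (peZ_real _ _ ((HLb j).1 k)); ring.
  by rewrite exchange_big; apply: eq_bigr => j _; rewrite big_split /= -!mulr_sumr.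
rewrite dL_wirt -sumrB.
have zs : rn (s%:C *: z) <= rn z by rewrite rnZ rn_real ger0_norm // ler_piMl ?rn_ge0.
apply: (@le_trans _ _ (rn z * (K * rn (s%:C *: z) ^+ N))); last first.
  rewrite exprS mulrCA ler_wpM2l // ler_wpM2l ?rn_ge0 // lerXn2r ?nnegrE ?rn_ge0 //.
have := HO (s%:C *: z) (le_lt_trans zs zd1).
rewrite -rmorph_sum rn_real ger0_norm; last by apply: sumr_ge0 => j _; rewrite addr_ge0 ?rn_ge0.
move=> h1; apply: le_trans (ler_wpM2l (rn_ge0 z) h1).
apply: le_trans (rn_sum _ _ _) _; rewrite mulr_sumr; apply: ler_sum => j _.
have -> (a b p q x y : C) : a * p + b * q - (a * x + b * y) = a * (p - x) + b * (q - y) by ring.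
apply: le_trans (rnD _ _) _; rewrite !rnM rnJ mulrDr.
by apply: lerD; rewrite ler_wpM2r ?rn_ge0 ?rn_coord.
Qed.

End Taylor.

(** * Purity of the Taylor expansion under infinite type *)

Section Pure.
Variable R : realType.
Local Notation C := (Cplx R).

Lemma holD r (f g : C -> C) : hol r f -> hol r g -> hol r (fun t => f t + g t).
Proof. by move=> hf hg t tr; apply: differentiableD; [apply: hf | apply: hg]. Qed.
Lemma holM r (f g : C -> C) : hol r f -> hol r g -> hol r (fun t => f t * g t).
Proof. by move=> hf hg t tr; apply: differentiableM; [apply: hf | apply: hg]. Qed.
Lemma hol_cst r (c : C) : hol r (fun=> c).
Proof. by move=> t _; apply: differentiable_cst. Qed.
Lemma hol_sum r (I : eqType) (s : seq I) (f : I -> C -> C) : (forall i, hol r (f i)) ->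
  hol r (fun t => \sum_(i <- s) f i t).
Proof.
move=> H; elim: s => [|i s IH].
  have -> : (fun t => \sum_(i <- [::]) f i t) = (fun=> 0) by apply: funext => t; rewrite big_nil.
  exact: hol_cst.
have -> : (fun t => \sum_(i <- i :: s) f i t) = (fun t => f i t + \sum_(i <- s) f i t).
  by apply: funext => t; rewrite big_cons.
exact: holD.
Qed.
Lemma hol_le r r' (f : C -> C) : r' <= r -> hol r f -> hol r' f.
Proof. by move=> rr hf t tr; apply: hf; exact: lt_le_trans tr rr. Qed.

(** The points [cis (1 / (k + 1))] are pairwise distinct because cosine is injective on [0, pi];
    this gives more roots than the degree allows. *)
Lemma unit_poly_zero (p : {poly C}) : (forall t : R, p.[cis t] = 0) -> p = 0.
Proof.
move=> H; apply/eqP/negP => /negP p0.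
pose s : seq C := [seq cis (k.+1%:R^-1) | k <- iota 0 (size p)].
have in01 k : (k.+1%:R^-1 : R) \in `[0, pi]%R.
  rewrite in_itv /= invr_ge0 ler0n /=; apply: (@le_trans _ _ 1).
    by rewrite invf_le1 ?ltr0n // ler1n.
  by apply: le_trans (pi_ge2 R); rewrite ler1n.
have us : uniq s.
  rewrite map_inj_uniq ?iota_uniq // => i j [cij _].
  have := cos_inj (in01 i) (in01 j) cij => /invr_inj /eqP.
  by rewrite eqr_nat => /eqP [].
have := max_poly_roots p0 _ us; rewrite size_map size_iota ltnn => h.
have := h ltac:(apply/allP => x /mapP [k _ ->]; apply/eqP; exact: H).
by [].
Qed.

Variable n : nat.
Local Notation V := 'rV[C]_n.

(* A holomorphic polynomial as a list of (coefficient, monomial). *)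
Definition hp (l : seq (C * seq 'I_n)) (z : V) : C := \sum_(p <- l) p.1 * mon p.2 z.

Lemma hol_mon r (c : C -> V) u : (forall j, hol r (fun t => c t 0 j)) -> hol r (fun t => mon u (c t)).
Proof.
move=> H; elim: u => [|j u IH].
  have -> : (fun t => mon [::] (c t)) = (fun=> 1) by apply: funext => t; rewrite /mon big_nil.
  exact: hol_cst.
have -> : (fun t => mon (j :: u) (c t)) = (fun t => c t 0 j * mon u (c t)).
  by apply: funext => t; rewrite /mon big_cons.
exact: holM.
Qed.

Lemma hol_hp r (c : C -> V) l : (forall j, hol r (fun t => c t 0 j)) -> hol r (fun t => hp l (c t)).
Proof.
move=> H; apply: (@hol_sum r _ l (fun p t => p.1 * mon p.2 (c t))) => p.
by apply: holM; [exact: hol_cst | exact: hol_mon].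
Qed.

Lemma row_bigo1 (c : C -> V) : (forall j, bigo 1 (fun t => c t 0 j)) -> exists L d : R,
  [/\ 0 <= L, 0 < d & forall t, rn t < d -> rn (c t) <= L * rn t].
Proof.
move=> H; have : bigo 1 (fun t => \sum_j (rn (c t 0 j))%:C : C).
  apply: bigo_sum => j _; have [K [d [K0 d0 HK]]] := H j; exists K, d; split=> // t /HK.
  by rewrite rn_real ger0_norm ?rn_ge0.
move=> [K [d [K0 d0 HK]]]; exists K, d; split=> // t /HK.
have s0 (P : pred 'I_n) : 0 <= \sum_(j | P j) rn (c t 0 j) by apply: sumr_ge0 => j _; rewrite rn_ge0.
rewrite -rmorph_sum rn_real ger0_norm // expr1; apply: le_trans.
apply: rn_row_le => // j; rewrite (bigD1 j) //= lerDl; exact: s0.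
Qed.

Section Curve.
Variables (c : C -> V) (v : V).
Hypothesis Hc : forall j, bigo 2 (fun t => c t 0 j - t * v 0 j).

Lemma curve_bigo1 j : bigo 1 (fun t => c t 0 j).
Proof.
have h : bigo 1 (fun t : C => v 0 j * t) := bigoM (bigo_cst C (v 0 j)) (@bigo_id R).
by apply: bigo_ext (bigoD (bigo_le (leqnSn 1) (@Hc j)) h) => t; rewrite mulrC subrK.
Qed.

Lemma mon_perturb u : bigo (size u) (fun t : C => mon u (t *: v)) /\
  bigo (size u) (fun t => mon u (c t)) /\ bigo (size u).+1 (fun t => mon u (c t) - mon u (t *: v)).
Proof.
elim: u => [|j u [IH1 [IH2 IH3]]].
  have E : (fun t : C => 1) =1 (fun t => mon [::] (c t)) by move=> t; rewrite /mon big_nil.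
  have E' : (fun t : C => 1) =1 (fun t : C => mon [::] (t *: v)) by move=> t; rewrite /mon big_nil.
  split; first by apply: bigo_ext E' (bigo_cst C 1).
  split; first by apply: bigo_ext E (bigo_cst C 1).
  by apply: bigo_ext (bigo0 C 1) => t; rewrite -E -E' subrr.
have h : bigo 1 (fun t : C => v 0 j * t) := bigoM (bigo_cst C (v 0 j)) (@bigo_id R).
have mc (z : V) : mon (j :: u) z = z 0 j * mon u z by rewrite /mon big_cons.
split; first by apply: bigo_ext (bigoM h IH1) => t; rewrite mc mxE [v 0 j * t]mulrC.
split; first by apply: bigo_ext (bigoM (curve_bigo1 j) IH2) => t; rewrite mc.
apply: bigo_ext (bigoD (bigoM (@Hc j) IH2) (bigoM h IH3)) => t.
by rewrite !mc mxE; ring.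
Qed.

(** Exchanging one factor costs O(t^2) where the factor itself is O(t), so the leading term of a
    form of degree k along the curve depends only on the velocity. *)
Lemma pe_perturb k l : homog k l -> bigo k.+1 (fun t => pe l (c t) - pe l (t *: v)).
Proof.
move=> H; have : bigo k.+1 (fun t : C => \sum_(p <- l | p \in l) p.1 * (bmon p.2 (c t) - bmon p.2 (t *: v))).
  apply: bigo_sum => p pl; apply: bigoZ; rewrite -(H p pl).
  have [a1 [a2 a3]] := mon_perturb p.2.1; have [b1 [b2 b3]] := mon_perturb p.2.2.
  have h1 := bigoM a3 (bigo_J b2); have h2 := bigoM a1 (bigo_J b3); rewrite addnS in h2; rewrite addSn in h1.
  by apply: bigo_ext (bigoD h1 h2) => t; rewrite /bmon rmorphB /=; ring.
apply: bigo_ext => t; rewrite -big_seq /pe -sumrB; apply: eq_bigr => p _; ring.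
Qed.
End Curve.

(* Curves with prescribed velocity in submanifolds tangent to [2 Re w + g = 0] to order [m]. *)
Definition curves (g : V -> C) := forall m (v : V), exists (c : C -> V) (b : C -> C) (r : R),
  [/\ 0 < r, forall j, hol r (fun t => c t 0 j), hol r b,
      forall j, bigo 2 (fun t => c t 0 j - t * v 0 j) &
      bigo m (fun t => (b t + (b t)^*%C) + g (c t))].

(** [hp l] plays the role of S truncated below degree N. Degrees start at 2 because [F] has neither
    constant nor linear part. *)
Definition pure_at (g : V -> C) N (l : seq (C * seq 'I_n)) :=
  (forall p, p \in l -> (2 <= size p.2 < N)%N) /\ bigo N (fun z => g z - (hp l z + (hp l z)^*%C)).

Lemma addJ (x : C) : x + x^*%C = (2 * complex.Re x)%:C.
Proof. by rewrite Re2. Qed.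

Lemma smooth_mon (U : set V) u : open U -> smooth_on U (mon u).
Proof.
move=> oU; pose B (f : V -> C) := exists j, f = fun z => z 0 j.
apply: (dclosed_smooth oU (A := alg B)).
  apply: alg_dclosed => f [j ->]; split=> [x _|w].
    by apply/contP => e e0; exists e => // y; apply: le_lt_trans; have := rn_coord (y - x) j; rewrite !mxE.
  exists (fun=> w 0 j); split; first exact: alg_cst.
  move=> x _; have := @rD_line R C (x 0 j) (w 0 j) 0; apply: rD_ext; exists 1 => // h _.
  by rewrite !mxE.
elim: u => [|j u IH].
  have -> : mon [::] = (fun=> 1) :> (V -> C) by apply: funext => z; rewrite /mon big_nil.
  exact: alg_cst.
have -> : mon (j :: u) = (fun z => z 0 j * mon u z) :> (V -> C).
  by apply: funext => z; rewrite /mon big_cons.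
by apply: alg_mul => //; apply: alg_base; exists j.
Qed.

Lemma alg_hp (U : set V) l : open U -> alg (smooth_on U) (hp l).
Proof.
move=> oU; elim: l => [|p l IH].
  have -> : hp [::] = (fun=> 0) :> (V -> C) by apply: funext => z; rewrite /hp big_nil.
  exact: alg_cst.
have -> : hp (p :: l) = (fun z => p.1 * mon p.2 z + hp l z) :> (V -> C).
  by apply: funext => z; rewrite /hp big_cons.
by apply: alg_add => //; apply: alg_mul; [exact: alg_cst | apply: alg_base; exact: smooth_mon].
Qed.

Lemma smooth_sub_hp (U : set V) g l : open U -> smooth_on U g ->
  smooth_on U (fun z => g z - (hp l z + (hp l z)^*%C)).
Proof.
move=> oU sg; have -> : (fun z => g z - (hp l z + (hp l z)^*%C)) =
   (fun z => g z + (-1) * (hp l z + (hp l z)^*%C)) by apply: funext => z; rewrite mulN1r.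
apply: (smooth_alg oU (B := smooth_on U)) => //.
have Ag : alg (smooth_on U) g by apply: alg_base.
have Al := alg_hp l oU.
exact: (alg_add Ag (alg_mul (alg_cst _ (-1)) (alg_add Al (alg_conj Al)))).
Qed.

(* The degree N part Q of the remainder satisfies Q(la v) = Re (ka la^N) for all la in C;
   comparing Fourier coefficients on |la| = 1 leaves only the pure terms of Q. *)
Lemma pure_step (U : set V) g N l : open U -> U 0 -> smooth_on U g -> (2 <= N)%N ->
  curves g -> pure_at g N l -> exists l', pure_at g N.+1 l'.
Proof.
move=> oU U0 sg N2 Hcur [Hl HO]; set g1 := (fun z => _) in HO.
have sg1 : smooth_on U g1 by exact: smooth_sub_hp.
have [L [HL HT]] := taylor_row N.+1 oU U0 sg1.
(* The remainder is O(|z|^N), so on each real ray its homogeneous parts of degree below N vanish. *)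
have L0 k z : (k < N)%N -> pe (L k) z = 0.
  move=> kN.
  have hb : bigo N (fun z => \sum_(k < N) pe (L k) z).
    have hN : bigo N (pe (L N)).
      have : bigo N (fun z => \sum_(p <- L N | p \in L N) p.1 * bmon p.2 z).
        apply: bigo_sum => p pl; apply: bigoZ; rewrite -(HL N p pl).
        have b1 u : bigo (size u) (fun z : V => mon u z).
          elim: u => [|j u IH].
            by apply: bigo_ext (bigo_cst _ 1) => w; rewrite /mon big_nil.
          have hj : bigo 1 (fun z : V => z 0 j).
            by exists 1, 1; split=> // w _; rewrite expr1 mul1r; exact: rn_coord.
          by apply: bigo_ext (bigoM hj IH) => w; rewrite /mon big_cons.
        exact: bigoM (b1 _) (bigo_J (b1 _)).
      by apply: bigo_ext => w; rewrite -big_seq.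
    apply: bigo_ext (bigoB (bigoB HO (bigo_le (leqnSn N) HT)) hN) => w.
    by rewrite big_ord_recr /=; ring.
  have [K [d [K0 d0 HK]]] := hb.
  have z1 : 0 < rn z + 1 by rewrite ltr_wpDl ?rn_ge0.
  apply: (@real_poly_small R N (fun k => pe (L k) z) (K * rn z ^+ N) (d / (rn z + 1))) => //.
    by rewrite divr_gt0.
  move=> s /andP [s0]; rewrite ltr_pdivlMr // => sd.
  have := HK (s%:C *: z); rewrite rnZ rn_real gtr0_norm // => /(_ ltac:(lra)).
  rewrite exprMn mulrA mulrAC => h; apply: le_trans h; apply: eqW; congr rn.
  by apply: eq_bigr => i _; rewrite (peZ_real _ _ (HL i)) mulrC.
pose Q := pe (L N).
have HQ : bigo N.+1 (fun z => g1 z - Q z).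
  apply: bigo_ext HT => z; rewrite big_ord_recr /= big1 ?add0r // => k _; exact: L0.
pose l1 := [seq (p.1, p.2.1) | p <- L N & p.2.2 == [::]].
have key v : Q v = hp l1 v + (hp l1 v)^*%C.
  have [c [b [r [r0 hc hb hv hm]]]] := Hcur N.+1 v.
  (* Tangency of the curve makes Q(t v) equal to the real part of this holomorphic function, up to
     O(t^(N+1)). *)
  pose kf t := - (1 + 1) * (b t + hp l (c t)).
  have hk : hol r kf by apply: holM; [exact: hol_cst | apply: holD => //; exact: hol_hp].
  have [Lc [dc [Lc0 dc0 HLc]]] := row_bigo1 (curve_bigo1 hv).
  have H1 := bigo_comp Lc0 dc0 HLc HQ.
  have H2 := pe_perturb hv (HL N).
  have HQt : bigo N.+1 (fun t : C => Q (t *: v) - (complex.Re (kf t))%:C).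
    apply: bigo_ext (bigoB hm (bigoD H1 H2)) => t.
    rewrite -/(Q _) -/(Q _) /g1.
    have -> : (complex.Re (kf t))%:C = - (b t + (b t)^*%C) - (hp l (c t) + (hp l (c t))^*%C) :> C.
      rewrite -opprD addrACA -rmorphD addJ -rmorphN; congr (_%:C).
      by rewrite /kf; case: (b t + hp l (c t)) => x y /=; ring.
    ring.
  have HT2 := hol_taylor N.+1 r0 hk.
  pose ck k := taylorc kf k.
  have HQp : bigo N.+1 (fun t : C => Q (t *: v) - (complex.Re (\sum_(k < N.+1) ck k * t ^+ k))%:C).
    apply: bigo_ext (bigoD HQt (bigo_Re HT2)) => t.
    by rewrite cReB rmorphB /= -/(ck) ; ring.
  clearbody ck.
  have HQl (la : C) : Q (la *: v) = (complex.Re (ck N * la ^+ N))%:C.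
    have [K [d [K0 d0 HK]]] := HQp.
    have z1 : 0 < rn la + 1 by rewrite ltr_wpDl ?rn_ge0.
    have := @real_poly_small R N.+1 (fun k => (if k == N then Q (la *: v) else 0) - (complex.Re (ck k * la ^+ k))%:C)
      (K * rn la ^+ N.+1) (d / (rn la + 1)) (divr_gt0 d0 z1) _ N (ltnSn N).
    rewrite eqxx => h; apply/eqP; rewrite -subr_eq0; apply/eqP; apply: h.
    move=> s /andP [s0]; rewrite ltr_pdivlMr // => sd.
    have := HK (s%:C * la); rewrite rnM rn_real gtr0_norm // => /(_ ltac:(lra)).
    rewrite [in X in _ <= X]exprMn mulrA mulrAC => h; apply: le_trans h; apply: eqW; congr rn.
    rewrite big_ord_recr /= eqxx big_ord_recr /= cReD rmorphD /= -scalerA.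
    rewrite /Q (peZ_real _ _ (HL N)) -/Q.
    have e1 k : (complex.Re (ck k * (s%:C * la) ^+ k))%:C = (complex.Re (ck k * la ^+ k))%:C * s%:C ^+ k :> C.
      have -> : ck k * (s%:C * la) ^+ k = (s ^+ k)%:C * (ck k * la ^+ k).
        by rewrite rmorphXn exprMn; ring.
      by rewrite cReZ rmorphM rmorphXn /= mulrC.
    rewrite e1 cRe_sum rmorph_sum /=.
    have -> : \sum_(i < N) ((if (i : nat) == N then Q (la *: v) else 0) - (complex.Re (ck i * la ^+ i))%:C) * s%:C ^+ i =
      - \sum_(i < N) (complex.Re (ck i * (s%:C * la) ^+ i))%:C.
      rewrite -sumrN; apply: eq_bigr => i _; rewrite e1 (ltn_eqF (ltn_ord i)); ring.
    ring.
  (* The part of Q(v) of degree a in the conjugate variables. *)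
  pose Ak a := \sum_(p <- L N | size p.2.2 == a) p.1 * bmon p.2 v.
  have QA (la : C) : Q (la *: v) = \sum_(a < N.+1) Ak a * (la ^+ (N - a) * (la^*%C) ^+ a).
    rewrite /Q /pe /Ak.
    under [RHS]eq_bigr => a _ do rewrite mulr_suml big_mkcond /=.
    rewrite exchange_big /= big_seq [RHS]big_seq; apply: eq_bigr => p pl.
    have Hp := HL N p pl; have sp : (size p.2.2 < N.+1)%N by rewrite ltnS -Hp leq_addl.
    rewrite (bigD1 (Ordinal sp)) //= eqxx big1 ?addr0; last first.
      by move=> a; rewrite -val_eqE /= eq_sym => /negbTE ->.
    by rewrite bmonZ -Hp addnK; ring.
  have A0 : Ak 0%N = hp l1 v.
    rewrite /hp /l1 big_map big_filter; apply: eq_big => p; first by rewrite size_eq0.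
    by rewrite size_eq0 => /eqP p0; rewrite /bmon p0 /mon big_nil rmorph1 mulr1.
  set ka := ck N in HQl; clearbody ka.
  (* On |la| = 1 the conjugate of [la] is its inverse, so multiplying Q(la v) - Re (ka la^N) by la^N
     yields a polynomial in [la], which vanishes on the circle. *)
  pose P : {poly C} := \sum_(a < N.+1) (Ak a *: 'X^(2 * (N - a))) - (2^-1 * ka) *: 'X^(2 * N) - (2^-1 * ka^*%C)%:P.
  have cisJ t : cis t * (cis t : C)^*%C = 1 :> C by have := cisVN t.
  have P0 : P = 0.
    apply: unit_poly_zero => t; rewrite /P !hornerE horner_sum.
    have e2 : \sum_(a < N.+1) (Ak a *: 'X^(2 * (N - a))).[cis t] = (cis t) ^+ N * Q (cis t *: v).
      rewrite QA mulr_sumr; apply: eq_bigr => a _; rewrite hornerZ hornerXn mulrCA; congr (_ * _).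
      have aN : (a <= N)%N by rewrite -ltnS ltn_ord.
      have -> : (cis t) ^+ N = (cis t) ^+ (N - a) * (cis t) ^+ a by rewrite -exprD subnK.
      rewrite mul2n -addnn exprD.
      transitivity ((cis t) ^+ (N - a) * (cis t) ^+ (N - a) * (cis t * (cis t)^*%C) ^+ a); last by rewrite exprMn; ring.
      by rewrite cisJ expr1n mulr1.
    rewrite e2 HQl; have -> : (complex.Re (ka * cis t ^+ N))%:C =
       2^-1 * (ka * cis t ^+ N + ka^*%C * (cis t)^*%C ^+ N) :> C.
      have := Re2 (ka * cis t ^+ N); rewrite !rmorphM rmorphXn rmorph_nat /= => <-.
      by rewrite mulrA mulVf ?mul1r // pnatr_eq0.
    rewrite ?hornerZ ?hornerXn ?hornerC mul2n -addnn exprD.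
    transitivity (2^-1 * ka^*%C * ((cis t * (cis t)^*%C) ^+ N - 1)); first by rewrite exprMn; ring.
    by rewrite cisJ expr1n subrr mulr0.
  (* In degree 2 N only the term a = 0 and ka / 2 contribute, the constant term staying out because
     N > 0. Hence the holomorphic part of Q at v is ka / 2. *)
  have := congr1 (fun p : {poly C} => p`_(2 * N)) P0; rewrite /P !coefB coef_sum coef0 coefC [(_ *: 'X^(2 * N))`__]coefZ coefXn eqxx mulr1.
  have N0 : (2 * N == 0)%N = false by case: (N) N2.
  have -> : \sum_(i < N.+1) (Ak i *: 'X^(2 * (N - i)))`_(2 * N) = hp l1 v.
    rewrite big_ord_recl subn0 coefZ coefXn eqxx mulr1 big1 ?addr0 // => i _.
    rewrite coefZ coefXn lift0 (_ : (2 * N == 2 * (N - i.+1))%N = false) ?mulr0 //.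
    by have := ltn_ord i; apply: contraTF; rewrite eqn_mul2l /= => /eqP; lia.
  rewrite N0 subr0 => /eqP; rewrite subr_eq0 => /eqP h1.
  have := HQl 1; rewrite scale1r expr1n mulr1 => ->.
  have -> : ka = 2 * hp l1 v by rewrite h1 mulrA divff ?mul1r // pnatr_eq0.
  by rewrite addJ; congr (_%:C); case: (hp l1 v) => x y /=; ring.
exists (l ++ l1); split.
  move=> p; rewrite mem_cat => /orP [/Hl /andP [h1 h2]|].
    by rewrite h1 (ltn_trans h2).
  move=> /mapP [q]; rewrite mem_filter => /andP [/eqP q2 qL] -> /=.
  by have := HL N q qL; rewrite q2 addn0 => ->; rewrite N2 ltnSn.
apply: bigo_ext HQ => z; rewrite /g1 key /hp big_cat /= rmorphD /=; ring.
Qed.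

Lemma smooth_bigo2 (U : set V) g : open U -> U 0 -> smooth_on U g -> g 0 = 0 ->
  (forall v, rdiff g v 0 = 0) -> bigo 2 g.
Proof.
move=> oU U0 sg g0 dg.
have lip1 (f : V -> C) : smooth_on U f -> f 0 = 0 -> bigo 1 f.
  move=> sf f0; have [L [d [L0 d0 H]]] := smooth_lip oU sf U0; exists L, d; split=> // x xd.
  by have := H x 0; rewrite !subr0 f0 subr0 expr1 rn0; apply.
have hd : bigo 1 (fun z => \sum_i (rn (rdiff g (dir R i) z))%:C : C).
  apply: bigo_sum => i _; have [_ /(_ (dir R i)) [si _]] := smooth_base sg.
  have [K [d [K0 d0 HK]]] := lip1 _ si (dg _); exists K, d; split=> // x /HK.
  by rewrite rn_real ger0_norm ?rn_ge0.
have [K [d1 [K0 d10 HK]]] := hd; have [d d0 HU] := open_ball0 oU U0.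
exists K, (Num.min d d1); split; rewrite ?lt_min ?d0 // => z; rewrite lt_min => /andP [zd zd1].
have := @row_MVT R n U g (fun=> 0) (fun=> 0) z (K * rn z ^+ 2) d oU sg HU zd (fun s _ => rD_cst 0 s).
rewrite g0 !subr0; apply=> s /andP [s0 s1]; rewrite subr0.
have zs : rn (s%:C *: z) <= rn z by rewrite rnZ rn_real ger0_norm // ler_piMl ?rn_ge0.
apply: le_trans (dL_le _ _ _) _; rewrite expr2 mulrA ler_wpM2r ?rn_ge0 //.
have := HK _ (le_lt_trans zs zd1); rewrite -rmorph_sum rn_real ger0_norm; last first.
  by apply: sumr_ge0 => i _; rewrite rn_ge0.
by move/le_trans; apply; rewrite expr1 ler_wpM2l.
Qed.

Lemma pure_exists (U : set V) g : open U -> U 0 -> smooth_on U g -> g 0 = 0 ->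
  (forall v, rdiff g v 0 = 0) -> curves g -> forall N, exists l, pure_at g (N.+2) l.
Proof.
move=> oU U0 sg g0 dg Hcur; elim=> [|N [l Hl]]; last first.
  exact: (pure_step oU U0 sg _ Hcur Hl).
exists [::]; split=> //.
apply: bigo_ext (smooth_bigo2 oU U0 sg g0 dg) => z.
by rewrite /hp big_nil rmorph0 addr0 subr0.
Qed.

End Pure.

(** * Wirtinger derivatives and the coefficients of S *)

Section Coef.
Variable R : realType.
Local Notation C := (Cplx R).
Variable n : nat.
Local Notation V := 'rV[C]_n.

(** This is d/dz_j of [mon u]; see [mon_dD]. *)
Definition dmon (j : 'I_n) (u : seq 'I_n) (z : V) : C := (count_mem j u)%:R * mon (rem j u) z.

Lemma mon_cons j u (z : V) : mon (j :: u) z = z 0 j * mon u z.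
Proof. by rewrite /mon big_cons. Qed.

Lemma mon_dD u (v x : V) : dD (mon u) v x (\sum_j v 0 j * dmon j u x).
Proof.
elim: u => [|i u IH].
  have -> : \sum_j v 0 j * dmon j [::] x = 0 by apply: big1 => j _; rewrite /dmon mul0r mulr0.
  have -> : mon [::] = (fun=> 1) :> (V -> C) by apply: funext => z; rewrite /mon big_nil.
  exact: rD_cst.
have -> : mon (i :: u) = (fun z => z 0 i * mon u z) :> (V -> C) by apply: funext => z; rewrite mon_cons.
have Di : dD (fun z : V => z 0 i) v x (v 0 i).
  have := @rD_line R C (x 0 i) (v 0 i) 0; apply: rD_ext; exists 1 => // h _.
  by rewrite !mxE.
have := rD_mul Di IH; rewrite scale0r addr0 /dD.
suff -> : \sum_j v 0 j * dmon j (i :: u) x = v 0 i * mon u x + x 0 i * \sum_j v 0 j * dmon j u x by [].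
rewrite mulr_sumr (bigD1 i) //= [in RHS](bigD1 i) //= addrA; congr (_ + _).
  rewrite /dmon /= eqxx natrD -[(true : nat)%:R]/(1 : C); case: (boolP (i \in u)) => iu.
    have E : mon u x = x 0 i * mon (rem i u) x.
      by rewrite -mon_cons /mon; apply: perm_big; exact: perm_to_rem.
    by rewrite E; ring.
  by rewrite (count_memPn iu); ring.
apply: eq_bigr => j ji; rewrite /dmon /= eq_sym (negbTE ji) add0n mon_cons; ring.
Qed.

Definition dhp (j : 'I_n) (l : seq (C * seq 'I_n)) : seq (C * seq 'I_n) :=
  [seq (p.1 * (count_mem j p.2)%:R, rem j p.2) | p <- l].

Lemma hp_dD l (v x : V) : dD (hp l) v x (\sum_j v 0 j * hp (dhp j l) x).
Proof.
elim: l => [|p l IH].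
  have -> : \sum_j v 0 j * hp (dhp j [::]) x = 0 by apply: big1 => j _; rewrite /hp big_nil mulr0.
  have -> : hp [::] = (fun=> 0) :> (V -> C) by apply: funext => z; rewrite /hp big_nil.
  exact: rD_cst.
have -> : hp (p :: l) = (fun z => p.1 * mon p.2 z + hp l z) :> (V -> C).
  by apply: funext => z; rewrite /hp big_cons.
have := rD_add (rD_mulC p.1 (mon_dD p.2 v x)) IH; rewrite /dD.
suff -> : \sum_j v 0 j * hp (dhp j (p :: l)) x = p.1 * (\sum_j v 0 j * dmon j p.2 x) + \sum_j v 0 j * hp (dhp j l) x by [].
rewrite mulr_sumr -big_split; apply: eq_bigr => j _ /=.
by rewrite /hp big_cons /= /dmon; ring.
Qed.

Lemma wirt_hp l j : wirt j (hp l) = hp (dhp j l) :> (V -> C).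
Proof.
apply: funext => x; rewrite /wirt !(dD_rdiff (hp_dD l _ x)).
have E (c : C) : \sum_k (c *: delta_mx 0 j : V) 0 k * hp (dhp k l) x = c * hp (dhp j l) x.
  rewrite (bigD1 j) //= !mxE !eqxx mulr1 big1 ?addr0 // => k kj.
  by rewrite !mxE eqxx (negbTE kj) /= mulr0 mul0r.
have := E 1; rewrite scale1r mul1r => ->; rewrite E mulrA -expr2 sqrCi.
by field.
Qed.

Lemma wirt_conj_hp l j : wirt j (fun x : V => (hp l x)^*%C) = (fun=> 0) :> (V -> C).
Proof.
apply: funext => x; rewrite /wirt !(dD_rdiff (rD_conj (hp_dD l _ x))).
have E (c : C) : \sum_k (c *: delta_mx 0 j : V) 0 k * hp (dhp k l) x = c * hp (dhp j l) x.
  rewrite (bigD1 j) //= !mxE !eqxx mulr1 big1 ?addr0 // => k kj.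
  by rewrite !mxE eqxx (negbTE kj) /= mulr0 mul0r.
have := E 1; rewrite scale1r mul1r => ->; rewrite E -complexiE.
have -> : ('i%C * hp (dhp j l) x)^*%C = - 'i%C * (hp (dhp j l) x)^*%C :> C.
  rewrite rmorphM /=; congr (_ * _); apply/eqP; rewrite eq_complex /= oppr0 eqxx //=.
have ii : 'i%C * 'i%C = -1 :> C by rewrite -expr2 sqr_i.
by rewrite mulrA mulrN ii opprK mul1r subrr mulr0.
Qed.

Lemma wirtL_rcons (g : V -> C) s j : wirtL g (rcons s j) = wirtL (wirt j g) s.
Proof. by rewrite /wirtL foldr_rcons. Qed.

Lemma wirtL_zero s : wirtL (fun=> 0) s = (fun=> 0) :> (V -> C).
Proof.
elim: s => [//|j s IH]; rewrite /= -/(wirtL _ s) IH; apply: funext => x.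
have D v : rdiff (fun=> 0 : C) v x = 0 by apply: dD_rdiff; exact: rD_cst.
by rewrite /wirt !D mulr0 subrr mulr0.
Qed.

Definition cfact (s : seq 'I_n) : C := ((\prod_j (count_mem j s)`!)%N)%:R.

Lemma hp0 l : hp l (0 : V) = \sum_(p <- l | p.2 == [::]) p.1.
Proof.
rewrite /hp [RHS]big_mkcond; apply: eq_bigr => p _; case: p => c [|j u] /=.
  by rewrite /mon big_nil mulr1.
by rewrite mon_cons mxE mul0r mulr0.
Qed.

Lemma perm_rcons_rem (u s : seq 'I_n) j : perm_eq u (rcons s j) = (j \in u) && perm_eq (rem j u) s.
Proof.
rewrite perm_sym perm_rcons perm_sym; apply/idP/andP => [H|[ju H]].
  have ju : j \in u by rewrite (perm_mem H) mem_head.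
  split=> //; rewrite -(perm_cons j); apply: perm_trans H; rewrite perm_sym; exact: perm_to_rem.
by apply: perm_trans (perm_to_rem ju) _; rewrite perm_cons.
Qed.

(** Induction from the end of [s], where the innermost derivative sits: each step lowers the
    exponent of [j] by one and supplies the next factor of the multi-index factorial [cfact s]. *)
Lemma wirtL_hp s l : wirtL (hp l) s (0 : V) = cfact s * \sum_(p <- l | perm_eq p.2 s) p.1.
Proof.
elim/last_ind: s l => [|s j IH] l.
  have c0 : cfact [::] = 1 by rewrite /cfact big1_idem.
  rewrite /= hp0 c0 mul1r; apply: eq_bigl => p.
  by apply/eqP/idP => [-> //|/perm_nilP].
rewrite wirtL_rcons wirt_hp IH /dhp big_map /= !mulr_sumr big_mkcond [RHS]big_mkcond.
apply: eq_bigr => p _; rewrite perm_rcons_rem.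
case: (boolP (j \in p.2)) => jp /=; last first.
  rewrite (count_memPn jp) mulr0 mulr0; by case: ifP.
case: ifP => [H|//]; rewrite mulrCA [RHS]mulrC; congr (_ * _).
have E : count_mem j p.2 = (count_mem j s).+1.
  by rewrite (permP (perm_to_rem jp)) /= eqxx (permP H).
rewrite E /cfact -natrM; congr (_%:R); rewrite (bigD1 j) //= [in RHS](bigD1 j) //=.
rewrite -cats1 count_cat /= eqxx addn0 addn1 factS mulnC mulnA; congr (_ * _)%N.
by apply: eq_bigr => i ij; rewrite count_cat /= eq_sym (negbTE ij) !addn0.
Qed.

Lemma smooth_wirtL (U : set V) g s : open U -> smooth_on U g -> smooth_on U (wirtL g s).
Proof. by move=> oU sg; elim: s => [//|j s IH] /=; exact: smooth_wirt. Qed.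

Lemma wirtL_add (U : set V) (f g : V -> C) s : open U -> smooth_on U f -> smooth_on U g ->
  forall x, U x -> wirtL (fun y => f y + g y) s x = wirtL f s x + wirtL g s x.
Proof.
move=> oU sf sg; elim: s => [//|j s IH] x Ux /=.
have [_ df] := smooth_base (smooth_wirtL s oU sf); have [_ dg] := smooth_base (smooth_wirtL s oU sg).
have D v : rdiff (wirtL (fun y => f y + g y) s) v x = rdiff (wirtL f s) v x + rdiff (wirtL g s) v x.
  apply: dD_rdiff; apply: (@dD_near _ _ (fun y => wirtL f s y + wirtL g s y)).
    by have := open_nbhs_nbhs (conj oU Ux); apply: filterS => y /IH.
  by apply: rD_add; [apply: (df v).2 | apply: (dg v).2].
have W h : wirt j h x = 2^-1 * (rdiff h (delta_mx 0 j) x - 'i%R * rdiff h ('i%R *: delta_mx 0 j) x) by [].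
rewrite !W (D (delta_mx 0 j)) (D ('i%R *: delta_mx 0 j)).
by move: (rdiff (wirtL f s) _ x) (rdiff (wirtL f s) _ x) (rdiff (wirtL g s) _ x) (rdiff (wirtL g s) _ x) => a b c d; ring.
Qed.

Lemma wirtL_bigo (U : set V) (g : V -> C) N s : open U -> U 0 -> smooth_on U g ->
  bigo (N + size s) g -> bigo N (wirtL g s).
Proof.
move=> oU U0 sg; elim: s N => [|j s IH] N; first by rewrite addn0.
rewrite /= addnS -addSn => /IH H; have sw := smooth_wirtL s oU sg.
have h v := smooth_decay v oU U0 sw H.
by apply: bigo_ext (bigoZ 2^-1 (bigoB (h (delta_mx 0 j)) (bigoZ 'i%R (h ('i%R *: delta_mx 0 j))))) => x.
Qed.

Lemma count_midx (al : 'I_n -> nat) j : count_mem j (midx al) = al j.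
Proof.
rewrite /midx count_flatten -map_comp sumnE big_map big_enum /= (bigD1 j) //= count_nseq /= eqxx mul1n.
by rewrite big1 ?addn0 // => i ij; rewrite count_nseq /= (negbTE ij).
Qed.

Lemma size_midx (al : 'I_n -> nat) : size (midx al) = (\sum_j al j)%N.
Proof.
rewrite /midx size_flatten /shape -map_comp sumnE big_map big_enum /=.
by apply: eq_bigr => j _; rewrite size_nseq.
Qed.

(** [F] splits into a remainder, [hp l] and its conjugate. The first is killed at 0 by its order,
    the last by any single d/dz_j. Several entries of [l] may carry the same monomial in different
    orders, hence a sum over entries up to permutation. *)
Lemma Scoef_pure (U : set V) (F : V -> R) N l (al : 'I_n -> nat) : open U -> U 0 ->
  smooth_on U (liftC F) -> pure_at (liftC F) N l -> (\sum_j al j < N)%N ->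
  Scoef F al = \sum_(p <- l | perm_eq p.2 (midx al)) p.1.
Proof.
move=> oU U0 sF [Hl HO] alN; rewrite /Scoef; case: eqP => [a0|/eqP a0].
  rewrite big_seq_cond big1 // => p /andP [/Hl /andP [p2 _] /perm_size].
  by rewrite size_midx a0 => h; rewrite h in p2.
set s := midx al; have ss : size s = (\sum_j al j)%N by rewrite size_midx.
set rm := (fun z : V => liftC F z - (hp l z + (hp l z)^*%C)) in HO.
have sr : smooth_on U rm by exact: smooth_sub_hp.
have sh : smooth_on U (hp l) by apply: (smooth_alg oU (B := smooth_on U)) => //; exact: alg_hp.
have shc : smooth_on U (fun z => (hp l z)^*%C : C).
  by apply: (smooth_alg oU (B := smooth_on U)) => //; apply: alg_conj; exact: alg_hp.
have shh : smooth_on U (fun z => hp l z + (hp l z)^*%C : C).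
  by apply: (smooth_alg oU (B := smooth_on U)) => //; apply: alg_add; [|apply: alg_conj]; exact: alg_hp.
have EF : liftC F = fun z : V => rm z + (hp l z + (hp l z)^*%C).
  by apply: funext => z; rewrite /rm subrK.
rewrite EF (wirtL_add s oU sr shh U0) (wirtL_add s oU sh shc U0) wirtL_hp.
have -> : wirtL rm s 0 = 0.
  apply: (@bigo_at0 _ _ _ 0); apply: (wirtL_bigo oU U0 sr).
  by apply: bigo_le HO; rewrite ss add1n.
have -> : wirtL (fun z => (hp l z)^*%C) s 0 = 0.
  case/lastP: (s) ss => [|s' j] ss; first by move: a0; rewrite -ss.
  by rewrite wirtL_rcons wirt_conj_hp wirtL_zero.
rewrite add0r addr0 /cfact.
have -> : (\prod_j (count_mem j s)`! = \prod_j (al j)`!)%N by apply: eq_bigr => j _; rewrite count_midx.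
set f := (\prod_j _)%N; have f0 : (f%:R : C) != 0.
  by rewrite pnatr_eq0 -lt0n prodn_gt0 // => j; rewrite fact_gt0.
by rewrite -[X in _ / X]/(f%:R : C) mulrAC divff ?mul1r.
Qed.

End Coef.

(** * Composition of the formal series S with a curve *)

Section Comp.
Variable R : realType.
Local Notation C := (Cplx R).

Lemma poly_bigo0 (p : {poly C}) : bigo 0 (fun t : C => p.[t]).
Proof.
elim/poly_ind: p => [|p c IH].
  by apply: bigo_ext (bigo0 C 0) => t; rewrite horner0.
have h := bigoD (bigoM (bigo_le (leq0n 1) (@bigo_id R)) IH) (bigo_cst C c).
by apply: bigo_ext h => t; rewrite hornerMXaddC mulrC.
Qed.

Lemma poly_trunc (p : {poly C}) N : bigo N (fun t : C => p.[t] - \sum_(k < N) p`_k * t ^+ k).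
Proof.
have h := bigoM (@bigo_exp R N) (poly_bigo0 (drop_poly N p)); rewrite addn0 in h.
apply: bigo_ext h => t; rewrite -[in RHS](poly_take_drop N p) hornerD hornerM hornerXn.
rewrite (horner_coef_wide _ (size_take_poly N p)).
have -> : \sum_(i < N) (take_poly N p)`_i * t ^+ i =
   \sum_(k < N) (take_poly N p + drop_poly N p * 'X^N)`_k * t ^+ k.
  by apply: eq_bigr => k _; rewrite poly_take_drop coef_take_poly ltn_ord.
by ring.
Qed.

(** Reduces the Taylor coefficients of products and compositions to finding a polynomial that agrees
    to order N. *)
Lemma taylorc_poly r (f : C -> C) (p : {poly C}) N : 0 < r -> hol r f ->
  bigo N (fun t => f t - p.[t]) -> forall k, (k < N)%N -> taylorc f k = p`_k.
Proof.
move=> r0 hf H k kN; apply/eqP; rewrite -subr_eq0; apply/eqP; move: k kN.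
apply: (@poly_small R N (fun k => taylorc f k - p`_k)).
have h := bigoB (bigoD H (poly_trunc p N)) (hol_taylor N r0 hf).
apply: bigo_ext h => t; under [RHS]eq_bigr => k _ do rewrite mulrBl.
by rewrite sumrB; ring.
Qed.

Variable n : nat.
Local Notation V := 'rV[C]_n.

Variables (gh : C -> V) (r : R).
Hypotheses (r0 : 0 < r) (hg : forall j, hol r (fun t => gh t 0 j)) (g0 : gh 0 = 0).

Definition cpoly k (j : 'I_n) : {poly C} := \poly_(i < k.+1) taylorc (fun t => gh t 0 j) i.

Lemma curve_coord_bigo1 j : bigo 1 (fun t => gh t 0 j).
Proof.
apply: (hol_coef_bigo r0 (hg j)) => -[|//] _.
by rewrite taylorc0 g0 mxE.
Qed.

Lemma cpoly_bigo k j : bigo k.+1 (fun t => gh t 0 j - (cpoly k j).[t]).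
Proof.
by apply: bigo_ext (hol_taylor k.+1 r0 (hg j)) => t; rewrite horner_poly.
Qed.

Definition mpolyc k (u : seq 'I_n) : {poly C} := \prod_(j <- u) cpoly k j.

Lemma mon_bigo k u : bigo (size u) (fun t => mon u (gh t)) /\
  bigo k.+1 (fun t => mon u (gh t) - (mpolyc k u).[t]).
Proof.
elim: u => [|j u [IH1 IH2]].
  split; first by apply: bigo_ext (bigo_cst C 1) => t; rewrite /mon big_nil.
  by apply: bigo_ext (bigo0 C k.+1) => t; rewrite /mon /mpolyc !big_nil hornerC subrr.
split; first by apply: bigo_ext (bigoM (curve_coord_bigo1 j) IH1) => t; rewrite mon_cons.
have h1 := bigoM (cpoly_bigo k j) (bigo_le (leq0n _) IH1); rewrite addn0 in h1.
have h2 := bigoM (poly_bigo0 (cpoly k j)) IH2; rewrite add0n in h2.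
apply: bigo_ext (bigoD h1 h2) => t; rewrite mon_cons /mpolyc big_cons hornerM.
by rewrite -/(mpolyc k u); ring.
Qed.

(** Each coordinate of [gh] vanishes at 0, so a monomial of degree above k contributes nothing to
    t^k. This justifies the restriction |al| <= k in [compcoef]. *)
Lemma mpolyc_small k u : (k < size u)%N -> (mpolyc k u)`_k = 0.
Proof.
move=> ku; have [h1 h2] := mon_bigo k u.
have hm : hol r (fun t => mon u (gh t)) by apply: hol_mon.
rewrite -(taylorc_poly r0 hm h2 (ltnSn k)).
exact: (hol_bigo_coef r0 hm (bigo_le ku h1) (ltnSn k)).
Qed.

Lemma mpolyc_count k u : mpolyc k u = \prod_j (cpoly k j) ^+ (count_mem j u).
Proof.
elim: u => [|i u IH].
  by rewrite /mpolyc big_nil big1 // => j _; rewrite expr0.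
rewrite /mpolyc big_cons -/(mpolyc k u) IH (bigD1 i) //= [in RHS](bigD1 i) //= eqxx exprS mulrA.
by congr (_ * _); apply: eq_bigr => j ji; rewrite eq_sym (negbTE ji).
Qed.

Lemma taylorc_hp k l : taylorc (fun t => hp l (gh t)) k = \sum_(p <- l) p.1 * (mpolyc k p.2)`_k.
Proof.
have hh : hol r (fun t => hp l (gh t)) by apply: hol_hp.
rewrite (taylorc_poly (p := \sum_(p <- l) p.1 *: mpolyc k p.2) r0 hh _ (ltnSn k)).
  by rewrite coef_sum; apply: eq_bigr => p _; rewrite coefZ.
have : bigo k.+1 (fun t => \sum_(p <- l) p.1 * (mon p.2 (gh t) - (mpolyc k p.2).[t])).
  by apply: bigo_sum => p _; apply: bigoZ; have [] := mon_bigo k p.2.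
apply: bigo_ext => t; rewrite horner_sum /hp -sumrB; apply: eq_bigr => p _.
by rewrite hornerZ mulrBr.
Qed.

(** The sum over the entries of [l] is regrouped by exponent vectors: an entry of degree at most k
    has exactly one among the finite functions, and longer entries drop out by [mpolyc_small]. *)
Lemma compcoef_pure (U : set V) (F : V -> R) N l k : open U -> U 0 ->
  smooth_on U (liftC F) -> pure_at (liftC F) N l -> (k < N)%N ->
  taylorc (fun t => hp l (gh t)) k = compcoef F gh k.
Proof.
move=> oU U0 sF Hl kN; rewrite taylorc_hp /compcoef.
pose Q (al : {ffun 'I_n -> 'I_k.+1}) : C := (\prod_j (cpoly k j) ^+ (al j))`_k.
transitivity (\sum_(al : {ffun 'I_n -> 'I_k.+1} | (\sum_j (al j : nat) <= k)%N)
   \sum_(p <- l | perm_eq p.2 (midx (fun j => al j : nat))) p.1 * Q al); last first.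
  apply: eq_bigr => al alk; rewrite -mulr_suml; congr (_ * _).
  by rewrite (Scoef_pure oU U0 sF Hl) //; exact: leq_ltn_trans alk kN.
rewrite (exchange_big_dep xpredT) //=; apply: eq_bigr => p _.
have ek (al : {ffun 'I_n -> 'I_k.+1}) :
   perm_eq p.2 (midx (fun j => al j : nat)) -> forall j, count_mem j p.2 = al j.
  by move=> /permP h j; rewrite h count_midx.
have [pk|pk] := leqP (size p.2) k; last first.
  rewrite mpolyc_small // mulr0 big1 // => al /andP [alk /perm_size].
  by rewrite size_midx => h; move: alk; rewrite -h leqNgt pk.
have cb j : (count_mem j p.2 < k.+1)%N by rewrite ltnS (leq_trans (count_size _ _)).
pose al0 : {ffun 'I_n -> 'I_k.+1} := [ffun j => Ordinal (cb j)].
have E0 : perm_eq p.2 (midx (fun j => al0 j : nat)).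
  by apply/allP => j _ /=; rewrite count_midx ffunE.
have S0 : (\sum_j (al0 j : nat) = size p.2)%N by rewrite (perm_size E0) size_midx.
rewrite (bigD1 al0) /=; last by rewrite S0 pk E0.
rewrite big1 ?addr0; last first.
  move=> al /andP [/andP [_ /ek h]] /eqP []; apply/ffunP => j; apply/val_inj.
  by rewrite ffunE /= h.
have E : mpolyc k p.2 = \prod_j (cpoly k j) ^+ (al0 j).
  by rewrite mpolyc_count; apply: eq_bigr => j _; rewrite ffunE.
by rewrite E.
Qed.

End Comp.

(** * Formal power series over the algebra generated by a curve *)

Section Formal.
Variable R : realType.
Local Notation C := (Cplx R).
Local Notation fps := (nat -> C).

Definition cvl (a b : fps) : fps := fun k => \sum_(i < k.+1) a i * b (k - i)%N.
Definition ord_ge (a : fps) N := forall k, (k < N)%N -> a k = 0.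
Definition addf (a b : fps) : fps := fun k => a k + b k.
Definition scalef (c : C) (a : fps) : fps := fun k => c * a k.

Lemma cvlD x a b : cvl x (addf a b) = addf (cvl x a) (cvl x b).
Proof.
by apply: funext => k; rewrite /cvl /addf -big_split; apply: eq_bigr => i _; rewrite mulrDr.
Qed.
Lemma cvlZ x c a : cvl x (scalef c a) = scalef c (cvl x a).
Proof.
by apply: funext => k; rewrite /cvl /scalef mulr_sumr; apply: eq_bigr => i _; rewrite mulrCA.
Qed.
Definition zerof : fps := fun=> 0.
Lemma cvl0 x : cvl x zerof = zerof.
Proof. by apply: funext => k; apply: big1 => i _; rewrite mulr0. Qed.

(* Weighted l^1 norm on partial sums; multiplication by a unit close to a constant is
   invertible for it without loss of radius. *)
Definition nbd (rho : R) (a : fps) (mu : R) := forall N, \sum_(k < N) rn (a k) * rho ^+ k <= mu.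

Lemma nbd_coef rho a mu k : 0 < rho -> nbd rho a mu -> rn (a k) <= mu / rho ^+ k.
Proof.
move=> r0 /(_ k.+1); rewrite big_ord_recr /= => h; rewrite ler_pdivlMr ?exprn_gt0 //.
apply: le_trans h; rewrite lerDr; apply: sumr_ge0 => i _.
by rewrite mulr_ge0 ?rn_ge0 // exprn_ge0 // ltW.
Qed.

Lemma nbd_ge0 rho a mu : nbd rho a mu -> 0 <= mu.
Proof. by move=> /(_ 0%N); rewrite big_ord0. Qed.

Lemma nbd_add rho a b mu nu : 0 < rho -> nbd rho a mu -> nbd rho b nu -> nbd rho (addf a b) (mu + nu).
Proof.
move=> r0 ha hb N; apply: le_trans (lerD (ha N) (hb N)); rewrite -big_split /=.
by apply: ler_sum => k _; rewrite -mulrDl ler_wpM2r ?rnD // exprn_ge0 // ltW.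
Qed.
Lemma nbd_scale rho c a mu : nbd rho a mu -> nbd rho (scalef c a) (rn c * mu).
Proof.
move=> ha N; apply: le_trans (ler_wpM2l (rn_ge0 c) (ha N)); rewrite mulr_sumr.
by apply: ler_sum => k _; rewrite /scalef rnM mulrA.
Qed.

Lemma nbd_geo rho s M a : 0 < rho -> 0 <= s -> s * rho <= 2^-1 -> (forall k, rn (a k) <= M * s ^+ k) ->
  nbd rho a (2 * M).
Proof.
move=> r0 s0 sr Ha N.
have M0 : 0 <= M by have := Ha 0%N; rewrite expr0 mulr1; apply: le_trans; exact: rn_ge0.
apply: (@le_trans _ _ (\sum_(k < N) M * 2^-1 ^+ k)).
  apply: ler_sum => k _; apply: le_trans (ler_wpM2r _ (Ha k)) _; first by rewrite exprn_ge0 // ltW.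
  rewrite -mulrA -exprMn ler_wpM2l // lerXn2r ?nnegrE ?mulr_ge0 ?(ltW r0) //.
have h q : \sum_(k < q) (2^-1 : R) ^+ k <= 2 - 2^-1 ^+ q * 2.
  elim: q => [|q IH]; first by rewrite big_ord0 expr0; lra.
  by rewrite big_ord_recr /= exprS; lra.
rewrite -mulr_sumr mulrC ler_wpM2r //; apply: le_trans (h N) _.
have : (0 : R) <= 2^-1 ^+ N by rewrite exprn_ge0 // invr_ge0.
lra.
Qed.

Variables (x : fps) (d : nat).
Hypothesis xd : ord_ge x d.
Local Notation T := (cvl x).

Lemma cvl_shift a k : T a (k + d)%N = \sum_(i < k.+1) x (d + i)%N * a (k - i)%N.
Proof.
rewrite /cvl -(big_mkord xpredT (fun i => x i * a (k + d - i)%N)).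
rewrite (big_cat_nat (n := d)) //=; last by rewrite leqW // leq_addl.
rewrite big_nat big1 ?add0r; last by move=> i /andP [_ /xd ->]; rewrite mul0r.
rewrite -{1}[d]add0n big_addn big_mkord (_ : ((k + d).+1 - d)%N = k.+1); last by lia.
apply: eq_bigr => i _; rewrite addnC; congr (_ * a _); have := ltn_ord i; lia.
Qed.

Lemma cvl_low a k : (k < d)%N -> T a k = 0.
Proof.
move=> kd; apply: big1 => i _; rewrite xd ?mul0r //.
by apply: leq_ltn_trans kd; rewrite -ltnS.
Qed.

Lemma cvl_ord a N : ord_ge a N -> ord_ge (T a) (N + d)%N.
Proof.
move=> aN k kN; have [kd|kd] := ltnP k d; first exact: cvl_low.
rewrite -(subnK kd) cvl_shift big1 // => i _; rewrite aN ?mulr0 //; have := ltn_ord i; lia.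
Qed.

Lemma cvl_lead a N : ord_ge a N -> T a (N + d)%N = x d * a N.
Proof.
move=> aN; rewrite cvl_shift big_ord_recl addn0 subn0 big1 ?addr0 // => i _.
by rewrite lift0 aN ?mulr0 //; have := ltn_ord i; lia.
Qed.

Hypothesis xdn : x d != 0.

(** By [cvl_lead] the lowest coefficient of [a] reappears in the product, multiplied by the nonzero
    [x d]. *)
Lemma cvl_inj a N : ord_ge (T a) (N + d)%N -> ord_ge a N.
Proof.
move=> H k; elim/ltn_ind: k => k IH kN.
have := cvl_lead (fun i ik => IH i ik (ltn_trans ik kN)).
rewrite H ?ltn_add2r // => /esym /eqP; rewrite mulf_eq0 (negbTE xdn) => /eqP.
by [].
Qed.

(* [divl f k] lists the first [k] coefficients of the quotient of [f] by [x]. *)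
Fixpoint divl (f : fps) k : seq C := if k is k'.+1 then
  rcons (divl f k') ((f (k' + d)%N - \sum_(i < k') x (d + (k' - i))%N * (divl f k')`_i) / x d) else [::].
Definition divf (f : fps) : fps := fun k => (divl f k.+1)`_k.

Lemma size_divl f k : size (divl f k) = k.
Proof. by elim: k => [//|k IH]; rewrite /= size_rcons IH. Qed.

Lemma divl_nth f k m : (k < m)%N -> (divl f m)`_k = divf f k.
Proof.
elim: m => [//|m IH]; rewrite ltnS leq_eqVlt => /orP [/eqP -> //|km].
by rewrite /= nth_rcons size_divl km IH.
Qed.

Lemma divf_eq f k : x d * divf f k = f (k + d)%N - \sum_(i < k) x (d + (k - i))%N * divf f i.
Proof.
rewrite {1}/divf /= nth_rcons size_divl ltnn eqxx mulrC mulfVK //; congr (_ - _).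
by apply: eq_bigr => i _; rewrite divl_nth.
Qed.

Lemma cvl_divf f : ord_ge f d -> T (divf f) = f.
Proof.
move=> fd; apply: funext => k; have [kd|kd] := ltnP k d; first by rewrite cvl_low // fd.
rewrite -(subnK kd); move: (k - d)%N => {kd}k.
rewrite cvl_shift big_ord_recl addn0 subn0 divf_eq.
rewrite (reindex_inj rev_ord_inj) /=.
rewrite -[RHS]addr0 -addrA; congr (_ + _); apply/eqP; rewrite addrC subr_eq0; apply/eqP.
apply: eq_bigr => i _; have ik := ltn_ord i; rewrite /bump /= add1n.
by congr (x _ * divf f _); lia.
Qed.

(** The bound on the tail says that [x] is its leading term times a unit within 1/2 of 1 in the
    weighted norm. The convolution with that tail then takes at most half of the left-hand side, so
    division keeps the radius rho and costs a factor independent of [f]. *)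
Lemma divf_nbd rho f mu : 0 < rho -> ord_ge f d ->
  (forall N, \sum_(i < N) rn (x (d + i.+1)%N) * rho ^+ i.+1 <= rn (x d) / 2) ->
  nbd rho f mu -> nbd rho (divf f) (2 / rn (x d) / rho ^+ d * mu).
Proof.
move=> r0 fd Hx Hf N.
have xp : 0 < rn (x d) by rewrite rn_gt0.
have rk k : 0 <= rho ^+ k by rewrite exprn_ge0 // ltW.
set S := \sum_(k < N) _.
have S0 : 0 <= S by apply: sumr_ge0 => k _; rewrite mulr_ge0 ?rn_ge0.
have A : rn (x d) * S <= mu / rho ^+ d + rn (x d) / 2 * S.
  rewrite mulr_sumr.
  apply: (@le_trans _ _ (\sum_(k < N) (rn (f (k + d)%N) * rho ^+ k +
     \sum_(i < k) (rn (x (d + (k - i))%N) * rho ^+ (k - i)) * (rn (divf f i) * rho ^+ i)))).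
    apply: ler_sum => k _; rewrite mulrA -rnM divf_eq.
    apply: le_trans (ler_wpM2r (rk k) (rnB _ _)) _; rewrite mulrDl lerD2l.
    apply: le_trans (ler_wpM2r (rk k) (rn_sum _ _ _)) _; rewrite mulr_suml.
    apply: ler_sum => i _; rewrite rnM le_eqVlt; apply/orP; left; apply/eqP.
    have -> : rho ^+ k = rho ^+ (k - i) * rho ^+ i by rewrite -exprD subnK // ltnW.
    by ring.
  rewrite big_split /=; apply: lerD.
    rewrite ler_pdivlMr ?exprn_gt0 // mulr_suml; apply: le_trans (Hf (N + d)%N).
    rewrite -(big_mkord xpredT (fun k => rn (f k) * rho ^+ k)) (big_cat_nat (n := d)) //= ?leq_addl //.
    have -> : \sum_(d <= i < N + d) rn (f i) * rho ^+ i = \sum_(i < N) rn (f (i + d)%N) * rho ^+ (i + d).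
      by rewrite -{1}[d]add0n big_addn addnK big_mkord.
    apply: ler_wpDl; first by apply: sumr_ge0 => i _; rewrite mulr_ge0 ?rn_ge0.
    by apply: ler_sum => i _; rewrite -mulrA -exprD.
  (* For k at most N the inner sum is extended to all i < N under a condition, ready for exchanging
     the two sums; the second alternative covers the remaining k. *)
  have step (k : nat) : \sum_(i < k) (rn (x (d + (k - i))%N) * rho ^+ (k - i)) * (rn (divf f i) * rho ^+ i) =
     \sum_(i < N | (i < k)%N) (rn (x (d + (k - i))%N) * rho ^+ (k - i)) * (rn (divf f i) * rho ^+ i) \/ (N < k)%N.
    have [Nk|kN] := ltnP N k; [by right|left].
    by rewrite (big_ord_widen N (fun i => (rn (x (d + (k - i))%N) * rho ^+ (k - i)) * (rn (divf f i) * rho ^+ i))).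
  under eq_bigr => k _.
    have -> : \sum_(i < k) (rn (x (d + (k - i))%N) * rho ^+ (k - i)) * (rn (divf f i) * rho ^+ i) =
     \sum_(i < N | (i < k)%N) (rn (x (d + (k - i))%N) * rho ^+ (k - i)) * (rn (divf f i) * rho ^+ i).
      by have [//|] := step k; rewrite ltnNge ltnW.
    over.
  rewrite (exchange_big_dep xpredT) //= /S mulr_sumr; apply: ler_sum => i _.
  rewrite -mulr_suml ler_wpM2r ?mulr_ge0 ?rn_ge0 //.
  apply: le_trans (Hx (N - i.+1)%N).
  rewrite -(big_mkord (fun k => i < k)%N (fun k => rn (x (d + (k - i))%N) * rho ^+ (k - i))).
  rewrite (big_cat_nat (n := i.+1)) //=.
  rewrite big_nat_cond big1 ?add0r; last by move=> k /andP [/andP [_ h1] h2]; lia.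
  rewrite -{1}[i.+1]add0n big_addn big_mkord big_mkcond.
  apply: ler_sum => k _; rewrite ifT; last by lia.
  by rewrite (_ : (k + i.+1 - i)%N = k.+1); last by lia.
have B : S <= 2 / rn (x d) * (mu / rho ^+ d).
  rewrite mulrAC ler_pdivlMr //; move: (mu / rho ^+ d) A => m A; lra.
by apply: le_trans B _; rewrite le_eqVlt; apply/orP; left; apply/eqP; ring.
Qed.

End Formal.

(** * Convergent expansions of elements of the formal closure *)

Section Artin.
Variable R : realType.
Local Notation C := (Cplx R).
Local Notation fps := (nat -> C).
Variables (x : fps) (d : nat).
Hypotheses (d0 : (0 < d)%N) (xd : ord_ge x d) (xdn : x d != 0).
Local Notation T := (cvl x).
Variables (B : set fps) (s : R).
Hypotheses (s0 : 0 < s) (xs : exists M, forall k, rn (x k) <= M * s ^+ k).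
Hypotheses (B0 : B (zerof R)) (BD : forall a b, B a -> B b -> B (addf a b)).
Hypotheses (BZ : forall c a, B a -> B (scalef c a)) (BT : forall a, B a -> B (T a)).
Hypothesis Bs : forall a, B a -> exists M, forall k, rn (a k) <= M * s ^+ k.

(** Membership in the t-adic closure of [B]. *)
Definition fcl (f : fps) := forall N, exists2 g, B g & forall k, (k < N)%N -> f k = g k.
Definition exo (a : fps) e := ord_ge a e /\ a e != 0.

Lemma ord_geZ c (a : fps) N : ord_ge a N -> ord_ge (scalef c a) N.
Proof. by move=> ha k kN; rewrite /scalef ha // mulr0. Qed.

Lemma fclD a b : fcl a -> fcl b -> fcl (addf a b).
Proof.
move=> ha hb N; have [g Bg Hg] := ha N; have [h Bh Hh] := hb N.
by exists (addf g h); [exact: BD | move=> k kN; rewrite /addf Hg // Hh].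
Qed.
Lemma fclZ c a : fcl a -> fcl (scalef c a).
Proof.
move=> ha N; have [g Bg Hg] := ha N.
by exists (scalef c g); [exact: BZ | move=> k kN; rewrite /scalef Hg].
Qed.

Lemma exo_iter q a e : exo a e -> exo (iter q T a) (e + q * d).
Proof.
move=> h; elim: q => [|q [IH1 IH2]]; first by rewrite addn0.
have E : (e + q.+1 * d = e + q * d + d)%N by lia.
rewrite /= E; split; first exact: (cvl_ord xd IH1).
by rewrite (cvl_lead xd IH1) mulf_neq0.
Qed.

Lemma B_iter q a : B a -> B (iter q T a).
Proof. by move=> h; elim: q => [//|q IH]; exact: BT. Qed.

(* Once some element of [B] has exact order e, all orders e + q d occur: the
   orders of [B] are known from finitely many elements, one per class mod d. *)
Lemma order_bound : exists2 L, (d <= L)%N & forall N a, (L <= N)%N -> B a -> exo a N ->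
  exists2 b, B b & exo b (N - d).
Proof.
(* For each residue class mod d, an order attained in [B] if there is one, and 0 otherwise. *)
have /choice [e He] : forall i : 'I_d, exists e, (exists a e', [/\ B a, exo a e' & (e' %% d = i)%N]) ->
   exists a, [/\ B a, exo a e & (e %% d = i)%N].
  move=> i; have [[a [e [h1 h2 h3]]]|h] := pselect (exists a e', [/\ B a, exo a e' & (e' %% d = i)%N]).
    by exists e => _; exists a.
  by exists 0%N.
exists (\max_i e i + d)%N; first exact: leq_addl.
move=> N a LN Ba ea; have [b [Bb eb em]] := He (Ordinal (ltn_pmod N d0)) (ex_intro _ a (ex_intro _ N (And3 Ba ea erefl))).
set i := Ordinal _ in eb em; have ei : (e i <= \max_i e i)%N by exact: leq_bigmax.
have dN : (d %| N - d - e i)%N.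
  rewrite -eqn_mod_dvd; last by lia.
  by rewrite -(modnDr (N - d)) subnK ?em //; lia.
exists (iter ((N - d - e i) %/ d) T b); first exact: B_iter.
have := exo_iter ((N - d - e i) %/ d) eb; rewrite divnK //.
by rewrite (_ : (e i + (N - d - e i) = N - d)%N); last by lia.
Qed.

Section WithL.
Variable L : nat.
Hypothesis dL : (d <= L)%N.
Hypothesis HL : forall N a, (L <= N)%N -> B a -> exo a N -> exists2 b, B b & exo b (N - d).

Definition subT f g := addf f (scalef (-1) (T g)).

(** Successive cancellation: whenever the remainder f - x g has exact order N >= L, some element of
    [B] has order N - d, and a multiple of it added to [g] removes the leading coefficient. *)
Lemma B_div_approx N f : B f -> ord_ge f L -> exists2 g, B g & ord_ge (subT f g) N.
Proof.
move=> Bf fL; elim: N => [|N [g Bg Hg]]; first by exists (zerof R).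
have Bfg : B (subT f g) by apply: BD => //; apply: BZ; exact: BT.
have [NL|LN] := ltnP N L.
  exists (zerof R) => // k kN; rewrite /subT /addf /scalef cvl0 /zerof mulr0 addr0.
  by apply: fL; lia.
have [z|nz] := eqVneq (subT f g N) 0.
  by exists g => // k; rewrite ltnS leq_eqVlt => /orP [/eqP ->|/Hg].
have [b Bb [b1 b2]] := HL LN Bfg (conj Hg nz).
have E : (N - d + d = N)%N by rewrite subnK // (leq_trans dL).
have t1 := cvl_ord xd b1; have t2 := cvl_lead xd b1; rewrite E in t1 t2.
pose c := subT f g N / (x d * b (N - d)%N).
exists (addf g (scalef c b)); first by apply: BD => //; exact: BZ.
have E2 k : subT f (addf g (scalef c b)) k = subT f g k - c * T b k.
  by rewrite /subT cvlD cvlZ /addf /scalef; ring.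
move=> k; rewrite E2 ltnS leq_eqVlt => /orP [/eqP ->|kN].
  by rewrite t2 /c divfK ?subrr // mulf_neq0.
by rewrite Hg // t1 // mulr0 subr0.
Qed.

(** The approximate quotients in [B] agree with the true one to high order after multiplication by
    [x], hence by [cvl_inj] also before it. *)
Lemma fcl_divf f : fcl f -> ord_ge f L -> fcl (divf x d f).
Proof.
move=> cf fL N; have [g Bg Hg] := cf (N + d + L)%N.
have gL : ord_ge g L by move=> k kL; rewrite -Hg ?fL //; lia.
have [h Bh Hh] := B_div_approx (N + d) Bg gL.
exists h => // k kN; apply/eqP; rewrite -subr_eq0; apply/eqP.
have key : ord_ge (addf (divf x d f) (scalef (-1) h)) N.
  apply: (cvl_inj xd xdn); rewrite cvlD cvlZ cvl_divf //; last by move=> i id; apply: fL; lia.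
  move=> i iN; have := Hh i iN; rewrite /subT /addf Hg //; lia.
by have := key k kN; rewrite /addf /scalef mulN1r.
Qed.

(** One normalised element for each order attained in [B], and 0 at the gaps. *)
Variable p : nat -> fps.
Hypothesis Hp : forall e, [/\ B (p e), ord_ge (p e) e &
  p e e = 1 \/ (p e = zerof R /\ forall a, B a -> ord_ge a e -> a e = 0)].

Definition lc (c : nat -> C) E : fps := fun k => \sum_(e < E) c e * p e k.

Variable rho : R.
Hypotheses (rho0 : 0 < rho) (rhos : s * rho <= 2^-1).

Lemma eliminate E : exists2 K, 0 <= K & forall f, fcl f -> exists c,
  [/\ fcl (addf f (scalef (-1) (lc c E))), ord_ge (addf f (scalef (-1) (lc c E))) E &
   forall mu, nbd rho f mu -> nbd rho (addf f (scalef (-1) (lc c E))) (K * mu) /\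
     forall e, (e < E)%N -> rn (c e) <= K * mu].
Proof.
elim: E => [|E [K K0 IH]].
  exists 1 => // f cf; exists (fun=> 0).
  have -> : addf f (scalef (-1) (lc (fun=> 0) 0)) = f.
    by apply: funext => k; rewrite /addf /scalef /lc big_ord0 mulr0 addr0.
  by split=> // mu; rewrite mul1r.
have [Bp op pe] := Hp E; have [Mp HMp] := Bs Bp.
have np := nbd_geo rho0 (ltW s0) rhos HMp; have np0 := nbd_ge0 np.
have rE : 0 < rho ^+ E by rewrite exprn_gt0.
exists (K + K / rho ^+ E * (2 * Mp) + K / rho ^+ E).
  have h : 0 <= K / rho ^+ E by rewrite divr_ge0 // ltW.
  by rewrite addr_ge0 // addr_ge0 // (mulr_ge0 h np0).
move=> f /IH [c [h1 h2 h3]]; set f' := addf f _ in h1 h2 h3.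
pose c' e := if e == E then f' E else c e.
have E1 : addf f (scalef (-1) (lc c' E.+1)) = addf f' (scalef (- f' E) (p E)).
  apply: funext => k; rewrite {1}/addf {1}/scalef /lc big_ord_recr /= {2}/c' eqxx.
  rewrite (eq_bigr (fun e : 'I_E => c e * p e k)); last first.
    by move=> e _; rewrite /c' (ltn_eqF (ltn_ord e)).
  by rewrite -/(lc c E k) [RHS]/addf /f' /addf /scalef; ring.
exists c'; rewrite E1; split.
- apply: fclD => //; apply: fclZ => N; by exists (p E).
- move=> k; rewrite ltnS leq_eqVlt => /orP [/eqP ->|kE]; last first.
    by rewrite /addf /scalef h2 // op // mulr0 addr0.
  rewrite /addf /scalef; case: pe => [->|[-> Ha]]; first by rewrite mulr1 subrr.
  rewrite /zerof mulr0 addr0; have [g Bg Hg] := h1 E.+1.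
  by rewrite Hg //; apply: Ha => // i iE; rewrite -Hg ?h2 // ltnW.
- move=> mu /h3 [n1 n2]; have cE := nbd_coef E rho0 n1.
  have mu0 := nbd_ge0 n1; split.
    move=> N; apply: le_trans (nbd_add rho0 n1 (nbd_scale _ np) N) _.
    rewrite rnN; have := ler_wpM2r np0 cE.
    have : 0 <= K * mu / rho ^+ E by apply: le_trans cE; exact: rn_ge0.
    have -> : (K + K / rho ^+ E * (2 * Mp) + K / rho ^+ E) * mu =
       K * mu + K * mu / rho ^+ E * (2 * Mp) + K * mu / rho ^+ E by ring.
    move: (_ / rho ^+ E) => y y0 h; lra.
  have -> : (K + K / rho ^+ E * (2 * Mp) + K / rho ^+ E) * mu =
       K * mu + K * mu / rho ^+ E * (2 * Mp) + K * mu / rho ^+ E by ring.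
  have y0 : 0 <= K * mu / rho ^+ E by apply: le_trans cE; exact: rn_ge0.
  have y1 := mulr_ge0 y0 np0.
  move=> e; rewrite ltnS leq_eqVlt /c' => /orP [/eqP ->|eE].
    by rewrite eqxx; apply: le_trans cE _; lra.
  by rewrite (ltn_eqF eE); have := n2 e eE; lra.
Qed.

Lemma lc_iter m c E : iter m T (lc c E) = fun k => \sum_(e < E) c e * iter m T (p e) k.
Proof.
elim: m => [//|m IH]; apply: funext => k; rewrite [LHS]/= IH /cvl.
under eq_bigr => i _ do rewrite mulr_sumr.
rewrite exchange_big; apply: eq_bigr => e _ /=; rewrite /cvl mulr_sumr.
by apply: eq_bigr => i _; rewrite mulrCA.
Qed.

Lemma iterTD m a b : iter m T (addf a b) = addf (iter m T a) (iter m T b).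
Proof. by elim: m => [//|m IH]; rewrite /= IH cvlD. Qed.

Hypothesis Hrho : forall N, \sum_(i < N) rn (x (d + i.+1)%N) * rho ^+ i.+1 <= rn (x d) / 2.

(** The norms of the successive quotients grow by the fixed factor D K, so the coefficients attached
    to each [p e] form a convergent series in x. After N rounds the remainder is a multiple of x^N,
    of order at least N d >= N, which gives the identity coefficientwise. *)
Lemma expansion f mu : fcl f -> nbd rho f mu -> exists c : nat -> nat -> C, exists M q : R,
  [/\ 0 <= q, forall e m, (e < L)%N -> rn (c m e) <= M * q ^+ m &
   forall N k, (k < N)%N -> f k = \sum_(m < N) \sum_(e < L) c m e * iter m T (p e) k].
Proof.
move=> cf nf; have [K K0 HK] := eliminate L.
pose D := 2 / rn (x d) / rho ^+ d.
have D0 : 0 <= D by rewrite !divr_ge0 ?rn_ge0 // exprn_ge0 // ltW.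
(* One round of elimination and division as a function on all series; outside the closure its value
   is arbitrary. *)
have /choice [st Hst] : forall g : fps, exists y : (nat -> C) * fps, fcl g ->
  [/\ fcl y.2, g = addf (lc y.1 L) (T y.2) &
   forall nu, nbd rho g nu -> nbd rho y.2 (D * K * nu) /\ forall e, (e < L)%N -> rn (y.1 e) <= K * nu].
  move=> g; have [cg|?] := pselect (fcl g); last by exists (fun=> 0, zerof R).
  have [c [h1 h2 h3]] := HK g cg; set g' := addf g _ in h1 h2 h3.
  have gd : ord_ge g' d by move=> k kd; apply: h2; lia.
  exists (c, divf x d g') => _; split=> /=.
  - exact: fcl_divf.
  - by rewrite cvl_divf // /g'; apply: funext => k; rewrite /addf /scalef; ring.
  - move=> nu /h3 [n1 n2]; split=> //.
    by have := divf_nbd xdn rho0 gd Hrho n1; rewrite mulrA.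
pose fs m := iter m (fun g => (st g).2) f.
have cfs m : fcl (fs m) by elim: m => [//|m IH] /=; have [] := Hst _ IH.
have nfs m : nbd rho (fs m) ((D * K) ^+ m * mu).
  elim: m => [|m IH]; first by rewrite expr0 mul1r.
  by have [_ _ /(_ _ IH) [h _]] := Hst _ (cfs m); rewrite exprS -mulrA.
exists (fun m => (st (fs m)).1), (K * mu), (D * K); split.
- by rewrite mulr_ge0.
- move=> e m eL; have [_ _ /(_ _ (nfs m)) [_ /(_ e eL)]] := Hst _ (cfs m).
  by move/le_trans; apply; rewrite le_eqVlt; apply/orP; left; apply/eqP; ring.
have key N k : f k = \sum_(m < N) \sum_(e < L) (st (fs m)).1 e * iter m T (p e) k + iter N T (fs N) k.
  elim: N => [|N IH]; first by rewrite big_ord0 add0r.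
  rewrite IH big_ord_recr /= -addrA; congr (_ + _).
  have [_ E _] := Hst _ (cfs N); rewrite {1}E iterTD {1}/addf lc_iter; congr (_ + _).
  by rewrite -iterSr.
move=> N k kN; rewrite (key N); suff -> : iter N T (fs N) k = 0 by rewrite addr0.
have oN m : ord_ge (iter m T (fs N)) (m * d).
  elim: m => [//|m IH]; rewrite iterS mulSn addnC; exact: (cvl_ord xd IH).
by apply: oN; nia.
Qed.

End WithL.

(** The rate [s] is common to [x], to [f] and to all elements of [B], so a single radius rho has
    finite weighted norms for all of them and can still be taken small enough for division by
    [x]. *)
Lemma artin_rees f M : fcl f -> (forall k, rn (f k) <= M * s ^+ k) ->
  exists (L : nat) (p : nat -> fps) (c : nat -> nat -> C) (M q : R),
  [/\ 0 <= q, forall e, B (p e), forall e m, (e < L)%N -> rn (c m e) <= M * q ^+ m &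
   forall N k, (k < N)%N -> f k = \sum_(m < N) \sum_(e < L) c m e * iter m T (p e) k].
Proof.
move=> cf Hf; have [L dL HL] := order_bound.
have /choice [p Hp] : forall e, exists p, [/\ B p, ord_ge p e &
  p e = 1 \/ (p = zerof R /\ forall a, B a -> ord_ge a e -> a e = 0)].
  move=> e; have [[a [Ba oa na]]|h] := pselect (exists a, [/\ B a, ord_ge a e & a e != 0]).
    exists (scalef (a e)^-1 a); split; [exact: BZ | exact: ord_geZ |left].
    by rewrite /scalef mulVf.
  exists (zerof R); split=> //; right; split=> // a Ba oa.
  by apply/eqP/negPn/negP => na; apply: h; exists a.
have [Mx HMx] := xs; have xp : 0 < rn (x d) by rewrite rn_gt0.
have Mx0 : 0 <= Mx by have := HMx 0%N; rewrite expr0 mulr1; apply: le_trans; exact: rn_ge0.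
(* With rho = 1 / (s W), the summand 2 gives s rho <= 1/2, and the other summand makes the tail of
   [x] at most half its leading coefficient, as [divf_nbd] requires. *)
pose W := 4 * (Mx * s ^+ d) / rn (x d) + 2.
have W2 : 0 <= 4 * (Mx * s ^+ d) / rn (x d).
  by rewrite divr_ge0 ?rn_ge0 // mulr_ge0 // mulr_ge0 // exprn_ge0 // ltW.
have W0 : 0 < W by rewrite /W; lra.
pose rho := (s * W)^-1; have rho0 : 0 < rho by rewrite invr_gt0 mulr_gt0.
have sr : s * rho = W^-1 by rewrite /rho invfM mulrA divff ?mul1r // gt_eqF.
have sr2 : s * rho <= 2^-1 by rewrite sr lef_pV2 ?posrE // /W; lra.
have Hrho N : \sum_(i < N) rn (x (d + i.+1)%N) * rho ^+ i.+1 <= rn (x d) / 2.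
  have hi i : rn (x (d + i.+1)%N) * rho <= (Mx * s ^+ d * W^-1) * s ^+ i.
    apply: le_trans (ler_wpM2r (ltW rho0) (HMx _)) _; rewrite -sr exprD exprS.
    by rewrite le_eqVlt; apply/orP; left; apply/eqP; ring.
  have := @nbd_geo R rho s (Mx * s ^+ d * W^-1) (fun i => x (d + i.+1)%N * rho%:C) rho0 (ltW s0) sr2.
  move=> /(_ _ N); rewrite -/(nbd _ _ _) => h.
  have {}h := h ltac:(by move=> k; rewrite rnM rn_real (gtr0_norm rho0)).
  apply: (@le_trans _ _ (2 * (Mx * s ^+ d * W^-1))).
    apply: le_trans h; apply: ler_sum => i _; rewrite rnM rn_real (gtr0_norm rho0) exprS.
    by rewrite mulrA.
  rewrite mulrA ler_pdivrMr // mulrAC mulrC ler_pdivlMr // /W.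
  have : rn (x d) * (4 * (Mx * s ^+ d) / rn (x d)) = 4 * (Mx * s ^+ d).
    by rewrite mulrC divfK // gt_eqF.
  by move=> e4; have := ltW xp; lra.
have [c [M' [q [h1 h2 h3]]]] := expansion dL HL Hp rho0 sr2 Hrho cf (nbd_geo rho0 (ltW s0) sr2 Hf).
by exists L, p, c, M', q; split=> // e; have [] := Hp e.
Qed.

End Artin.

(** * A holomorphic function with prescribed Taylor series along a curve *)

Section Approx.
Variable R : realType.
Local Notation C := (Cplx R).

Lemma taylorc_mul r (f g : C -> C) : 0 < r -> hol r f -> hol r g ->
  taylorc (fun t => f t * g t) = cvl (taylorc f) (taylorc g).
Proof.
move=> r0 hf hg; apply: funext => k.
pose P (h : C -> C) : {poly C} := \poly_(i < k.+1) taylorc h i.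
have HP h : hol r h -> bigo k.+1 (fun t => h t - (P h).[t]).
  by move=> hh; apply: bigo_ext (hol_taylor k.+1 r0 hh) => t; rewrite horner_poly.
rewrite (taylorc_poly (p := P f * P g) r0 (holM hf hg) _ (ltnSn k)).
  rewrite coefM /cvl; apply: eq_bigr => i _.
  by rewrite !coef_poly ltn_ord ltnS leq_subr.
have b0 h : hol r h -> bigo 0 h.
  by move=> hh; apply: hol_coef_bigo hh _.
have h1 := bigoM (HP f hf) (b0 g hg); rewrite addn0 in h1.
have h2 := bigoM (poly_bigo0 (P f)) (HP g hg); rewrite add0n in h2.
by apply: bigo_ext (bigoD h1 h2) => t; rewrite hornerM; ring.
Qed.

Lemma taylorc_sum r (I : eqType) (s : seq I) (f : I -> C -> C) k : 0 < r -> (forall i, hol r (f i)) ->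
  taylorc (fun t => \sum_(i <- s) f i t) k = \sum_(i <- s) taylorc (f i) k.
Proof.
move=> r0 hf.
rewrite (taylorc_poly (p := \sum_(i <- s) \poly_(j < k.+1) taylorc (f i) j) r0 (hol_sum s hf) _ (ltnSn k)).
  by rewrite coef_sum; apply: eq_bigr => i _; rewrite coef_poly ltnSn.
have : bigo k.+1 (fun t => \sum_(i <- s) (f i t - (\poly_(j < k.+1) taylorc (f i) j).[t])).
  apply: bigo_sum => i _; apply: bigo_ext (hol_taylor k.+1 r0 (hf i)) => t.
  by rewrite horner_poly.
by apply: bigo_ext => t; rewrite sumrB horner_sum.
Qed.

Lemma taylorcZ r (f : C -> C) c : 0 < r -> hol r f -> taylorc (fun t => c * f t) = scalef c (taylorc f).
Proof.
move=> r0 hf; apply: funext => k.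
rewrite (taylorc_poly (p := c *: \poly_(j < k.+1) taylorc f j) r0 (holM (@hol_cst R r c) hf) _ (ltnSn k)).
  by rewrite coefZ coef_poly ltnSn.
apply: bigo_ext (bigoZ c (hol_taylor k.+1 r0 hf)) => t.
by rewrite hornerZ horner_poly mulrBr.
Qed.

Lemma taylorcD r (f g : C -> C) : 0 < r -> hol r f -> hol r g ->
  taylorc (fun t => f t + g t) = addf (taylorc f) (taylorc g).
Proof.
move=> r0 hf hg; apply: funext => k.
have := @taylorc_sum r _ [:: true; false] (fun b => if b then f else g) k r0 (fun b => if b as b return hol r (if b then f else g) then hf else hg).
rewrite !big_cons big_nil addr0 /= /addf => <-; congr (taylorc _ k).
by apply: funext => t; rewrite !big_cons big_nil addr0.
Qed.

Variable n : nat.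
Local Notation V := 'rV[C]_n.

Lemma coord_differentiable (j : 'I_n) (z : V) : differentiable (fun y : V => y 0 j : C) z.
Proof. exact: differentiable_coord. Qed.

Lemma hol_coord r (g : C -> V) j : (forall t, rn t < r -> differentiable g t) -> hol r (fun t => g t 0 j).
Proof.
move=> H t tr; apply: (@differentiable_comp _ _ _ _ g (fun y : V => y 0 j : C)); first exact: H.
exact: coord_differentiable.
Qed.

Lemma holo_curve (g : C -> V) : holo_at g 0 -> exists r rho M : R,
  [/\ 0 < rho, rho < r, 0 <= M, forall j, hol r (fun t => g t 0 j) & forall t, rn t <= rho -> rn (g t) <= M].
Proof.
move=> /near0P [r r0 Hr]; have := Hr 0; rewrite rn0 => /(_ r0) /differentiable_bound /(_ 1 ltr01) [d d0 Hd].
have m0 : 0 < Num.min d r by rewrite lt_min d0.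
have [m1 m2] : Num.min d r <= d /\ Num.min d r <= r by rewrite !ge_min !lexx orbT.
exists r, (Num.min d r / 2), (rn (g 0) + 1); split.
- by rewrite divr_gt0.
- by lra.
- by rewrite addr_ge0 ?rn_ge0.
- by move=> j; apply: hol_coord.
- move=> t tr; have := Hd t; rewrite subr0 => /(_ ltac:(lra)) h.
  by apply: le_trans (rn_le _ (g 0)) _; lra.
Qed.

Lemma mon_bound u (z : V) M : rn z <= M -> rn (mon u z) <= M ^+ size u.
Proof.
move=> zM; have M0 : 0 <= M by apply: le_trans zM; exact: rn_ge0.
elim: u => [|j u IH]; first by rewrite /mon big_nil rn1.
rewrite mon_cons rnM exprS; apply: ler_pM; rewrite ?rn_ge0 //.
exact: le_trans (rn_coord z j) zM.
Qed.

Lemma hp_bound l M : exists K, forall z : V, rn z <= M -> rn (hp l z) <= K.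
Proof.
exists (\sum_(p <- l) rn p.1 * M ^+ size p.2) => z zM; rewrite /hp.
apply: le_trans (rn_sum _ _ _) _; apply: ler_sum => p _; rewrite rnM.
by rewrite ler_wpM2l ?rn_ge0 // mon_bound.
Qed.

Lemma hp_bigo2 (l : seq (C * seq 'I_n)) : (forall p, p \in l -> (2 <= size p.2)%N) -> bigo 2 (hp l : V -> C).
Proof.
move=> H; have : bigo 2 (fun z : V => \sum_(p <- l | p \in l) p.1 * mon p.2 z).
  apply: bigo_sum => p /H p2; apply: bigoZ; apply: bigo_le p2 _.
  exists 1, 1; split=> // z _; rewrite mul1r; exact: mon_bound.
by apply: bigo_ext => z; rewrite -big_seq.
Qed.

Lemma hp_cat l l' (z : V) : hp (l ++ l') z = hp l z + hp l' z.
Proof. by rewrite /hp big_cat. Qed.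

Definition scale_hp (c : C) (l : seq (C * seq 'I_n)) := [seq (c * p.1, p.2) | p <- l].
Lemma scale_hpE c l (z : V) : hp (scale_hp c l) z = c * hp l z.
Proof. by rewrite /hp /scale_hp big_map mulr_sumr; apply: eq_bigr => p _ /=; rewrite mulrA. Qed.

Definition mulX_hp j (l : seq (C * seq 'I_n)) := [seq (p.1, j :: p.2) | p <- l].
Lemma mulX_hpE j l (z : V) : hp (mulX_hp j l) z = z 0 j * hp l z.
Proof.
rewrite /hp /mulX_hp big_map mulr_sumr; apply: eq_bigr => p _ /=.
by rewrite mon_cons mulrCA.
Qed.

Lemma mon_differentiable u (z : V) : differentiable (mon u) z.
Proof.
elim: u => [|j u IH].
  have -> : mon [::] = (fun=> 1) :> (V -> C) by apply: funext => y; rewrite /mon big_nil.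
  exact: differentiable_cst.
have -> : mon (j :: u) = (fun y => y 0 j * mon u y) :> (V -> C) by apply: funext => y; rewrite mon_cons.
by apply: differentiableM => //; exact: coord_differentiable.
Qed.

Lemma hp_differentiable l (z : V) : differentiable (hp l) z.
Proof.
elim: l => [|p l IH].
  have -> : hp [::] = (fun=> 0) :> (V -> C) by apply: funext => y; rewrite /hp big_nil.
  exact: differentiable_cst.
have -> : hp (p :: l) = (fun y => p.1 * mon p.2 y + hp l y) :> (V -> C).
  by apply: funext => y; rewrite /hp big_cons.
apply: differentiableD => //; apply: differentiableM; [exact: differentiable_cst | exact: mon_differentiable].
Qed.

Definition ballV (rho : R) : set V := [set z | rn z < rho].

Lemma open_ballV rho : open (ballV rho).
Proof.
rewrite openE => z /= zr; suff : \forall y \near z, ballV rho y by [].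
apply/nearP; exists (rho - rn z); first by rewrite subr_gt0.
by move=> y h; rewrite /ballV /=; have := rn_le y z; lra.
Qed.

Lemma smooth_hol_coord rho (h : C -> C) j : hol rho h -> smooth_on (ballV rho) (fun z : V => h (z 0 j)).
Proof.
move=> hh; pose B (f : V -> C) := exists2 g, hol rho g & f = fun z => g (z 0 j).
have oU := @open_ballV rho; move: (ballV rho) oU (fun x (xr : ballV rho x) => xr : rn x < rho) => U oU HU.
apply: (dclosed_smooth oU (A := alg B)); last by apply: alg_base; exists h.
apply: alg_dclosed => f [g hg ->]; split=> [x xr|v].
  have xj : rn (x 0 j) < rho := le_lt_trans (rn_coord x j) (HU _ xr).
  apply/contP => e e0; have [d d0 Hd] := differentiable_bound (hg _ xj) e0.
  exists d => // y yd; apply: Hd; apply: le_lt_trans yd.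
  by have := rn_coord (y - x) j; rewrite !mxE.
exists (fun z : V => v 0 j * derive1 g (z 0 j)); split.
  apply: alg_mul; first exact: alg_cst.
  by apply: alg_base; exists (derive1 g) => //; exact: hol_derive1.
move=> x xr; have xj : rn (x 0 j) < rho := le_lt_trans (rn_coord x j) (HU _ xr).
have := cD_dD (v 0 j) (differentiable_derive1 (hg _ xj)); rewrite /dD.
by apply: rD_ext; exists 1 => // t _; rewrite !mxE.
Qed.

(** Degree at least 2 ensures that subtracting 2 Re G from [F] preserves F(0) = 0 and the vanishing
    of the gradient. *)
Definition nice (l : seq (C * seq 'I_n)) := forall p : C * seq 'I_n, p \in l -> (2 <= size p.2)%N.

(* [G] is a finite sum of [hp l] times convergent power series in one coordinate
   that does not vanish identically along the curve. *)
Lemma analytic_approx (gh : C -> V) (f : nat -> C) (M s : R) : Gamma 0 gh ->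
  0 < s -> (forall k, rn (f k) <= M * s ^+ k) ->
  (forall N, exists2 l, nice l & forall k, (k < N)%N -> f k = taylorc (fun t => hp l (gh t)) k) ->
  exists (G : V -> C) (rh : R), [/\ 0 < rh, forall z, rn z < rh -> differentiable G z,
    smooth_on (ballV rh) G, bigo 2 G &
    forall N, bigo N (fun t => G (gh t) - \sum_(k < N) f k * t ^+ k)].
Proof.
move=> [gholo g0 gn] s0 Hf Hl.
have [r [rho [W [rho0 rhor W0 hg HW]]]] := holo_curve gholo.
have r0 : 0 < r by lra.
(* The curve is not constant, so some coordinate has a nonzero Taylor series; it becomes the divisor
   [x]. *)
have [j0 nz] : exists j, ~ (forall k, taylorc (fun t => gh t 0 j) k = 0).
  apply: contrapT => H; apply: gn.
  have : \forall t \near (0 : C), forall j, gh t 0 j = 0.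
    apply: (@filter_forall _ _ (fun j (t : C) => gh t 0 j = 0) (nbhs (0 : C))) => j; apply: (hol_zero r0 (hg j)).
    by apply: contrapT => h; apply: H; exists j.
  by apply: filterS => t h; apply/rowP => j; rewrite h mxE.
pose x := taylorc (fun t => gh t 0 j0).
have [d xdn xd] : exists2 d, x d != 0 & ord_ge x d.
  have : exists k, x k != 0.
    apply: contrapT => H; apply: nz => k; apply/eqP/negPn/negP => h; apply: H; by exists k.
  move=> /ex_minnP [d h1 h2]; exists d => // k kd; apply/eqP/negPn/negP => h.
  by have := h2 k h; rewrite leqNgt kd.
have d0 : (0 < d)%N.
  by case: (d) xdn => //; rewrite /x taylorc0 g0 mxE eqxx.
(* One rate for everything: 1 / rho by Cauchy's estimates for [x] and all of [B], and [s] for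
   [f]. *)
pose S := Num.max s rho^-1.
have [sS rS] : s <= S /\ rho^-1 <= S by rewrite !le_max !lexx orbT.
have ri0 : 0 < rho^-1 by rewrite invr_gt0.
have S0 : 0 < S by exact: lt_le_trans s0 sS.
have bnd (h : C -> C) K : hol r h -> (forall t, rn t <= rho -> rn (h t) <= K) ->
   forall k, rn (taylorc h k) <= K * S ^+ k.
  move=> hh HK k; have [H _ _] := hol_expand rho0 rhor hh HK.
  have K0 : 0 <= K by apply: le_trans (HK 0 _); rewrite ?rn_ge0 // rn0 ltW.
  apply: le_trans (H k) _; rewrite -exprVn ler_wpM2l // lerXn2r // nnegrE ltW //.
pose B : set (nat -> C) := fun a => exists2 l, nice l & a = taylorc (fun t => hp l (gh t)).
have hh l : hol r (fun t => hp l (gh t)) by apply: hol_hp.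
have xs : exists M, forall k, rn (x k) <= M * S ^+ k.
  exists W; apply: bnd => // t /HW; apply: le_trans; exact: rn_coord.
have B0 : B (zerof R).
  exists [::] => //; apply: funext => k.
  have -> : (fun t => hp [::] (gh t)) = (fun=> 0) by apply: funext => t; rewrite /hp big_nil.
  by rewrite (hol_bigo_coef r0 (@hol_cst R r 0) (bigo0 C k.+1) (ltnSn k)).
have BD a b : B a -> B b -> B (addf a b).
  move=> [l nl ->] [l' nl' ->]; exists (l ++ l').
    by move=> p; rewrite mem_cat => /orP [/nl|/nl'].
  by rewrite -(taylorcD r0 (hh l) (hh l')); congr taylorc; apply: funext => t; rewrite hp_cat.
have BZ c a : B a -> B (scalef c a).
  move=> [l nl ->]; exists (scale_hp c l); first by move=> p /mapP [q /nl h ->].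
  by rewrite -(taylorcZ c r0 (hh l)); congr taylorc; apply: funext => t; rewrite scale_hpE.
have BT a : B a -> B (cvl x a).
  move=> [l nl ->]; exists (mulX_hp j0 l); first by move=> p /mapP [q /nl h ->] /=; apply: leqW.
  by rewrite /x -(taylorc_mul r0 (hg j0) (hh l)); congr taylorc; apply: funext => t; rewrite mulX_hpE.
have Bs a : B a -> exists M, forall k, rn (a k) <= M * S ^+ k.
  move=> [l nl ->]; have [K HK] := hp_bound l W; exists K; apply: bnd => // t /HW; exact: HK.
have cf : fcl B f.
  by move=> N; have [l nl H] := Hl N; exists (taylorc (fun t => hp l (gh t))) => //; exists l.
have M0 : 0 <= M by have := Hf 0%N; rewrite expr0 mulr1; apply: le_trans; exact: rn_ge0.
have HfS k : rn (f k) <= M * S ^+ k.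
  apply: le_trans (Hf k) _; rewrite ler_wpM2l // lerXn2r // nnegrE ltW //.
have [L [p [c [K [q [q0 Bp Hc E]]]]]] := artin_rees d0 xd xdn S0 xs B0 BD BZ BT Bs cf HfS.
have /choice [l Hll] : forall e, exists l, nice l /\ p e = taylorc (fun t => hp l (gh t)).
  by move=> e; have [l nl h] := Bp e; exists l.
pose ce e m := c m e.
pose G (z : V) := \sum_(e < L) hp (l e) z * psum (ce e) (z 0 j0).
(* The summand 1 keeps the radius positive when q = 0. *)
pose rh := (q + 1)^-1; have q1 : 0 < q + 1 by rewrite ltr_wpDl.
have rh0 : 0 < rh by rewrite invr_gt0.
have qrh : q * rh <= 1 by rewrite /rh ler_pdivrMr // mul1r lerDl.
have hps (e : 'I_L) : hol rh (psum (ce e)) := hol_psum (fun m => Hc e m (ltn_ord e)) q0 qrh.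
have EG : G = \sum_(e < L) (fun z : V => hp (l e) z * psum (ce e) (z 0 j0)).
  by apply: funext => z; rewrite fct_sumE.
exists G, rh; split=> //.
- move=> z zr; rewrite EG; apply: differentiable_sum => e.
  apply: differentiableM; first exact: hp_differentiable.
  apply: (@differentiable_comp _ _ _ _ (fun y : V => y 0 j0 : C) (psum (ce e))).
    exact: coord_differentiable.
  by apply: hps; apply: le_lt_trans (rn_coord z j0) zr.
- have oU := @open_ballV rh.
  have hs (e : 'I_L) := smooth_hol_coord j0 (hps e).
  move: (ballV rh) oU hs => U oU hs; apply: (smooth_alg oU (B := smooth_on U)) => //.
  rewrite EG; elim/big_ind: _ => [|g1 g2 a1 a2|e _]; first exact: (alg_cst _ 0).
    exact: (alg_add a1 a2).
  by apply: alg_mul; [exact: alg_hp | apply: alg_base; exact: hs].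
- apply: bigo_sum => e _.
  have b0 : bigo 0 (psum (ce e)) by apply: hol_coef_bigo (hps e) _.
  have b1 : bigo 0 (fun z : V => psum (ce e) (z 0 j0)).
    by apply: (bigo_comp (L := 1) (d := 1)) b0 => // z _; rewrite mul1r; exact: rn_coord.
  have := bigoM (hp_bigo2 (Hll e).1) b1; rewrite addn0; exact.
move=> N.
have [K1 [d1 [K10 d10 HK1]]] := curve_coord_bigo1 r0 hg g0 j0.
have HK1' t : rn t < d1 -> rn (gh t 0 j0) <= K1 * rn t by move=> /HK1; rewrite expr1.
have tp (e : 'I_L) m : taylorc (psum (ce e)) m = ce e m.
  rewrite /taylorc (derive1n_psum (M := K) (s := q)) //; last by move=> i; apply: Hc.
  by rewrite mulrC mulKf // pnatr_eq0 -lt0n fact_gt0.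
(* Cutting each series in the coordinate at N costs O(t^N), because the coordinate is O(t). Then
   [s2] cuts every product at t^N, where [E] recombines the coefficients into those of [f]. *)
have s1 (e : 'I_L) : bigo N (fun t => hp (l e) (gh t) *
    (psum (ce e) (gh t 0 j0) - \sum_(m < N) c m e * (gh t 0 j0) ^+ m)).
  have b0 : bigo 0 (fun t => hp (l e) (gh t)) by apply: hol_coef_bigo (hh (l e)) _.
  have := bigoM b0 (bigo_comp K10 d10 HK1' (hol_taylor N rh0 (hps e))); rewrite add0n.
  by apply: bigo_ext => t; congr (_ * (_ - _)); apply: eq_bigr => m _; rewrite tp.
have hm m (e : 'I_L) : hol r (fun t => (gh t 0 j0) ^+ m * hp (l e) (gh t)) /\
   taylorc (fun t => (gh t 0 j0) ^+ m * hp (l e) (gh t)) = iter m (cvl x) (p e).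
  elim: m => [|m [IH1 IH2]].
    have E0 : (fun t => (gh t 0 j0) ^+ 0 * hp (l e) (gh t)) = (fun t => hp (l e) (gh t)).
      by apply: funext => t; rewrite expr0 mul1r.
    by rewrite E0 /= (Hll e).2.
  have E1 : (fun t => (gh t 0 j0) ^+ m.+1 * hp (l e) (gh t)) =
     (fun t => gh t 0 j0 * ((gh t 0 j0) ^+ m * hp (l e) (gh t))).
    by apply: funext => t; rewrite exprS mulrA.
  rewrite E1; split; first exact: (holM (hg j0) IH1).
  by rewrite (taylorc_mul r0 (hg j0) IH1) IH2.
have s2 : bigo N (fun t => \sum_(m < N) \sum_(e < L) c m e * ((gh t 0 j0) ^+ m * hp (l e) (gh t) -
    \sum_(k < N) iter m (cvl x) (p e) k * t ^+ k)).
  apply: bigo_sum => m _; apply: bigo_sum => e _; apply: bigoZ.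
  by have [h1 <-] := hm m e; exact: (hol_taylor N r0 h1).
have s3 : bigo N (fun t => \sum_(e < L) hp (l e) (gh t) *
    (psum (ce e) (gh t 0 j0) - \sum_(m < N) c m e * (gh t 0 j0) ^+ m)).
  by apply: bigo_sum => e _; exact: s1.
apply: bigo_ext (bigoD s3 s2) => t.
have -> : \sum_(k < N) f k * t ^+ k = \sum_(m < N) \sum_(e < L) c m e * \sum_(k < N) iter m (cvl x) (p e) k * t ^+ k.
  under eq_bigr => k _.
    rewrite (E N k (ltn_ord k)) mulr_suml; under eq_bigr => m _ do rewrite mulr_suml.
    over.
  rewrite exchange_big; apply: eq_bigr => m _; rewrite exchange_big; apply: eq_bigr => e _ /=.
  by rewrite mulr_sumr; apply: eq_bigr => k _; rewrite mulrA.
rewrite /G.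
under eq_bigr => e _ do rewrite mulrBr.
under [X in _ + X]eq_bigr => m _ do under eq_bigr => e _ do rewrite mulrBr.
rewrite sumrB; under [X in _ + X]eq_bigr => m _ do rewrite sumrB.
rewrite sumrB addrA; congr (_ - _); rewrite -[RHS]addr0 -addrA; congr (_ + _).
apply/eqP; rewrite addrC subr_eq0; apply/eqP; rewrite exchange_big; apply: eq_bigr => e _ /=.
by rewrite mulr_sumr; apply: eq_bigr => m _; ring.
Qed.

End Approx.

(** * Independence of the good coordinate *)

Section Lip.
Variable R : realType.
Local Notation C := (Cplx R).

Definition lipat (V W : normedModType C) (f : V -> W) (a : V) := exists L d : R,
  [/\ 0 <= L, 0 < d & forall x y, rn (x - a) < d -> rn (y - a) < d -> rn (f x - f y) <= L * rn (x - y)].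

Lemma near_lt (V W : normedModType C) (f : V -> W) (a : V) (b : W) d : {for a, continuous f} -> f a = b -> 0 < d ->
  \forall x \near a, rn (f x - b) < d.
Proof. by move=> /contP cf <- /cf H; apply/nearP. Qed.

Lemma near_cont (V W : normedModType C) (f : V -> W) (a : V) (b : W) (P : W -> Prop) :
  {for a, continuous f} -> f a = b -> (\forall y \near b, P y) -> \forall x \near a, P (f x).
Proof.
move=> /contP cf <- /nearP [d d0 Hd]; apply/nearP; have [e e0 He] := cf d d0.
by exists e => // x /He /Hd.
Qed.

Lemma lip_cont (V W : normedModType C) (f : V -> W) (a : V) : lipat f a -> {for a, continuous f}.
Proof.
move=> [L [d [L0 d0 H]]]; apply/contP => e e0; have L1 : 0 < L + 1 by lra.
exists (Num.min d (e / (L + 1))); first by rewrite lt_min d0 divr_gt0.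
move=> x; rewrite lt_min ltr_pdivlMr // => /andP [h1 h2].
have aa : rn (a - a) < d by rewrite subrr rn0.
by apply: le_lt_trans (H x a h1 aa) _; have := rn_ge0 (x - a); nra.
Qed.

Lemma lip_near (V W : normedModType C) (f : V -> W) (a : V) : lipat f a ->
  exists2 L, 0 <= L & exists2 d, 0 < d & forall x y, rn (x - a) < d -> rn (y - a) < d -> rn (f x - f y) <= L * rn (x - y).
Proof. by move=> [L [d [L0 d0 H]]]; exists L => //; exists d. Qed.

Lemma lip_comp (V W X : normedModType C) (f : V -> W) (g : W -> X) (a : V) (b : W) : f a = b ->
  lipat f a -> lipat g b -> lipat (fun x => g (f x)) a.
Proof.
move=> fab lf [L [d [L0 d0 H]]]; have /nearP [d1 d10 H1] := near_lt (lip_cont lf) fab d0.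
have [K [d2 [K0 d20 H2]]] := lf; exists (L * K), (Num.min d1 d2); split.
- exact: mulr_ge0.
- by rewrite lt_min d10.
move=> x y; rewrite !lt_min => /andP [x1 x2] /andP [y1 y2].
apply: le_trans (H _ _ (H1 x x1) (H1 y y1)) _; rewrite -mulrA ler_wpM2l //; exact: H2.
Qed.

Lemma lip_add (V W : normedModType C) (f g : V -> W) (a : V) : lipat f a -> lipat g a ->
  lipat (fun x => f x + g x) a.
Proof.
move=> [L [d [L0 d0 H]]] [K [d2 [K0 d20 H2]]]; exists (L + K), (Num.min d d2); split.
- exact: addr_ge0.
- by rewrite lt_min d0.
move=> x y; rewrite !lt_min => /andP [x1 x2] /andP [y1 y2].
rewrite opprD addrACA mulrDl; apply: le_trans (rnD _ _) _.
by apply: lerD; [apply: H | apply: H2].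
Qed.

Lemma lip_lip (V W X : normedModType C) (f : V -> W) (g : V -> X) (a : V) (k : R) : 0 <= k ->
  (forall x y, rn (g x - g y) <= k * rn (f x - f y)) -> lipat f a -> lipat g a.
Proof.
move=> k0 Hk [L [d [L0 d0 H]]]; exists (k * L), d; split=> //; first exact: mulr_ge0.
by move=> x y xd yd; apply: le_trans (Hk _ _) _; rewrite -mulrA ler_wpM2l // H.
Qed.

Lemma fin_min m (dj : 'I_m -> R) : (forall j, 0 < dj j) -> exists2 d, 0 < d & forall j, d <= dj j.
Proof.
move=> H; have s0 (P : pred 'I_m) : 0 <= \sum_(j | P j) (dj j)^-1.
  by apply: sumr_ge0 => j _; rewrite invr_ge0 ltW.
have t0 : 0 < \sum_j (dj j)^-1 + 1 by rewrite ltr_wpDl.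
exists (\sum_j (dj j)^-1 + 1)^-1; first by rewrite invr_gt0.
move=> j; rewrite -[leRHS]invrK lef_pV2 ?posrE ?invr_gt0 //.
by rewrite (bigD1 j) //=; have := s0 (fun i => i != j); lra.
Qed.

Lemma holo_lip_row (V : normedModType C) m (f : V -> 'rV[C]_m) (a : V) : holo_at f a -> lipat f a.
Proof.
move=> hf; have hj j : exists Ld : R * R, [/\ 0 <= Ld.1, 0 < Ld.2 &
    forall x y, rn (x - a) < Ld.2 -> rn (y - a) < Ld.2 -> rn (f x 0 j - f y 0 j) <= Ld.1 * rn (x - y)].
  have : holo_at (fun x => f x 0 j : C) a.
    apply: filterS hf => x dx; apply: (@differentiable_comp _ _ _ _ f (fun y : 'rV[C]_m => y 0 j : C)) => //.
    exact: coord_differentiable.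
  by move=> /holo_lip [L [d H]]; exists (L, d).
have /choice [g Hg] := hj; have gp j : 0 < (g j).2 by case: (Hg j).
have [d d0 Hd] := fin_min gp.
have s0 (P : pred 'I_m) : 0 <= \sum_(j | P j) (g j).1.
  by apply: sumr_ge0 => j _; case: (Hg j).
exists (\sum_j (g j).1), d; split=> // x y xd yd.
apply: rn_row_le; first by rewrite mulr_ge0 ?rn_ge0.
move=> j; have [g1 g2 g3] := Hg j; rewrite !mxE.
apply: le_trans (g3 x y (lt_le_trans xd (Hd j)) (lt_le_trans yd (Hd j))) _.
rewrite ler_wpM2r ?rn_ge0 // (bigD1 j) //= lerDl; exact: s0.
Qed.

Variable n : nat.
Local Notation V := 'rV[C]_n.
Local Notation W := 'rV[C]_(n + 1).

Lemma zpartE (x : W) j : zpart x 0 j = x 0 (lshift 1 j).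
Proof. by rewrite /zpart mxE. Qed.
Lemma wpartE (x : W) : wpart x = x 0 (rshift n ord0).
Proof. by rewrite /wpart mxE. Qed.

Lemma zpartB (x y : W) : zpart (x - y) = zpart x - zpart y.
Proof. by apply/rowP => j; rewrite !mxE. Qed.
Lemma wpartB (x y : W) : wpart (x - y) = wpart x - wpart y.
Proof. by rewrite !wpartE !mxE. Qed.
Lemma zpart0 : zpart (0 : W) = 0.
Proof. by apply/rowP => j; rewrite !mxE. Qed.
Lemma wpart0 : wpart (0 : W) = 0.
Proof. by rewrite wpartE mxE. Qed.
Lemma rn_zpart (x : W) : rn (zpart x) <= rn x.
Proof. by apply: rn_row_le; [exact: rn_ge0 | move=> j; rewrite zpartE; exact: rn_coord]. Qed.
Lemma rn_wpart (x : W) : rn (wpart x) <= rn x.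
Proof. by rewrite wpartE; exact: rn_coord. Qed.

Lemma row_split_le (x : W) (e : R) : rn (zpart x) <= e -> rn (wpart x) <= e -> rn x <= e.
Proof.
move=> hz hw; apply: rn_row_le => [|j]; first by apply: le_trans hw; exact: rn_ge0.
case: (split_ordP j) => k ->; first by rewrite -zpartE; apply: le_trans hz; exact: rn_coord.
by rewrite (ord1 k) -wpartE.
Qed.

Lemma split_eq (x y : W) : zpart x = zpart y -> wpart x = wpart y -> x = y.
Proof.
move=> hz hw; apply/rowP => j; case: (split_ordP j) => k ->; first by rewrite -!zpartE hz.
by rewrite (ord1 k) -!wpartE.
Qed.

Definition elast : W := delta_mx 0 (rshift n ord0).
Lemma zpart_elast (x : W) c : zpart (x + c *: elast) = zpart x.
Proof.
apply/rowP => j; rewrite !mxE eqxx /= (_ : (lshift 1 j == rshift n ord0) = false) ?mulr0 ?addr0 //.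
exact: eq_lrshift.
Qed.
Lemma wpart_elast (x : W) c : wpart (x + c *: elast) = wpart x + c.
Proof. by rewrite !wpartE !mxE !eqxx mulr1. Qed.

Lemma zpart_differentiable (x : W) : differentiable (@zpart R n) x.
Proof. exact: differentiable_lsubmx. Qed.
Lemma wpart_differentiable (x : W) : differentiable (@wpart R n) x.
Proof.
have -> : @wpart R n = (fun y : W => y 0 (rshift n ord0) : C) by apply: funext => y; rewrite wpartE.
exact: coord_differentiable.
Qed.

Lemma lip_zpart (a : W) : lipat (@zpart R n) a.
Proof. by exists 1, 1; split=> // x y _ _; rewrite mul1r -zpartB rn_zpart. Qed.
Lemma lip_wpart (a : W) : lipat (@wpart R n) a.
Proof. by exists 1, 1; split=> // x y _ _; rewrite mul1r -wpartB rn_wpart. Qed.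

Lemma lip_Re (X : normedModType C) (f : X -> C) a : lipat f a -> lipat (fun x => (2 * complex.Re (f x))%:C : C) a.
Proof.
apply: (@lip_lip _ _ _ _ _ _ 2) => // x y.
rewrite -rmorphB rn_real -mulrBr normrM (ger0_norm (x := 2)) // ler_wpM2l //.
by rewrite -cReB; exact: Re_le.
Qed.

Section Transfer.
Variables (M : set W) (p : W).

Lemma good_lip Phi F : good_coord M p Phi F -> lipat (liftC (defr Phi F)) p /\ defr Phi F p = 0.
Proof.
move=> [Pp hP _ [[U [oU U0 sF]] [F0 _]] _]; split; last first.
  by rewrite /defr Pp wpart0 zpart0 F0 mulr0 addr0.
have lP := holo_lip_row hP.
have lz := lip_comp Pp lP (lip_zpart 0); have lw := lip_comp Pp lP (lip_wpart 0).
have zp : zpart (Phi p) = 0 by rewrite Pp zpart0.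
have lF := lip_comp (f := fun x => zpart (Phi x)) zp lz (smooth_lip oU sF U0).
have := lip_add (lip_Re lw) lF.
have -> // : (fun x => (2 * complex.Re (wpart (Phi x)))%:C + liftC F (zpart (Phi x))) = liftC (defr Phi F).
by apply: funext => x; rewrite /liftC /defr rmorphD.
Qed.

(* Moving the [w]-coordinate of [x] by [- r0 x / 2] lands on [M], where [r] vanishes. *)
Lemma defr_dominated Phi0 F0 Phi F : good_coord M p Phi0 F0 -> good_coord M p Phi F ->
  exists2 K, 0 <= K & \forall x \near p, `|defr Phi F x| <= K * `|defr Phi0 F0 x|.
Proof.
move=> G0 G; have [l0 z0] := good_lip G0; have [l1 z1] := good_lip G.
have [Pp0 hP0 [Psi [hPsi Psi0 PsiK PhiK]] _ HM0] := G0; have [_ _ _ _ HM] := G.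
have lP := holo_lip_row hP0; have lPsi := holo_lip_row hPsi.
pose y' x := Phi0 x + (- 2^-1 * liftC (defr Phi0 F0) x) *: elast.
have y'p : y' p = 0 by rewrite /y' Pp0 /liftC z0 rmorph0 mulr0 scale0r addr0.
have ly : lipat y' p.
  apply: lip_add lP _; apply: (@lip_lip _ _ _ _ _ _ (rn elast)) l0; first exact: rn_ge0.
  move=> x y; rewrite -scalerBl -mulrBr rnZ rnM rnN mulrC ler_wpM2l ?rn_ge0 //.
  rewrite ler_piMl ?rn_ge0 // -[2^-1]/((2 : C)^-1) rnV rn_nat; lra.
have lX := lip_comp y'p ly lPsi; have X'p : Psi (y' p) = p by rewrite y'p.
have [L1 L10 [d1 d10 H1]] := lip_near lPsi; have [L2 L20 [d2 d20 H2]] := lip_near l1.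
exists (L2 * (L1 * rn elast)); first by rewrite !mulr_ge0 ?rn_ge0.
have n1 := near_cont (lip_cont ly) y'p PhiK.
have n2 := near_cont (lip_cont lX) X'p HM0.
have n3 := near_cont (lip_cont lX) X'p HM.
have n4 := near_lt (lip_cont lP) Pp0 d10.
have n5 := near_lt (lip_cont ly) y'p d10.
have n6 := near_lt (lip_cont lX) X'p d20.
have n7 : \forall x \near p, rn (x - p) < d2 by apply/nearP; exists d2.
near=> x.
have e1 : Psi (Phi0 x) = x by near: x.
have e2 : Phi0 (Psi (y' x)) = y' x by near: x.
have e3 : M (Psi (y' x)) <-> defr Phi0 F0 (Psi (y' x)) = 0 by near: x.
have e4 : M (Psi (y' x)) <-> defr Phi F (Psi (y' x)) = 0 by near: x.
have e5 : rn (Phi0 x - 0) < d1 by near: x.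
have e6 : rn (y' x - 0) < d1 by near: x.
have e7 : rn (Psi (y' x) - p) < d2 by near: x.
have e8 : rn (x - p) < d2 by near: x.
(* The shift leaves the z-part, hence [F0], unchanged and lowers 2 Re w by exactly
   [defr Phi0 F0 x]. *)
have r0 : defr Phi0 F0 (Psi (y' x)) = 0.
  rewrite {1}/defr e2 zpart_elast wpart_elast cReD.
  have -> : complex.Re (- 2^-1 * liftC (defr Phi0 F0) x) = - 2^-1 * defr Phi0 F0 x.
    have -> : - 2^-1 * liftC (defr Phi0 F0) x = (- 2^-1 * defr Phi0 F0 x)%:C :> C.
      by rewrite rmorphM rmorphN fmorphV rmorph_nat.
    by [].
  by rewrite /defr; lra.
(* Here the common zero set enters: near [p] both functions vanish exactly on [M]. The rest is the
   Lipschitz bound between [x] and the shifted point. *)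
have r1 : defr Phi F (Psi (y' x)) = 0 by apply/e4/e3.
have h2 := H2 x (Psi (y' x)) e8 e7; have h1 := H1 (Phi0 x) (y' x) e5 e6.
rewrite e1 in h1; rewrite /liftC r1 rmorph0 subr0 rn_real in h2.
apply: le_trans h2 _; rewrite -!mulrA ler_wpM2l //; apply: le_trans h1 _.
rewrite ler_wpM2l // /y' opprD addrA subrr add0r rnN rnZ mulrC ler_wpM2l ?rn_ge0 //.
rewrite rnM rnN rn_real ler_piMl // -[2^-1]/((2 : C)^-1) rnV rn_nat; lra.
Unshelve. all: by end_near.
Qed.

End Transfer.

(** Bridge between the [C]-valued bounds of [vanish_order] and [tangent_inf] and the real bounds of
    [bigo]. *)
Lemma near_bigo (X : normedModType C) (u : X -> R) N :
  (exists K : R, \forall x \near (0 : X), (`|u x|)%:C <= K%:C * `|x| ^+ N) <-> bigo N (liftC u).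
Proof.
have E (K : R) (x : X) : ((`|u x|)%:C <= K%:C * `|x| ^+ N) = (rn (liftC u x) <= K * rn x ^+ N).
  by rewrite rnE -rmorphXn -rmorphM lecR /liftC rn_real.
split=> [[K /near0P [d d0 H]]|[K [d [K0 d0 H]]]]; last first.
  by exists K; apply/near0P; exists d => // x /H; rewrite E.
exists (`|K|), d; split=> // x /H; rewrite E => h; apply: le_trans h _.
by rewrite ler_wpM2r ?exprn_ge0 ?rn_ge0 // ler_norm.
Qed.

Lemma bigo_dominated (X : normedModType C) (g : X -> W) (p : W) (r r0 : W -> R) K N : 0 <= K ->
  (\forall x \near p, `|r x| <= K * `|r0 x|) -> {for 0, continuous g} -> g 0 = p ->
  bigo N (liftC (fun t => r0 (g t))) -> bigo N (liftC (fun t => r (g t))).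
Proof.
move=> K0 H cg gp [K1 [d1 [K10 d10 H1]]]; have /near0P [d2 d20 H2] := near_cont cg gp H.
exists (K * K1), (Num.min d1 d2); split; first exact: mulr_ge0.
  by rewrite lt_min d10.
move=> x; rewrite lt_min => /andP [/H1 h1 /H2 h2]; move: h1; rewrite /liftC !rn_real => h1.
by apply: le_trans h2 _; rewrite -mulrA ler_wpM2l.
Qed.

End Lip.

(** * Curves with prescribed velocity in tangent submanifolds *)

Section Curves.
Variable R : realType.
Local Notation C := (Cplx R).

Lemma holo_comp (V W X : normedModType C) (f : V -> W) (g : W -> X) a b : f a = b ->
  holo_at f a -> holo_at g b -> holo_at (fun x => g (f x)) a.
Proof.
move=> fab hf hg; have cf : {for a, continuous f}.
  by apply: differentiable_continuous; exact: nbhs_singleton hf.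
have hgf := near_cont cf fab hg.
near=> x; apply: (@differentiable_comp _ _ _ _ f g); first by near: x.
by near: x.
Unshelve. all: by end_near.
Qed.

Lemma holo_line (V W : normedModType C) (g : V -> W) u : holo_at g 0 -> holo_at (fun t : C => g (t *: u)) 0.
Proof.
move=> hg; apply: (holo_comp (f := fun t : C => t *: u) (b := 0)) => //; first by rewrite scale0r.
by apply/near0P; exists 1 => // t _; apply: differentiableZl.
Qed.

Lemma bigo_line (V : normedModType C) N (g : V -> C) u : bigo N g -> bigo N (fun t : C => g (t *: u)).
Proof. by apply: (bigo_comp (L := rn u) (d := 1)); rewrite ?rn_ge0 // => t _; rewrite rnZ mulrC. Qed.

(** Along the line spanned by [u] the increment is both t L(u) + o(t) and O(t^2); [m] is chosen so
    small that the two errors cannot add up to a nonzero t L(u). *)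
Lemma linear_at_quadratic (V W : normedModType C) (f : V -> W) (L : V -> W) u K d : fD f 0 L ->
  (forall t : C, L (t *: u) = t *: L u) -> 0 <= K -> 0 < d ->
  (forall t : C, rn t < d -> rn (f (t *: u) - f 0) <= K * rn t ^+ 2) -> L u = 0.
Proof.
move=> H HL K0 d0 Hd; apply/eqP; rewrite -rn_eq0 eq_le rn_ge0 andbT leNgt; apply/negP => y0.
set y := rn (L u) in y0; have u1 : 0 < rn u + 1 by rewrite ltr_wpDl ?rn_ge0.
have e0 : 0 < y / (4 * (rn u + 1)) by rewrite divr_gt0 // mulr_gt0.
have [d1 d10 H1] := H _ e0; have K1 : 0 < K + 1 by lra.
pose m := Num.min d (Num.min (d1 / (rn u + 1)) (y / (4 * (K + 1)))).
have m0 : 0 < m by rewrite !lt_min d0 !divr_gt0 // mulr_gt0.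
have [ma mb mc] : [/\ m <= d, m <= d1 / (rn u + 1) & m <= y / (4 * (K + 1))].
  by rewrite /m !ge_min !lexx !orbT.
rewrite ler_pdivlMr // in mb; rewrite ler_pdivlMr ?mulr_gt0 // in mc.
pose t : C := (m / 2)%:C; have rt : rn t = m / 2 by rewrite rn_real gtr0_norm // divr_gt0.
have hu : rn (t *: u) = m / 2 * rn u by rewrite rnZ rt.
have h1 := H1 (t *: u) ltac:(rewrite hu; have := rn_ge0 u; nra).
have h2 := Hd t ltac:(rewrite rt; lra).
rewrite add0r HL in h1.
have h3 : rn (t *: L u) <= rn (f (t *: u) - f 0) + rn (f (t *: u) - f 0 - t *: L u).
  by rewrite -{1}[t *: L u](subKr (f (t *: u) - f 0)); exact: rnB.
rewrite rnZ rt -/y in h3; rewrite rt in h2.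
have h4 : y / (4 * (rn u + 1)) * rn (t *: u) <= m / 2 * (y / 4).
  rewrite hu; have -> : y / (4 * (rn u + 1)) * (m / 2 * rn u) = m / 2 * (y / 4) * (rn u / (rn u + 1)).
    by field; rewrite gt_eqF.
  rewrite ler_piMr //; last by rewrite ler_pdivrMr // mul1r lerDl.
  by rewrite mulr_ge0 // divr_ge0 // ltW.
have h5 : K * (m / 2) ^+ 2 <= m / 2 * (y / 4).
  by rewrite expr2 mulrCA ler_wpM2l ?divr_ge0 ?(ltW m0) //; nra.
nra.
Qed.

Variable n : nat.
Local Notation V := 'rV[C]_n.
Local Notation W := 'rV[C]_(n + 1).

Lemma taylorc1_line (A : V -> V) u j : differentiable A 0 ->
  taylorc (fun t : C => A (t *: u) 0 j) 1 = ('d A 0 u) 0 j.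
Proof.
move=> dA; have H := differentiable_fD dA.
have D : cD (fun t : C => A (t *: u) 0 j) 0 (('d A 0 u) 0 j).
  have u1 : 0 < rn u + 1 by rewrite ltr_wpDl ?rn_ge0.
  move=> e e0; have [d d0 Hd] := H _ (divr_gt0 e0 u1).
  exists (d / (rn u + 1)); first exact: divr_gt0.
  move=> h; rewrite ltr_pdivlMr // => hd.
  have hu : rn (h *: u) <= rn h * (rn u + 1).
    by rewrite rnZ ler_wpM2l ?rn_ge0 // lerDl.
  have := Hd (h *: u) (le_lt_trans hu hd); rewrite !add0r scale0r linearZ /=.
  have := rn_coord (A (h *: u) - A 0 - h *: 'd A 0 u) j; rewrite !mxE => h1 h2.
  apply: le_trans h1 _; apply: le_trans h2 _.
  apply: le_trans (ler_wpM2l _ hu) _; first by rewrite divr_ge0 // ltW.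
  by rewrite mulrCA divfK ?gt_eqF // mulrC.
by rewrite /taylorc derive1n1 (cD_derive1 D) divr1.
Qed.

(* The derivative of [w o Phi o phi] vanishes at 0 since Re w = O(2) there, so the
   [z]-part of the injective derivative of [Phi o phi] is injective, hence onto. *)
Lemma curves_of_BG (M : set W) p Phi F : good_coord M p Phi F -> BG_type_infinite (defr Phi F) p ->
  curves (liftC F).
Proof.
move=> [Pp hP [Psi [hPsi Psi0 PsiK PhiK]] [[U [oU U0 sF]] [F0 dF]] _] HBG m v.
(* Order at least 2 is asked for even when m is smaller: it forces the derivative of [b] at 0 to
   vanish. *)
have [phi [[hphi phi0 phi_inj] Hvan]] := HBG (maxn m 2).
have hPphi := holo_comp phi0 hphi hP.
have Q0 : Phi (phi 0) = 0 by rewrite phi0.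
pose A (z : V) := zpart (Phi (phi z)); pose b (z : V) := wpart (Phi (phi z)).
have hA : holo_at A 0.
  by apply: (holo_comp Q0 hPphi); apply/near0P; exists 1 => // x _; exact: zpart_differentiable.
have hb : holo_at b 0.
  by apply: (holo_comp Q0 hPphi); apply/near0P; exists 1 => // x _; exact: wpart_differentiable.
have A0 : A 0 = 0 by rewrite /A Q0 zpart0.
have b0 : b 0 = 0 by rewrite /b Q0 wpart0.
have van : bigo (maxn m 2) (liftC (fun z => defr Phi F (phi z))) by apply/near_bigo.
have F2 : bigo 2 (liftC F) by apply: (smooth_bigo2 oU U0 sF) => //; rewrite /liftC F0 rmorph0.
have FA : bigo 2 (fun z => liftC F (A z)).
  have [L [d [L0 d0 H]]] := holo_lip_row hA; apply: (bigo_comp L0 d0) F2 => x xd.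
  by have := H x 0; rewrite A0 !subr0; apply => //; rewrite rn0.
have line (u : V) : exists r, [/\ 0 < r, forall j, hol r (fun t : C => A (t *: u) 0 j),
    hol r (fun t => b (t *: u)) & bigo 2 (fun t : C => b (t *: u))].
  have [r1 [rho [W1 [h1 h2 _ h3 _]]]] := holo_curve (holo_line u hA).
  have [r2 r20 h4] := holo_at_hol (holo_line u hb).
  exists (Num.min r1 r2); have r0 : 0 < Num.min r1 r2 by rewrite lt_min r20 andbT; lra.
  have hb' : hol (Num.min r1 r2) (fun t => b (t *: u)).
    by apply: hol_le h4; rewrite ge_min lexx orbT.
  split=> //; first by move=> j; apply: hol_le (h3 j); rewrite ge_min lexx.
  apply: (hol_coef_bigo r0 hb') => -[|[|//]] _; first by rewrite taylorc0 scale0r b0.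
  apply: (hol_Re_coef (N := 2) r0 hb') => //.
  have := bigoZ 2^-1 (bigo_line u (bigoB (bigo_le (leq_maxr m 2) van) FA)).
  apply: bigo_ext => t; rewrite /liftC /defr rmorphD /= -/(A _) -/(b _) addrK rmorphM rmorph_nat.
  by rewrite mulrA mulVf ?mul1r // pnatr_eq0.
have dA : differentiable A 0 := nbhs_singleton hA.
(* If the z-part has zero derivative along [u], then Phi o phi is O(t^2) there. The Lipschitz
   inverse [Psi] carries this back to [phi], and injectivity of the derivative of [phi] gives u =
   0. *)
have inj (u : V) : 'd A 0 u = 0 -> u = 0.
  move=> Lu; have [r [r0 hc hbt b2]] := line u.
  have c2 j : bigo 2 (fun t : C => A (t *: u) 0 j).
    apply: (hol_coef_bigo r0 (hc j)) => -[|[|//]] _; first by rewrite taylorc0 scale0r A0 mxE.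
    by rewrite taylorc1_line // Lu mxE.
  have re (f : C -> C) : bigo 2 f -> bigo 2 (fun t => (rn (f t))%:C : C).
    by move=> [K [d [K0 d0 H]]]; exists K, d; split=> // t /H; rewrite rn_real ger0_norm ?rn_ge0.
  have [K [d [K0 d0 H]]] : bigo 2 (fun t : C => \sum_j (rn (A (t *: u) 0 j))%:C + (rn (b (t *: u)))%:C : C).
    by apply: bigoD (re _ b2); apply: bigo_sum => j _; exact: re.
  have s0 (t : C) (P : pred 'I_n) : 0 <= \sum_(j | P j) rn (A (t *: u) 0 j).
    by apply: sumr_ge0 => j _; rewrite rn_ge0.
  have Hrow (t : C) : rn t < d -> rn (Phi (phi (t *: u))) <= K * rn t ^+ 2.
    move=> /H; rewrite -rmorph_sum -rmorphD rn_real ger0_norm; last by rewrite addr_ge0 ?rn_ge0.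
    apply: le_trans; apply: row_split_le; last by rewrite lerDr.
    apply: rn_row_le => [|j]; first by rewrite addr_ge0 ?rn_ge0.
    rewrite (bigD1 j) //= -addrA lerDl addr_ge0 ?rn_ge0 //; exact: s0.
  have [L L0 [d1 d10 H1]] := lip_near (holo_lip_row hPsi).
  have cphi := differentiable_continuous (nbhs_singleton hphi).
  have cPhi := differentiable_continuous (nbhs_singleton hPphi).
  have /near0P [d2 d20 H2] := near_cont cphi phi0 PsiK.
  have /near0P [d3 d30 H3] := near_lt cPhi Q0 d10.
  have u1 : 0 < rn u + 1 by rewrite ltr_wpDl ?rn_ge0.
  pose dd := Num.min d (Num.min (d2 / (rn u + 1)) (d3 / (rn u + 1))).
  have dd0 : 0 < dd by rewrite !lt_min d0 !divr_gt0.
  have key := linear_at_quadratic (u := u) (K := L * K) (d := dd) (differentiable_fD (nbhs_singleton hphi)).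
  have : 'd phi 0 u = 'd phi 0 0.
    rewrite linear0; apply: key => //; first by move=> t; rewrite linearZ.
      exact: mulr_ge0.
    move=> t; rewrite !lt_min !ltr_pdivlMr // => /andP [t1 /andP [t2 t3]].
    have tu : rn (t *: u) <= rn t * (rn u + 1) by rewrite rnZ ler_wpM2l ?rn_ge0 // lerDl.
    rewrite -(H2 (t *: u) (le_lt_trans tu t2)) phi0 -Psi0.
    have h3 := H3 (t *: u) (le_lt_trans tu t3).
    have := H1 (Phi (phi (t *: u))) 0 h3; rewrite subrr rn0 => /(_ d10) h; apply: le_trans h _.
    by rewrite subr0 -mulrA ler_wpM2l //; exact: Hrow.
  by move/phi_inj.
(* Injective between equal dimensions, hence invertible: some direction [u] is sent exactly to
   [v]. *)
pose B := lin1_mx ('d A 0).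
have uB : B \in unitmx.
  by rewrite -row_free_unit; apply: inj_row_free => w; rewrite mul_rV_lin1; exact: inj.
pose u := v *m invmx B.
have Lu : 'd A 0 u = v by rewrite -mul_rV_lin1 mulmxKV.
have [r [r0 hc hbt b2]] := line u.
exists (fun t => A (t *: u)), (fun t => b (t *: u)), r; split=> //.
- move=> j; apply: bigo_ext (hol_taylor 2 r0 (hc j)) => t.
  rewrite !big_ord_recr big_ord0 /= taylorc0 scale0r A0 mxE taylorc1_line // Lu.
  by rewrite ?mxE mul0r !add0r expr1 mulrC.
- have := bigo_line u (bigo_le (leq_maxl m 2) van); apply: bigo_ext => t.
  by rewrite addJ /liftC /defr rmorphD.
Qed.

End Curves.

(** * The three implications *)

Section Main.
Variable R : realType.
Local Notation C := (Cplx R).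

Lemma series_cvg_geo (a : nat -> C) (M s : R) t : (forall k, rn (a k) <= M * s ^+ k) -> 0 <= s ->
  s * rn t < 1 -> cvgn (series (fun k => a k * t ^+ k)).
Proof.
move=> Ha s0 st; apply/cvg_ex; exists (psum a t); apply/cvgrPdist_le => e e0.
have ee : e = (complex.Re e)%:C by have := ger0_Im (ltW e0); case: e {e0} => u w /= ->.
move: e0; rewrite ee ltcR => e0.
have q01 : 0 <= s * rn t < 1 by rewrite st mulr_ge0 ?rn_ge0.
have [N HN] := small_geo (2 * M / (1 - s * rn t)) q01 e0.
exists N => // m /= /HN h; rewrite lecP /series /= big_mkord.
exact: le_trans (psumP Ha s0 st m) (ltW h).
Qed.

(** The terms tend to 0 at t = rho / 2, so they are bounded there: by 1 from some N on, and by the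
    finite sum before. *)
Lemma series_geo_bound (a : nat -> C) (rho : R) : 0 < rho ->
  (forall t : C, `|t| < rho%:C -> cvgn (series (fun k => a k * t ^+ k))) ->
  exists M, forall k, rn (a k) <= M * (2 / rho) ^+ k.
Proof.
move=> rho0 H; pose t : C := (rho / 2)%:C.
have rt : rn t = rho / 2 by rewrite rn_real gtr0_norm // divr_gt0.
have /H /cvg_series_cvg_0 /cvgrPdist_lt /(_ 1 ltr01) [N _ HN] : `|t| < rho%:C by rewrite ltcP rt; lra.
pose M := 1 + \sum_(k < N) rn (a k * t ^+ k).
have s0 (P : pred 'I_N) : 0 <= \sum_(k < N | P k) rn (a k * t ^+ k) by apply: sumr_ge0 => k _; rewrite rn_ge0.
exists M => k; have tk : 0 < (rho / 2) ^+ k by rewrite exprn_gt0 // divr_gt0.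
rewrite -[2 / rho]invrK invf_div exprVn ler_pdivlMr // -rt -rnX -rnM.
have [kN|Nk] := ltnP k N.
  by rewrite /M (bigD1 (Ordinal kN)) //=; have := s0 (fun i => i != Ordinal kN); lra.
have := HN k Nk; rewrite /= sub0r normrN -[1]/((1 : R)%:C) ltcP /M => h.
by have := s0 xpredT; lra.
Qed.

Variable n : nat.
Local Notation V := 'rV[C]_n.
Local Notation W := 'rV[C]_(n + 1).
Variables (M : set W) (p : W).

Lemma tangent_transfer Phi0 F0 Phi F (g : C -> W) : good_coord M p Phi0 F0 -> good_coord M p Phi F ->
  holo_at g 0 -> g 0 = p -> tangent_inf (defr Phi0 F0) g -> tangent_inf (defr Phi F) g.
Proof.
move=> G0 G hg gp H N; have [K K0 HK] := defr_dominated G0 G.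
apply/near_bigo; apply: (bigo_dominated K0 HK) => //.
  by apply: differentiable_continuous; exact: nbhs_singleton hg.
by apply/near_bigo; exact: H.
Qed.

Lemma BG_transfer Phi0 F0 Phi F : good_coord M p Phi0 F0 -> good_coord M p Phi F ->
  BG_type_infinite (defr Phi0 F0) p -> BG_type_infinite (defr Phi F) p.
Proof.
move=> G0 G H N; have [K K0 HK] := defr_dominated G0 G.
have [phi [[h1 h2 h3] hv]] := H N; exists phi; split=> //.
apply/near_bigo; apply: (bigo_dominated K0 HK) => //.
  by apply: differentiable_continuous; exact: nbhs_singleton h1.
by apply/near_bigo.
Qed.

Definition zlift (z : V) : W := row_mx z 0.

Lemma zpart_lift z : zpart (zlift z) = z.
Proof. exact: row_mxKl. Qed.
Lemma wpart_lift z : wpart (zlift z) = 0.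
Proof. by rewrite /wpart /zlift row_mxKr mxE. Qed.

Lemma zlift_differentiable z : differentiable zlift z.
Proof.
have -> : zlift = \sum_(j < n) (fun z : V => z 0 j *: (zlift (delta_mx 0 j))).
  apply: funext => y; rewrite fct_sumE; apply: split_eq.
    rewrite zpart_lift; apply/rowP => j; rewrite /zpart mxE summxE (bigD1 j) //= big1 ?addr0.
      by rewrite mxE /zlift row_mxEl mxE !eqxx mulr1.
    by move=> i ij; rewrite mxE /zlift row_mxEl mxE eqxx /= eq_sym (negbTE ij) mulr0.
  rewrite wpart_lift wpartE summxE big1 // => i _.
  by rewrite mxE -wpartE wpart_lift mulr0.
by apply: differentiable_sum => j; apply: differentiableZl; exact: coord_differentiable.
Qed.

Lemma curve_in (U : set V) (gh : C -> V) : open U -> U 0 -> holo_at gh 0 -> gh 0 = 0 ->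
  exists r : R, [/\ 0 < r, forall j, hol r (fun t => gh t 0 j) & forall t, rn t < r -> U (gh t)].
Proof.
move=> oU U0 hg g0; have [r [rho [K [h1 h2 _ h3 _]]]] := holo_curve hg.
have cg : {for 0, continuous gh} by apply: differentiable_continuous; exact: nbhs_singleton hg.
have /near0P [d d0 Hd] := near_cont cg g0 (open_nbhs_nbhs (conj oU U0)).
exists (Num.min r d); split; first by rewrite lt_min d0 andbT; lra.
  by move=> j; apply: hol_le (h3 j); rewrite ge_min lexx.
by move=> t; rewrite lt_min => /andP [_ /Hd].
Qed.

Lemma open_discC (r : R) : open [set t : C | rn t < r].
Proof.
rewrite openE => t /= tr; suff : \forall u \near (t : C), [set t : C | rn t < r] u by [].
apply/nearP; exists (r - rn t); first by rewrite subr_gt0.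
by move=> y h /=; have := rn_le y t; lra.
Qed.

(** Turns flatness, stated by iterated directional derivatives, into bounds of every order.
    Smoothness of the composition is used in both directions. *)
Lemma flat_iff_bigo (U : set V) (F : V -> R) (gh : C -> V) : open U -> U 0 -> smooth_on U (liftC F) ->
  holo_at gh 0 -> gh 0 = 0 ->
  flat_at (liftC (F \o gh)) 0 <-> forall N, bigo N (fun t => liftC F (gh t)).
Proof.
move=> oU U0 sF hg g0; have [r [r0 hc HU]] := curve_in oU U0 hg g0.
have sc := smooth_comp_curve oU sF hc HU; have oD := @open_discC r.
have D0 : [set t : C | rn t < r] 0 by rewrite /= rn0.
split=> [fl N|H s]; first exact: (flat_bigo N oD D0 sc fl).
exact: (bigo_flat oD D0 sc (H (size s).+1) (leqnn _)).
Qed.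

Lemma flat_tangent Phi F gh : good_coord M p Phi F -> Gamma 0 gh -> flat_at (liftC (F \o gh)) 0 ->
  exists2 g, Gamma p g & tangent_inf (defr Phi F) g.
Proof.
move=> [Pp hP [Psi [hPsi Psi0 PsiK PhiK]] [[U [oU U0 sF]] [F0 dF]] _] [hg g0 gn] fl.
have L0 : zlift 0 = 0 :> W by rewrite /zlift row_mx0.
have hl : holo_at (fun t => zlift (gh t)) 0.
  by apply: (holo_comp g0 hg); apply/near0P; exists 1 => // x _; exact: zlift_differentiable.
have l0 : zlift (gh 0) = 0 by rewrite g0.
have hga : holo_at (fun t => Psi (zlift (gh t))) 0 := holo_comp (f := fun t => zlift (gh t)) l0 hl hPsi.
have cl : {for 0, continuous (fun t => zlift (gh t))}.
  by apply: differentiable_continuous; exact: nbhs_singleton hl.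
have nK := near_cont cl l0 PhiK.
exists (fun t => Psi (zlift (gh t))).
  split=> //; first by rewrite l0.
  (* A constant lift would give gh = 0 near 0, since [Phi] recovers [gh] from the lift. *)
  move=> H; apply: gn; near=> t.
  have e1 : Psi (zlift (gh t)) = p by near: t.
  have e2 : Phi (Psi (zlift (gh t))) = zlift (gh t) by near: t.
  by rewrite -[gh t]zpart_lift -e2 e1 Pp zpart0.
move=> N; apply/near_bigo.
apply: bigo_near ((flat_iff_bigo oU U0 sF hg g0).1 fl N).
apply: filterS nK => t e; rewrite /liftC /defr e zpart_lift wpart_lift /= mulr0 add0r //.
Unshelve. all: by end_near.
Qed.

Lemma pure_curve (U : set V) (F : V -> R) gh N : open U -> U 0 -> smooth_on U (liftC F) ->
  F 0 = 0 -> (forall v, rdiff (liftC F) v 0 = 0) -> curves (liftC F) -> holo_at gh 0 -> gh 0 = 0 ->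
  exists l, [/\ nice l, bigo N.+2 (fun t => liftC F (gh t) - (hp l (gh t) + (hp l (gh t))^*%C)) &
    forall k, (k < N.+2)%N -> taylorc (fun t => hp l (gh t)) k = compcoef F gh k].
Proof.
move=> oU U0 sF F0 dF cF hg g0; have [r [r0 hc HU]] := curve_in oU U0 hg g0.
have z0 : liftC F 0 = 0 by rewrite /liftC F0 rmorph0.
have [l Hl] := pure_exists oU U0 sF z0 dF cF N; exists l; split.
- by move=> q /Hl.1 /andP [].
- have [L [d [L0 d0 H]]] := holo_lip_row hg; apply: (bigo_comp L0 d0) Hl.2 => x xd.
  by have := H x 0; rewrite g0 !subr0; apply => //; rewrite rn0.
- by move=> k kN; exact: (compcoef_pure r0 hc g0 oU U0 sF Hl kN).
Qed.

Lemma tangent_converges Phi F g : good_coord M p Phi F -> BG_type_infinite (defr Phi F) p ->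
  Gamma p g -> tangent_inf (defr Phi F) g -> exists2 gh, Gamma 0 gh & S_comp_converges F gh.
Proof.
move=> G BG [hg g0 gn] tg; have cF := curves_of_BG G BG.
have [Pp hP [Psi [hPsi Psi0 PsiK PhiK]] [[U [oU U0 sF]] [F0 dF]] _] := G.
have hPg := holo_comp g0 hg hP.
have Q0 : Phi (g 0) = 0 by rewrite g0.
pose gh t := zpart (Phi (g t)); pose h t := wpart (Phi (g t)).
have hgh : holo_at gh 0.
  by apply: (holo_comp Q0 hPg); apply/near0P; exists 1 => // x _; exact: zpart_differentiable.
have hh : holo_at h 0.
  by apply: (holo_comp Q0 hPg); apply/near0P; exists 1 => // x _; exact: wpart_differentiable.
have gh0 : gh 0 = 0 by rewrite /gh Q0 zpart0.
have h0 : h 0 = 0 by rewrite /h Q0 wpart0.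
have [rh rh0 hhol] := holo_at_hol hh.
have tN N : bigo N (liftC (fun t => defr Phi F (g t))) by apply/near_bigo; exact: tg.
have half (f : C -> C) N : bigo N (fun t => (2 * complex.Re (f t))%:C : C) -> bigo N (fun t => (complex.Re (f t))%:C : C).
  move=> /(bigoZ 2^-1); apply: bigo_ext => t.
  by rewrite rmorphM rmorph_nat mulrA mulVf ?mul1r // pnatr_eq0.
exists gh.
  (* If [gh] vanished near 0, tangency would say Re h = O(t^N) for all N, so h = 0 and the curve [g]
     would be constant. *)
  split=> // gz; have hz N : bigo N (fun t => (complex.Re (h t))%:C : C).
    apply: half; apply: bigo_near (tN N); apply: filterS gz => t e.
    by rewrite /liftC /defr -/(gh t) -/(h t) e F0 addr0.
  have hnz := hol_zero rh0 hhol; apply: gn.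
  have cg : {for 0, continuous g} by apply: differentiable_continuous; exact: nbhs_singleton hg.
  have nK := near_cont cg g0 PsiK.
  have {}hnz : \forall t \near (0 : C), h t = 0.
    apply: hnz => -[|k]; first by rewrite taylorc0.
    by apply: (hol_Re_coef rh0 hhol (hz k.+2)); rewrite ltnSn.
  near=> t.
  have e1 : Psi (Phi (g t)) = g t by near: t.
  have e2 : gh t = 0 by near: t.
  have e3 : h t = 0 by near: t.
  rewrite -e1 -Psi0; congr Psi; apply: split_eq; first by rewrite zpart0.
  by rewrite wpart0.
have Ek k : compcoef F gh k = - taylorc h k.
  have [l [nl lO lc]] := pure_curve k oU U0 sF F0 dF cF hgh gh0.
  rewrite -(lc k (leqnSn _)).
  have [r [rho [K [h1 h2 _ hc _]]]] := holo_curve hgh.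
  pose r' := Num.min r rh; have r'0 : 0 < r' by rewrite lt_min rh0 andbT; lra.
  have hl : hol r' (fun t => hp l (gh t)).
    by apply: hol_le (hol_hp l hc); rewrite ge_min lexx.
  have hh' : hol r' h by apply: hol_le hhol; rewrite ge_min lexx orbT.
  apply/eqP; rewrite -addr_eq0; apply/eqP.
  have := congr1 (fun f => f k) (taylorcD r'0 hl hh'); rewrite /addf => <-.
  (* The constant coefficient is treated apart, since real parts do not determine it; both summands
     vanish at 0. *)
  case: k lO lc => [|k] lO lc.
    rewrite taylorc0 h0 addr0 gh0; exact: (bigo_at0 (hp_bigo2 nl)).
  apply: (hol_Re_coef (N := k.+3) r'0 (holD hl hh')); last by lia.
  apply: half; apply: bigo_ext (bigoB (tN k.+3) lO) => t.
  rewrite /liftC /defr -/(gh t) -/(h t) addJ cReD mulrDr !rmorphD /=; ring.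
have [rho [K [h1 h2 h3 h4]]] := hol_germ rh0 hhol.
have [Hb _ _] := hol_expand h1 h2 hhol h4.
exists rho; split=> // t; rewrite ltcP => tr.
apply: (series_cvg_geo (M := K) (s := rho^-1)).
- by move=> k; rewrite Ek rnN exprVn.
- by rewrite invr_ge0 ltW.
- by rewrite mulrC ltr_pdivrMr // mul1r.
Unshelve. all: by end_near.
Qed.

Lemma converges_flat Phi F gh : good_coord M p Phi F -> BG_type_infinite (defr Phi F) p ->
  Gamma 0 gh -> S_comp_converges F gh ->
  exists Phi' F', good_coord M p Phi' F' /\ flat_at (liftC (F' \o gh)) 0.
Proof.
move=> G BG Ggh [rho [rho0 /(series_geo_bound rho0) [K HK]]]; have cF := curves_of_BG G BG.
have [Pp hP [Psi [hPsi Psi0 PsiK PhiK]] [[U [oU U0 sF]] [F0 dF]] HM] := G.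
have [hg g0 gn] := Ggh; have pc N := pure_curve N oU U0 sF F0 dF cF hg g0.
have Hl N : exists2 l, nice l & forall k, (k < N)%N -> compcoef F gh k = taylorc (fun t => hp l (gh t)) k.
  have [l [nl _ lc]] := pc N; exists l => // k kN; rewrite lc //; lia.
have s0 : 0 < 2 / rho by rewrite divr_gt0.
have [Gf [rh [rh0 dG sG G2 GO]]] := analytic_approx Ggh s0 HK Hl.
have G0 : Gf 0 = 0 := bigo_at0 G2.
have hG : holo_at Gf 0 by apply/near0P; exists rh => // x xr; exact: dG.
pose e := @elast R n.
pose Phi' x := Phi x + Gf (zpart (Phi x)) *: e; pose F' z := F z - 2 * complex.Re (Gf z).
have hz : holo_at (@zpart R n) 0 by apply/near0P; exists 1 => // x _; exact: zpart_differentiable.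
have hGz : holo_at (fun y : W => Gf (zpart y)) 0 := holo_comp (f := @zpart R n) (zpart0 R n) hz hG.
(* The new coordinate has literally the same defining function, so it describes the same [M]. *)
have Edefr : defr Phi' F' = defr Phi F.
  by apply: funext => x; rewrite /defr /Phi' /F' zpart_elast wpart_elast cReD; ring.
have oV : open (U `&` ballV rh) by apply: openI => //; exact: open_ballV.
have V0 : (U `&` ballV rh) 0 by split=> //; rewrite /ballV /= rn0.
have sub (X Y : set V) (f : V -> C) : X `<=` Y -> smooth_on Y f -> smooth_on X f.
  by move=> XY H s v x /XY; exact: H.
have EF' : liftC F' = fun z => liftC F z + (-1) * (Gf z + (Gf z)^*%C).
  by apply: funext => z; rewrite addJ /liftC /F' rmorphB mulN1r.
have sF' : smooth_on (U `&` ballV rh) (liftC F').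
  have a1 := sub _ _ _ (@subIsetl _ U (ballV rh)) sF.
  have a2 := sub _ _ _ (@subIsetr _ U (ballV rh)) sG.
  move: (U `&` ballV rh) oV a1 a2 => X oX a1 a2; rewrite EF'.
  apply: (smooth_alg oX (B := smooth_on X)) => //.
  have b1 : alg (smooth_on X) (liftC F) by apply: alg_base.
  have b2 : alg (smooth_on X) Gf by apply: alg_base.
  exact: (alg_add b1 (alg_mul (alg_cst _ (-1)) (alg_add b2 (alg_conj b2)))).
have F'2 : bigo 2 (liftC F').
  have F2 : bigo 2 (liftC F) by apply: (smooth_bigo2 oU U0 sF) => //; rewrite /liftC F0 rmorph0.
  by rewrite EF'; exact: (bigoD F2 (bigoZ (-1) (bigoD G2 (bigo_J G2)))).
exists Phi', F'; split; last first.
  apply/(flat_iff_bigo oV V0 sF' hg g0) => N; have [l [nl lO lc]] := pc N.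
  have [r [rho' [K' [h1 h2 _ hc _]]]] := holo_curve hg; have r0 : 0 < r by lra.
  have H1 := hol_taylor N r0 (hol_hp l hc).
  have H2 := bigoB H1 (GO N).
  (* Up to O(t^N) along the curve, [F] agrees with 2 Re (hp l), [hp l] with the truncation of S o
     gh, and that truncation with [Gf]. *)
  have H3 := bigoD (bigo_le (leqW (leqnSn N)) lO) (bigoD H2 (bigo_J H2)).
  apply: bigo_ext H3 => t; rewrite EF'.
  have -> : \sum_(k < N) taylorc (fun t => hp l (gh t)) k * t ^+ k = \sum_(k < N) compcoef F gh k * t ^+ k.
    by apply: eq_bigr => k _; rewrite lc //; have := ltn_ord k; lia.
  move: (hp l (gh t)) (Gf (gh t)) (\sum_(k < N) _) => a b c.
  by rewrite !rmorphB /=; ring.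
split.
- by rewrite /Phi' Pp zpart0 G0 scale0r addr0.
- have hGP := holo_comp Pp hP hGz.
  near=> x; apply: differentiableD; first by near: x.
  by apply: differentiableZl; near: x.
(* The shear w -> w + G(z) leaves z fixed, so w -> w - G(z) inverts it exactly. *)
- pose sh (y : W) := y + (- Gf (zpart y)) *: e.
  have hsh : holo_at sh 0.
    near=> x; apply: differentiableD => //; apply: differentiableZl; apply: differentiableN.
    by near: x.
  have sh0 : sh 0 = 0 by rewrite /sh zpart0 G0 oppr0 scale0r addr0.
  exists (fun y => Psi (sh y)); split.
  + exact: (holo_comp sh0 hsh hPsi).
  + by rewrite sh0.
  + apply: filterS PsiK => x {2}<-; congr Psi; rewrite /sh /Phi' zpart_elast.
    by rewrite scaleNr addrK.
  + have csh : {for 0, continuous sh} by apply: differentiable_continuous; exact: nbhs_singleton hsh.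
    apply: filterS (near_cont csh sh0 PhiK) => y Ey.
    by rewrite /Phi' Ey {2}/sh zpart_elast /sh scaleNr subrK.
- split; first by exists (U `&` ballV rh).
  split; first by rewrite /F' F0 G0 /= mulr0 subr0.
  by move=> v; exact: (bigo_flat (s := [:: v]) oV V0 sF' F'2).
- by rewrite Edefr.
Unshelve. all: by end_near.
Qed.

End Main.

End Lemmas.

Theorem theorem6p3 (R : realType) (n : nat)
  (M : set 'rV[Cplx R]_(n + 1)) (p : 'rV[Cplx R]_(n + 1))
  (Phi0 : 'rV[Cplx R]_(n + 1) -> 'rV[Cplx R]_(n + 1)) (F0 : 'rV[Cplx R]_n -> R) :
  (0 < n)%N ->
  real_hypersurface M -> M p ->
  good_coord M p Phi0 F0 ->
  BG_type_infinite (defr Phi0 F0) p ->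
  ((exists gamma, Gamma p gamma /\ tangent_inf (defr Phi0 F0) gamma) <->
   (exists Phi F, good_coord M p Phi F /\
      exists gh, Gamma (0 : 'rV[Cplx R]_n) gh /\ flat_at (liftC (F \o gh)) 0)) /\
  ((exists Phi F, good_coord M p Phi F /\
      exists gh, Gamma (0 : 'rV[Cplx R]_n) gh /\ flat_at (liftC (F \o gh)) 0) <->
   (exists Phi F, good_coord M p Phi F /\
      exists gh, Gamma (0 : 'rV[Cplx R]_n) gh /\ S_comp_converges F gh)).
Proof.
move=> _ _ _ G0 BG0.
(* The implications run in a cycle. Condition (i) and the type refer to the given coordinate [Phi0],
   whereas (ii) and (iii) may involve another one; this is where the two transfer lemmas are
   applied. *)
have i_iii : (exists gamma, Gamma p gamma /\ tangent_inf (defr Phi0 F0) gamma) ->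
   exists Phi F, good_coord M p Phi F /\
      exists gh, Gamma (0 : 'rV[Cplx R]_n) gh /\ S_comp_converges F gh.
  move=> [g [Gg tg]]; exists Phi0, F0; split=> //.
  by have [gh h1 h2] := tangent_converges G0 BG0 Gg tg; exists gh.
have iii_ii : (exists Phi F, good_coord M p Phi F /\
      exists gh, Gamma (0 : 'rV[Cplx R]_n) gh /\ S_comp_converges F gh) ->
   exists Phi F, good_coord M p Phi F /\
      exists gh, Gamma (0 : 'rV[Cplx R]_n) gh /\ flat_at (liftC (F \o gh)) 0.
  move=> [Phi [F [G [gh [Ggh cv]]]]].
  have [Phi' [F' [G' fl]]] := converges_flat G (BG_transfer G0 G BG0) Ggh cv.
  by exists Phi', F'; split=> //; exists gh.
have ii_i : (exists Phi F, good_coord M p Phi F /\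
      exists gh, Gamma (0 : 'rV[Cplx R]_n) gh /\ flat_at (liftC (F \o gh)) 0) ->
   exists gamma, Gamma p gamma /\ tangent_inf (defr Phi0 F0) gamma.
  move=> [Phi [F [G [gh [Ggh fl]]]]]; have [g Gg tg] := flat_tangent G Ggh fl.
  exists g; split=> //; have [hg gp _] := Gg; exact: (tangent_transfer G G0 hg gp tg).
by split; split; auto.
Qed.
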